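(* Let $(E,C)$ be an adaptable separated graph, let $S(E,C)$ be its associated inverse semigroup, and let $C^*(S(E,C))$ be the universal $C^*$-algebra defined by the generators $E^0\cup E^1\cup\{(t_i^v)^{\pm1}:i\in\mathbb N,\ v\in E^0\}$ and the relations (R1)–(R10). Then there is an isomorphism $$C^*(S(E,C))\cong C^*(\mathcal G_{tight}(S(E,C)))$$ sending $\iota(s)\in C^*(S(E,C))$ to $1_{\Theta(s,D_{s^*s})}$ for each $s\in S(E,C)$. Here (R1)–(R10) are the relations listed in the context.
   Context: **Adaptable separated graphs.** $\mathbb N=\{1,2,\dots\}$. For a directed graph $E=(E^0,E^1,s,r)$, paths are $e_1\cdots e_n$ with $r(e_i)=s(e_{i+1})$; vertices are paths of length $0$. A separated graph $(E,C)$ is a directed graph $E$ with $C=\bigsqcup_{v\in E^0}C_v$, where $C_v$ is a partition of $s^{-1}(v)$ into nonempty subsets ($C_v=\emptyset$ if $v$ is a sink). It is finitely separated if all sets in $C$ are finite. Put $v\le w$ if there is a path from $w$ to $v$; let $(I,\le)$ be the antisymmetrization of $(E^0,\le)$, whose elements are the transitive components. A finitely separated graph $(E,C)$ is adaptable if $I$ is finite and there are a partition $I=I_{free}\sqcup I_{reg}$ and subgraphs $(E_p)_{p\in I}$, with $E_p^0$ the vertex set of the component $p$, such that: (1) $E^0=\bigsqcup_p E_p^0$; $E_p$ is a transitive (any two vertices joined by a directed path) row-finite graph if $p\in I_{reg}$; $E_p^0=\{v^p\}$ if $p\in I_{free}$. (2) For $p\in I_{reg}$, $w\in E_p^0$: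 $|C_w|=1$, $|s_{E_p}^{-1}(w)|\ge 2$, and every edge with source $w$ lies in $E_p$ or has range in $E_q^0$ with $q<p$. (3) For $p\in I_{free}$: $s^{-1}(v^p)=\emptyset$ iff $p$ is minimal in $I$ (then put $k(p)=0$). If $p$ is not minimal, $C_{v^p}=\{X_1^{(p)},\dots,X_{k(p)}^{(p)}\}$ is finite with $X_i^{(p)}=\{\alpha(p,i),\beta(p,i,1),\dots,\beta(p,i,g(p,i))\}$, $g(p,i)\ge1$, $\alpha(p,i)$ a loop at $v^p$, $r(\beta(p,i,t))\in E_q^0$ with $q<p$; and $E_p^1=\{\alpha(p,1),\dots,\alpha(p,k(p))\}$. **The inverse semigroup $S(E,C)$.** It is the $*$-semigroup with $0$ ($*$-semigroup: $s^{**}=s$, $(st)^*=t^*s^*$) generated by $E^0\cup E^1\cup\{(t_i^v)^{\pm1}: i\in\mathbb N,v\in E^0\}$ with relations: (R1) $vw=\delta_{v,w}v$, $v^*=v$ for $v,w\in E^0$; (R2) $e=s(e)e=er(e)$ for $e\in E^1$, and $e^*f=\delta_{e,f}r(e)$ for $e,f$ in the same set $X\in C$; (R3) for $p\in I_{free}$, $i\ne j$: $\alpha(p,i)\alpha(p,j)=\alpha(p,j)\alpha(p,i)$, $\alpha(p,i)\alpha(p,j)^*=\alpha(p,j)^*\alpha(p,i)$; (R4) for $p\in I_{free}$: $\beta(p,i,s)^*\beta(p,j,t)=0$ if $(i,s)\neq(j,t)$; (R5) for each $v$ the elements $(t_i^v)^{\pm1}$ commute mutually, $vt_i^v=t_i^v=t_i^vv$,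 $t_i^v(t_i^v)^{-1}=v=(t_i^v)^{-1}t_i^v$, $(t_i^v)^*=(t_i^v)^{-1}$; (R6) $t_i^{s(e)}e=e\,t_i^{r(e)}$ if $s(e)\in E_p^0$, $p\in I_{reg}$; (R7) for $p\in I_{free}$: $(t_i^{v^p})^{\pm1}\beta(p,j,s)=\beta(p,j,s)(t^{r(\beta(p,j,s))}_{i+k(p)-1})^{\pm1}$; (R8) for $p\in I_{free}$, $i\ne j$: $\alpha(p,i)\beta(p,j,s)=\beta(p,j,s)t^{r(\beta(p,j,s))}_{\sigma_j^p(i)}$ and $\alpha(p,i)^*\beta(p,j,s)=\beta(p,j,s)(t^{r(\beta(p,j,s))}_{\sigma_j^p(i)})^{-1}$, where $\sigma_j^p$ is the increasing bijection $\{1,\dots,k(p)\}\setminus\{j\}\to\{1,\dots,k(p)-1\}$; (R9) for $p\in I_{free}$: $t_i^{v^p}$ commutes with $\alpha(p,j)$ and $\alpha(p,j)^*$. $S(E,C)$ is an inverse semigroup; $\mathcal E$ is its semilattice of idempotents ($e\le f$ iff $ef=e$). **Additional relation.** (R10) $v=\sum_{e\in X}ee^*$ for all $v\in E^0$, $X\in C_v$. The map $\iota\colon S(E,C)\to C^*(S(E,C))$ is the canonical $*$-homomorphism of semigroups, the identity on generators. **Tight groupoid.** A filter on $\mathcal E$ is a nonempty $\eta\subseteq\mathcal E$ with $0\notin\eta$, closed under products and upward closed. Filters are topologized as a subspace of $\{0,1\}^{\mathcal E}$. A finite cover of $\mathcal F_e=\{f\in\mathcal E:f\le e\}$ is a finite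 $Z\subseteq\mathcal F_e$ such that every $0\ne f\in\mathcal F_e$ has $fz\neq0$ for some $z\in Z$. A filter $\eta$ is tight if $e\in\eta$ implies $Z\cap\eta\ne\emptyset$ for every finite cover $Z$ of $\mathcal F_e$; $\widehat{\mathcal E}_{tight}$ is the space of tight filters. For $e\in\mathcal E$ let $D_e=\{\eta\in\widehat{\mathcal E}_{tight}: e\in\eta\}$; $s\in S(E,C)$ acts by $\alpha_s\colon D_{s^*s}\to D_{ss^*}$, $\alpha_s(\eta)=\{f\in\mathcal E: s^*fs\in\eta\}$. $\mathcal G_{tight}(S(E,C))$ is the groupoid of germs $[s,x]$, $x\in D_{s^*s}$, where $[s,x]=[s',y]$ iff $x=y$ and $sf=s'f$ for some $f\in\mathcal E$ with $f\in x$; source $x$, range $\alpha_s(x)$, $[s,\alpha_t(x)][t,x]=[st,x]$, $[s,x]^{-1}=[s^*,\alpha_s(x)]$. Its topology is generated by $\Theta(s,U)=\{[s,x]:x\in U\}$, $U\subseteq D_{s^*s}$ open. It is an ample Hausdorff groupoid. $C^*(\mathcal G)$ denotes the full groupoid $C^*$-algebra, and $1_B$ the characteristic function of a compact open bisection $B$. *)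

(* Defs.v *)
From HB Require Import structures.
From mathcomp Require Import all_boot all_order all_algebra.
From mathcomp Require Import generic_quotient complex.
From mathcomp Require Import all_classical all_reals all_analysis.

Set Implicit Arguments.
Unset Strict Implicit.
Unset Printing Implicit Defensive.
Import Order.TTheory GRing.Theory Num.Theory.
Import numFieldNormedType.Exports.
Local Open Scope classical_set_scope.
Local Open Scope quotient_scope.
Local Open Scope ring_scope.

Record sepGraph := SepGraph {
  vert : choiceType;
  edge : choiceType;
  src : edge -> vert;
  rng : edge -> vert;
  blocks : vert -> set (set edge);
  blocks_partition :
    forall v, partition (blocks v) id (src @^-1` [set v]) }.

Section Graphs.
Variable G : sepGraph.

(* [es] is a path from [v] to [w] all of whose edges lie in [A]. *)
Fixpoint walk (A : set (edge G)) (v : vert G) (es : seq (edge G))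
    (w : vert G) : Prop :=
  if es is e :: es' then [/\ A e, src e = v & walk A (rng e) es' w] else v = w.

Definition finitely_separated :=
  forall (v : vert G) (X : set (edge G)), blocks v X -> finite_set X.

Definition vle (v w : vert G) := exists es, walk setT w es v.

(* The antisymmetrization [I]: its elements are the classes of the
   equivalence relation "v <= w and w <= v", as sets of vertices, so that
   [val p] is the vertex set $E_p^0$ of the component [p]. *)
Definition tcomp := set_type
  [set p : set (vert G) | exists v, p = [set w | vle v w /\ vle w v]].

Definition tle (p q : tcomp) := exists v w, [/\ val p v, val q w & vle v w].

Definition tlt (p q : tcomp) := tle p q /\ p <> q.

Definition tminimal (p : tcomp) := forall q, tle q p -> q = p.

Definition free_block n (a : edge G) (b : 'I_n -> edge G) : set (edge G) :=
  a |` range b.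

(* [free] is $I_{free}$, its complement is $I_{reg}$, and [sub_edge p] is the
   edge set $E_p^1$. Indices start at [0], so that [alpha p i], [beta p i t]
   stand for $\alpha(p,i+1)$, $\beta(p,i+1,t+1)$. The values of [fvert],
   [fdeg], [fbeta], [alpha] and [beta] outside of [free] are irrelevant. *)
Record adaptable := Adaptable {
  ad_finsep : finitely_separated;
  ad_finite : finite_set [set: tcomp];
  free : set tcomp;
  sub_edge : tcomp -> set (edge G);
  sub_edgeP : forall p e, sub_edge p e -> val p (src e) /\ val p (rng e);
  fvert : tcomp -> vert G;
  fdeg : tcomp -> nat;                                         (* k(p) *)
  fbeta : forall p, 'I_(fdeg p) -> nat;                        (* g(p,i) *)
  alpha : forall p, 'I_(fdeg p) -> edge G;
  beta : forall p (i : 'I_(fdeg p)), 'I_(fbeta i) -> edge G;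
  reg_transitive : forall p, ~ free p -> forall v w, val p v -> val p w ->
    exists es, walk (sub_edge p) v es w;
  reg_rowfinite : forall p, ~ free p -> forall v, val p v ->
    finite_set [set e | sub_edge p e /\ src e = v];
  free_vert : forall p, free p -> val p = [set fvert p];
  reg_block : forall p, ~ free p -> forall w, val p w ->
    exists X, blocks w = [set X];
  reg_two : forall p, ~ free p -> forall w, val p w ->
    exists e f, [/\ sub_edge p e, sub_edge p f, src e = w, src f = w & e <> f];
  reg_edge : forall p, ~ free p -> forall e, val p (src e) ->
    sub_edge p e \/ exists2 q, tlt q p & val q (rng e);
  free_sink : forall p, free p ->
    ((@src G @^-1` [set fvert p] = set0) <-> tminimal p);
  free_min_deg : forall p, free p -> tminimal p -> fdeg p = 0%N;
  free_blocks : forall p, free p -> ~ tminimal p ->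
    blocks (fvert p) =
    range (fun i => free_block (alpha i) (@beta p i));
  free_blocks_inj : forall p, free p -> ~ tminimal p ->
    injective (fun i => free_block (alpha i) (@beta p i));
  free_beta_gt0 : forall p, free p -> ~ tminimal p ->
    forall i : 'I_(fdeg p), (0 < fbeta i)%N;
  free_beta_inj : forall p, free p -> ~ tminimal p ->
    forall i : 'I_(fdeg p), injective (@beta p i);
  free_alpha : forall p, free p -> ~ tminimal p -> forall i : 'I_(fdeg p),
    src (alpha i) = fvert p /\ rng (alpha i) = fvert p;
  free_beta : forall p, free p -> ~ tminimal p ->
    forall (i : 'I_(fdeg p)) (t : 'I_(fbeta i)),
    exists2 q, tlt q p & val q (rng (beta t));
  free_edge : forall p, free p -> ~ tminimal p ->
    sub_edge p = range (@alpha p) }.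

End Graphs.

Inductive sterm (X : Type) :=
  | SZero
  | SGen of X
  | SMul of sterm X & sterm X
  | SStar of sterm X.
Arguments SZero {X}.

Declare Scope sterm_scope.
Delimit Scope sterm_scope with sterm.
Bind Scope sterm_scope with sterm.
Notation "0" := SZero : sterm_scope.
Notation "x * y" := (SMul x y) : sterm_scope.
Notation "x ^*" := (SStar x) : sterm_scope.

HB.instance Definition _ (X : Type) := gen_eqMixin (sterm X).
HB.instance Definition _ (X : Type) := gen_choiceMixin (sterm X).

Section Presentation.
Variables (X : Type) (rel : sterm X -> sterm X -> Prop).
Local Open Scope sterm_scope.

(* The least congruence containing [rel] modulo which terms form a
   *-semigroup with zero. *)
Inductive scong : sterm X -> sterm X -> Prop :=
  | scong_refl x : scong x x
  | scong_sym x y : scong x y -> scong y x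
  | scong_trans x y z : scong x y -> scong y z -> scong x z
  | scong_mul x x' y y' : scong x x' -> scong y y' -> scong (x * y) (x' * y')
  | scong_star x x' : scong x x' -> scong x^* x'^*
  | scong_mulA x y z : scong (x * (y * z)) (x * y * z)
  | scong_mul0 x : scong (0 * x) 0
  | scong_0mul x : scong (x * 0) 0
  | scong_starK x : scong x^*^* x
  | scong_starM x y : scong (x * y)^* (y^* * x^*)
  | scong_rel x y : rel x y -> scong x y.

Definition scongb (x y : sterm X) : bool := `[< scong x y >].

Lemma scongb_refl : reflexive scongb.
Proof. by move=> x; apply/asboolP; exact: scong_refl. Qed.

Lemma scongb_sym : symmetric scongb.
Proof. by move=> x y; apply/asboolP/asboolP; exact: scong_sym. Qed.

Lemma scongb_trans : transitive scongb.
Proof.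
move=> y x z /asboolP xy /asboolP yz; apply/asboolP.
exact: scong_trans xy yz.
Qed.

Canonical scong_equiv := EquivRel scongb scongb_refl scongb_sym scongb_trans.

Definition psemi := {eq_quot scong_equiv}.
HB.instance Definition _ := Choice.on psemi.

Definition pcls (x : sterm X) : psemi := \pi_psemi x.
Definition pzero : psemi := pcls 0.
Definition pmul (s t : psemi) : psemi := pcls (repr s * repr t).
Definition pstar (s : psemi) : psemi := pcls (repr s)^*.

Lemma pclsP x y : pcls x = pcls y <-> scong x y.
Proof. by split=> [/eqmodP/asboolP|xy]; last by apply/eqmodP/asboolP. Qed.

Lemma pcls_repr x : scong (repr (pcls x)) x.
Proof. by apply/pclsP; rewrite /pcls reprK. Qed.

Lemma pmul_cls x y : pmul (pcls x) (pcls y) = pcls (x * y).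
Proof. by apply/pclsP; apply: scong_mul; exact: pcls_repr. Qed.

Lemma pstar_cls x : pstar (pcls x) = pcls x^*.
Proof. by apply/pclsP; apply: scong_star; exact: pcls_repr. Qed.

End Presentation.

(* [gT b i v] is $t_{i+1}^v$ for [b = false], its inverse for [b = true]. *)
Inductive sgen (G : sepGraph) :=
  | gV of vert G
  | gE of edge G
  | gT of bool & nat & vert G.

Section InverseSemigroup.
Variables (G : sepGraph) (A : adaptable G).
Local Open Scope sterm_scope.

Let V (v : vert G) := SGen (gV v).
Let E (e : edge G) := SGen (gE e).
Let T (b : bool) (i : nat) (v : vert G) := SGen (gT b i v).

(* As indices start at [0], [R7] still shifts by $k(p)-1$, and the increasing
   bijection $\sigma_j^p$ of [R8] is [unbump j]. *)
Inductive srel : sterm (sgen G) -> sterm (sgen G) -> Prop :=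
  | R1_idem v : srel (V v * V v) (V v)
  | R1_orth v w : v <> w -> srel (V v * V w) 0
  | R1_star v : srel (V v)^* (V v)
  | R2_src e : srel (V (src e) * E e) (E e)
  | R2_rng e : srel (E e * V (rng e)) (E e)
  | R2_iso v X e : blocks v X -> X e -> srel ((E e)^* * E e) (V (rng e))
  | R2_orth v X e f : blocks v X -> X e -> X f -> e <> f ->
      srel ((E e)^* * E f) 0
  | R3_comm p (i j : 'I_(fdeg A p)) : free A p -> i <> j ->
      srel (E (alpha i) * E (alpha j)) (E (alpha j) * E (alpha i))
  | R3_comm_star p (i j : 'I_(fdeg A p)) : free A p -> i <> j ->
      srel (E (alpha i) * (E (alpha j))^*) ((E (alpha j))^* * E (alpha i))
  | R4 p (i j : 'I_(fdeg A p)) (s : 'I_(fbeta i)) (t : 'I_(fbeta j)) :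
      free A p ->
      (nat_of_ord i, nat_of_ord s) <> (nat_of_ord j, nat_of_ord t) ->
      srel ((E (beta s))^* * E (beta t)) 0
  | R5_comm v b c i j : srel (T b i v * T c j v) (T c j v * T b i v)
  | R5_left v i : srel (V v * T false i v) (T false i v)
  | R5_right v i : srel (T false i v * V v) (T false i v)
  | R5_mulV v i : srel (T false i v * T true i v) (V v)
  | R5_Vmul v i : srel (T true i v * T false i v) (V v)
  | R5_star v i : srel (T false i v)^* (T true i v)
  | R6 p e i : ~ free A p -> val p (src e) ->
      srel (T false i (src e) * E e) (E e * T false i (rng e))
  | R7 p (j : 'I_(fdeg A p)) (s : 'I_(fbeta j)) b i : free A p ->
      srel (T b i (fvert A p) * E (beta s))
           (E (beta s) * T b (i + fdeg A p - 1)%N (rng (beta s)))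
  | R8 p (i j : 'I_(fdeg A p)) (s : 'I_(fbeta j)) : free A p -> i <> j ->
      srel (E (alpha i) * E (beta s))
           (E (beta s) * T false (unbump j i) (rng (beta s)))
  | R8_star p (i j : 'I_(fdeg A p)) (s : 'I_(fbeta j)) : free A p -> i <> j ->
      srel ((E (alpha i))^* * E (beta s))
           (E (beta s) * T true (unbump j i) (rng (beta s)))
  | R9 p (j : 'I_(fdeg A p)) i : free A p ->
      srel (T false i (fvert A p) * E (alpha j))
           (E (alpha j) * T false i (fvert A p))
  | R9_star p (j : 'I_(fdeg A p)) i : free A p ->
      srel (T false i (fvert A p) * (E (alpha j))^*)
           ((E (alpha j))^* * T false i (fvert A p)).

Definition SE := psemi srel.
HB.instance Definition _ := Choice.on SE.

End InverseSemigroup.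

Declare Scope SE_scope.
Delimit Scope SE_scope with SE.
Bind Scope SE_scope with SE.
Notation "0" := (pzero _) : SE_scope.
Notation "s * t" := (pmul s t) : SE_scope.
Notation "s ^*" := (pstar s) : SE_scope.

Section TightGroupoid.
Variables (G : sepGraph) (A : adaptable G).
Local Notation S := (SE A).
Local Open Scope SE_scope.

Definition idem : set S := [set e | e * e = e].

Definition ile (e f : S) := e * f = e.

(* A filter on the semilattice [idem], as a subset of [S]. *)
Definition is_filter (eta : set S) :=
  [/\ eta !=set0, eta `<=` idem, ~ eta 0,
      (forall e f, eta e -> eta f -> eta (e * f)) &
      (forall e f, eta e -> idem f -> ile e f -> eta f)].

Definition below (e : S) : set S := [set f | idem f /\ ile f e].

Definition finite_cover (e : S) (Z : set S) :=
  [/\ finite_set Z, Z `<=` below e &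
      forall f, below e f -> f <> 0 -> exists2 z, Z z & f * z <> 0].

Definition is_tight (eta : set S) :=
  is_filter eta /\
  forall e Z, eta e -> finite_cover e Z -> Z `&` eta !=set0.

Definition tight_set := set_type [set eta : set S | is_tight eta].

Definition filter_indicator (eta : tight_set) :
    prod_topology (fun _ : set_type idem => bool) :=
  fun e => `[< val eta (val e) >].

(* The tight spectrum, as a subspace of {0,1}^idem. *)
Definition tight := initial_topology filter_indicator.
HB.instance Definition _ := Topological.on tight.

Definition Dom (e : S) : set tight := [set eta | val eta e].

Definition act (s : S) (eta : set S) : set S :=
  [set f | idem f /\ eta (s^* * f * s)].

(* The germ [s,x], as an equivalence class of pairs. *)
Definition germ_class (s : S) (x : tight) : set (S * tight) :=
  [set p | [/\ Dom (p.1^* * p.1) p.2, p.2 = x &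
               exists2 f, val x f & s * f = p.1 * f]].

Definition germ := set_type
  [set g : set (S * tight) |
    exists s x, Dom (s^* * s) x /\ g = germ_class s x].
HB.instance Definition _ := Choice.on germ.

Definition is_germ (g : germ) (s : S) (x : tight) :=
  Dom (s^* * s) x /\ val g = germ_class s x.

Definition Theta (s : S) (U : set tight) : set germ :=
  [set g | exists2 x, U x & is_germ g s x].

HB.instance Definition _ := isSubBaseTopological.Build germ
  [set O | exists s U, [/\ open U, U `<=` Dom (s^* * s) & O = Theta s U]]
  (id : set germ -> set germ).

(* [germ_mul g h k] says that [g] and [h] are composable with product [k]. *)
Definition germ_mul (g h k : germ) :=
  exists s t x y, [/\ val y = act t (val x), is_germ g s y, is_germ h t x &
                      is_germ k (s * t) x].

(* The inverse of [g], selected from its graph. *)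
Definition germ_inv (g : germ) : germ :=
  xget g [set h | exists s x y,
    [/\ val y = act s (val x), is_germ g s x & is_germ h s^* y]].

End TightGroupoid.

Record cstarAlg (R : realType) := CStarAlg {
  csort :> completeNormedModType R[i];
  cmul : csort -> csort -> csort;
  cstar : csort -> csort;
  cmulA : associative cmul;
  cmulDl : left_distributive cmul +%R;
  cmulDr : right_distributive cmul +%R;
  cmulZl : forall (a : R[i]) x y, cmul (a *: x) y = a *: cmul x y;
  cmulZr : forall (a : R[i]) x y, cmul x (a *: y) = a *: cmul x y;
  cstarK : involutive cstar;
  cstarD : {morph cstar : x y / x + y};
  cstarZ : forall (a : R[i]) x, cstar (a *: x) = a^* *: cstar x;
  cstarM : forall x y, cstar (cmul x y) = cmul (cstar y) (cstar x);
  cnormM : forall x y, `|cmul x y| <= `|x| * `|y|;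
  cnorm_star : forall x, `|cmul (cstar x) x| = `|x| ^+ 2 }.

Section CStarAlgebras.
Variable R : realType.

Record is_star_hom (A B : cstarAlg R) (Phi : A -> B) : Prop := IsStarHom {
  star_homD : {morph Phi : x y / x + y};
  star_homZ : forall (a : R[i]) x, Phi (a *: x) = a *: Phi x;
  star_homM : forall x y, Phi (cmul x y) = cmul (Phi x) (Phi y);
  star_hom_star : forall x, Phi (cstar x) = cstar (Phi x) }.

Definition is_star_iso (A B : cstarAlg R) (Phi : A -> B) :=
  is_star_hom Phi /\ bijective Phi.

Fixpoint seval X (A : cstarAlg R) (phi : X -> A) (t : sterm X) : A :=
  match t with
  | SZero => 0
  | SGen x => phi x
  | SMul t u => cmul (seval phi t) (seval phi u)
  | SStar t => cstar (seval phi t)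
  end.

Section Universal.
Variables (G : sepGraph) (A : adaptable G).

Definition satisfies_R1_R10 (B : cstarAlg R) (phi : sgen G -> B) :=
  (forall t u, srel A t u -> seval phi t = seval phi u) /\
  (forall v (X : set (edge G)), blocks v X ->
     phi (gV v) = \sum_(e \in X) cmul (phi (gE e)) (cstar (phi (gE e)))).

Definition is_universal (B : cstarAlg R) (phi : sgen G -> B) :=
  satisfies_R1_R10 phi /\
  forall (D : cstarAlg R) (psi : sgen G -> D), satisfies_R1_R10 psi ->
    exists! Phi : B -> D, is_star_hom Phi /\ forall g, Phi (phi g) = psi g.

(* The value of [iotaS] does not depend on the representative, see
   [iotaS_cls] below. *)
Definition iotaS (B : cstarAlg R) (phi : sgen G -> B) (s : SE A) : B :=
  seval phi (repr s).

Lemma iotaS_cls (B : cstarAlg R) (phi : sgen G -> B) t :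
  satisfies_R1_R10 phi -> iotaS phi (pcls (srel A) t) = seval phi t.
Proof.
move=> [rphi _]; have mul0 (x : B) : cmul 0 x = 0.
  by rewrite -(scale0r x) cmulZl !scale0r.
have mulr0 (x : B) : cmul x 0 = 0.
  by rewrite -(scale0r x) cmulZr !scale0r.
have evalP u u' : scong (srel A) u u' -> seval phi u = seval phi u'.
  elim=> //= {u u'}.
  - by move=> x y z _ -> _ ->.
  - by move=> x x' y y' _ -> _ ->.
  - by move=> x x' _ ->.
  - by move=> x y z; exact: cmulA.
  - by move=> x; exact: cstarK.
  - by move=> x y; exact: cstarM.
exact/evalP/pcls_repr.
Qed.

End Universal.

Section FullGroupoid.
Variables (G : sepGraph) (A : adaptable G).
Local Notation gG := (germ A).

Definition Cc : set (gG -> R[i]) :=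
  [set f | continuous (f : gG -> R[i]^o) /\
           compact (closure [set g | f g != 0])].

(* For [f1], [f2] in [Cc] this sum has finite support. *)
Definition groupoid_conv (f1 f2 : gG -> R[i]) : gG -> R[i] := fun k =>
  \sum_(gh \in [set gh : gG * gG | germ_mul gh.1 gh.2 k]) (f1 gh.1 * f2 gh.2).

Definition groupoid_star (f : gG -> R[i]) : gG -> R[i] :=
  fun g => (f (germ_inv g))^*.

(* A *-representation of the convolution algebra [Cc] in a C*-algebra; its
   values outside of [Cc] are irrelevant. *)
Record is_Cc_rep (B : cstarAlg R) (pi : (gG -> R[i]) -> B) : Prop := IsCcRep {
  Cc_repD : forall f1 f2, Cc f1 -> Cc f2 ->
    pi (fun g => f1 g + f2 g) = pi f1 + pi f2;
  Cc_repZ : forall (a : R[i]) f, Cc f -> pi (fun g => a * f g) = a *: pi f;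
  Cc_repM : forall f1 f2, Cc f1 -> Cc f2 ->
    pi (groupoid_conv f1 f2) = cmul (pi f1) (pi f2);
  Cc_rep_star : forall f, Cc f -> pi (groupoid_star f) = cstar (pi f) }.

(* [B] is the completion of [Cc] for the norm that takes [f] to the supremum
   of the norms [`|pi f|] over all *-representations [pi]. This supremum is
   [`|j f|] as soon as it is a bound, since [j] is one of the [pi]. *)
Record is_full_groupoid_cstar (B : cstarAlg R) (j : (gG -> R[i]) -> B)
    : Prop := IsFullGroupoidCStar {
  full_rep : is_Cc_rep j;
  full_dense : dense (j @` Cc);
  full_norm : forall (D : cstarAlg R) (pi : (gG -> R[i]) -> D),
    is_Cc_rep pi -> forall f, Cc f -> `|pi f| <= `|j f| }.

End FullGroupoid.

End CStarAlgebras.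

(* Main.v *)
(* Every element of S = S(E,C) is 0 or a b^* with a, b products of generators
   along paths, and S acts on normal forms of such products; hence S is
   E^*-unitary, so that the bisections Theta(s) = Theta(s, D_{s^*s}) are closed
   under finite intersections. Relation (R10) says exactly that the image of
   the idempotents respects the finite covers given by the blocks, and these
   imply all finite covers. A finite sum of elements a_i i(s_i) is therefore
   bounded by a constant times the supremum of the function sum a_i 1_{Theta(s_i)},
   the constant depending only on the support, so that 1_{Theta(s)} |-> i(s)
   extends to a representation of C_c(G). Conversely a representation pi of
   C_c(G) is bounded in the same way (on a bisection, functions with values in
   [-1, 1] are averages of functions with values in the unit circle), and
   s |-> pi(1_{Theta(s)}) satisfies (R1)-(R10). Both universal properties thus
   concern the same representations. *)
Require Import Defs.
From HB Require Import structures.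
From mathcomp Require Import all_boot all_order all_algebra.
From mathcomp Require Import generic_quotient complex.
From mathcomp Require Import all_classical all_reals all_analysis.
From mathcomp Require Import finmap ring lra zify.
(* [free] would otherwise be that of [vector]. *)
Import Defs.

Set Implicit Arguments.
Unset Strict Implicit.
Unset Printing Implicit Defensive.
Import Order.TTheory GRing.Theory Num.Theory.
Import numFieldNormedType.Exports.
Local Open Scope classical_set_scope.
Local Open Scope quotient_scope.
Local Open Scope ring_scope.

(** * The inverse semigroup *)

(** The presentation gives no product formula, and neither $ss^*s=s$ nor commuting idempotents are
    part of it. Both are derived from an Ore condition between single generators, checked by cases
    on the type of edge. Equalities thus come from the relations, whereas distinctness needs the
    model on normal forms. On the analytic side little more than completeness and the C*-identity is
    used. A bound on the powers $x^{2^n}$ of a self-adjoint $x$ loses any constant factor, and the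
    missing unit is bypassed by elements $z$ for which $1+z$ would be unitary. The estimates on
    $C_c$ carry as a factor the number of bisections that cover the support. This is harmless: they
    serve only to approximate functions uniformly with a fixed support, and exact comparisons of
    norms come from contractivity of star-homomorphisms. Both algebras must also be shown to exist;
    one construction does this, completing formal combinations of terms for uniform convergence over
    all representations. *)

Section PresentedSemigroup.
Variables (X : Type) (rel : sterm X -> sterm X -> Prop).
Local Open Scope SE_scope.
Local Notation S := (psemi rel).
Implicit Types s t u : S.

Lemma pcls_surj s : exists x, s = pcls rel x.
Proof. by exists (repr s); rewrite /pcls reprK. Qed.

Lemma spmulA s t u : s * (t * u) = s * t * u.
Proof.
have [x ->] := pcls_surj s; have [y ->] := pcls_surj t.
have [z ->] := pcls_surj u.
by rewrite !pmul_cls; apply/pclsP; exact: scong_mulA.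
Qed.

Lemma spmul0l s : 0 * s = 0.
Proof.
have [x ->] := pcls_surj s; rewrite /pzero pmul_cls.
by apply/pclsP; exact: scong_mul0.
Qed.

Lemma spmul0r s : s * 0 = 0.
Proof.
have [x ->] := pcls_surj s; rewrite /pzero pmul_cls.
by apply/pclsP; exact: scong_0mul.
Qed.

Lemma spstarK s : s^*^* = s.
Proof.
have [x ->] := pcls_surj s; rewrite !pstar_cls.
by apply/pclsP; exact: scong_starK.
Qed.

Lemma spstarM s t : (s * t)^* = t^* * s^*.
Proof.
have [x ->] := pcls_surj s; have [y ->] := pcls_surj t.
rewrite pmul_cls !pstar_cls pmul_cls.
by apply/pclsP; exact: scong_starM.
Qed.

Lemma spstar0 : (0 : S)^* = 0.
Proof. by rewrite -{1}(spmul0r (0 : S)^*) spstarM spstarK spmul0r. Qed.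

Lemma pcls_rel x y : rel x y -> pcls rel x = pcls rel y.
Proof. by move=> xy; apply/pclsP; exact: scong_rel. Qed.

End PresentedSemigroup.

(** * Transitive components of the graph *)

Section Components.
Variable G : sepGraph.

Lemma vle_refl (v : vert G) : vle v v. Proof. by exists [::]. Qed.

Lemma walk_cat (B : set (edge G)) u v w es fs :
  walk B u es v -> walk B v fs w -> walk B u (es ++ fs) w.
Proof.
elim: es u => [|e es IH] u /=; first by move=> ->.
by case=> Be su esv fsw; split => //; exact: IH.
Qed.

Lemma vle_trans (u v w : vert G) : vle u v -> vle v w -> vle u w.
Proof.
by move=> [es vu] [fs wv]; exists (fs ++ es); exact: walk_cat wv vu.
Qed.

Lemma component_proof (v : vert G) :
  exists w, [set w | vle v w /\ vle w v] = [set u | vle w u /\ vle u w].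
Proof. by exists v. Qed.

Definition component (v : vert G) : tcomp G :=
  SigSub (mem_set (component_proof v)).

Lemma component_mem v : val (component v) v.
Proof. by split; exact: vle_refl. Qed.

Lemma componentE (p : tcomp G) v : val p v -> p = component v.
Proof.
case: p => p pP /= pv; apply: val_inj => /=.
have [w pw] := set_mem pP; subst p.
have [wv vw] := pv; apply/seteqP; split=> u [] h1 h2 /=.
  by split; [exact: vle_trans vw h1|exact: vle_trans h2 wv].
by split; [exact: vle_trans wv h1|exact: vle_trans h2 vw].
Qed.

End Components.

(** * The Ore condition and the inverse semigroup property *)

Section Semigroup.
Variables (G : sepGraph) (A : adaptable G).
Local Notation S := (SE A).
Local Open Scope SE_scope.
Implicit Types (v w : vert G) (e f : edge G).

Definition gen (x : sgen G) : S := pcls (srel A) (SGen x).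
Local Notation V := (fun v => gen (gV v)).
Local Notation E := (fun e => gen (gE e)).
Local Notation T := (fun b i v => gen (gT b i v)).

Lemma genV_idem v : V v * V v = V v.
Proof. by rewrite pmul_cls; apply: pcls_rel; exact: R1_idem. Qed.

Lemma genV_orth v w : v <> w -> V v * V w = 0.
Proof. by move=> vw; rewrite pmul_cls; apply: pcls_rel; exact: R1_orth. Qed.

Lemma genV_star v : (V v)^* = V v.
Proof. by rewrite pstar_cls; apply: pcls_rel; exact: R1_star. Qed.

Lemma genT_star b i v : (T b i v)^* = T (~~ b) i v.
Proof.
have h : (T false i v)^* = T true i v.
  by rewrite pstar_cls; apply: pcls_rel; exact: R5_star.
by case: b => //=; rewrite -h spstarK.
Qed.

Lemma genVT b i v : V v * T b i v = T b i v.
Proof.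
case: b.
  rewrite -[X in _ * X](genT_star false) -(genV_star v) -spstarM -[RHS](genT_star false).
  by congr pstar; rewrite pmul_cls; apply: pcls_rel; exact: R5_right.
by rewrite pmul_cls; apply: pcls_rel; exact: R5_left.
Qed.

Lemma genTV b i v : T b i v * V v = T b i v.
Proof.
by have := congr1 (@pstar _ _) (genVT (~~ b) i v);
  rewrite spstarM genT_star genV_star negbK.
Qed.

Lemma genTK b i v : T b i v * T (~~ b) i v = V v.
Proof.
by case: b; rewrite pmul_cls; apply: pcls_rel; [exact: R5_Vmul|exact: R5_mulV].
Qed.

Lemma genKT b i v : T (~~ b) i v * T b i v = V v.
Proof. by have := genTK (~~ b) i v; rewrite negbK. Qed.

Lemma genTC b c i j v : T b i v * T c j v = T c j v * T b i v.
Proof. by rewrite !pmul_cls; apply: pcls_rel; exact: R5_comm. Qed.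

Lemma genVE e : V (src e) * E e = E e.
Proof. by rewrite pmul_cls; apply: pcls_rel; exact: R2_src. Qed.

Lemma genEV e : E e * V (rng e) = E e.
Proof. by rewrite pmul_cls; apply: pcls_rel; exact: R2_rng. Qed.

Lemma block_of e : exists2 X, blocks (src e) X & X e.
Proof.
have [cov _ _] := blocks_partition (src e).
have : (@src G @^-1` [set src e]) e by [].
by rewrite -cov => -[X bX Xe]; exists X.
Qed.

Lemma block_src v (X : set (edge G)) e : blocks v X -> X e -> src e = v.
Proof.
move=> bX Xe; have [cov _ _] := blocks_partition v.
by have : cover (blocks v) id e; [exists X|rewrite cov].
Qed.

Lemma genEE e : (E e)^* * E e = V (rng e).
Proof.
have [X bX Xe] := block_of e.
by rewrite pstar_cls pmul_cls; apply: pcls_rel; exact: R2_iso bX Xe.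
Qed.

Lemma genEE_block v (X : set (edge G)) e f : blocks v X -> X e -> X f ->
  e <> f -> (E e)^* * E f = 0.
Proof.
move=> bX Xe Xf ef.
by rewrite pstar_cls pmul_cls; apply: pcls_rel; exact: R2_orth bX Xe Xf ef.
Qed.

Definition lsrc (x : sgen G) :=
  match x with gV v => v | gE e => src e | gT _ _ v => v end.
Definition lrng (x : sgen G) :=
  match x with gV v => v | gE e => rng e | gT _ _ v => v end.

Lemma gen_src x : V (lsrc x) * gen x = gen x.
Proof. by case: x => [v|e|b i v]; rewrite ?genV_idem ?genVE ?genVT. Qed.

Lemma gen_rng x : gen x * V (lrng x) = gen x.
Proof. by case: x => [v|e|b i v]; rewrite ?genV_idem ?genEV ?genTV. Qed.

Lemma gen_iso x : (gen x)^* * gen x = V (lrng x).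
Proof.
case: x => [v|e|b i v]; rewrite ?genV_star ?genV_idem ?genEE //.
by rewrite genT_star -[b in X in _ * X]negbK genTK.
Qed.

Variant edge_spec e : Prop :=
| EdgeReg : ~ free A (component (src e)) -> edge_spec e
| EdgeAlpha p (i : 'I_(fdeg A p)) : free A p -> ~ tminimal p ->
    e = alpha i -> edge_spec e
| EdgeBeta p (i : 'I_(fdeg A p)) (t : 'I_(fbeta i)) : free A p ->
    ~ tminimal p -> e = beta t -> edge_spec e.

Lemma free_src_nonmin e : free A (component (src e)) -> ~ tminimal (component (src e)).
Proof.
move=> fr mi; have /(free_sink fr) s0 := mi.
have : (@src G @^-1` [set fvert A (component (src e))]) e.
  have := component_mem (src e); rewrite (free_vert fr) => h.
  by rewrite /preimage /= [src e in LHS]h.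
by rewrite s0.
Qed.

Lemma src_fvert e : free A (component (src e)) -> src e = fvert A (component (src e)).
Proof. by move=> fr; have := component_mem (src e); rewrite {1}(free_vert fr). Qed.

(** Each edge lies in some block of its source, and the blocks at a free vertex are the sets
    [free_block]; non-minimality is automatic because the source of an edge is not a sink. *)
Lemma edgeP e : edge_spec e.
Proof.
have [fr|nfr] := pselect (free A (component (src e))); last exact: EdgeReg.
have nm := free_src_nonmin fr.
have [X bX Xe] := block_of e.
move: bX; rewrite (src_fvert fr) (free_blocks fr nm) => -[i _ iX].
move: Xe; rewrite -iX => -[ea|[t _ et]]; first exact: EdgeAlpha fr nm ea.
by apply: (EdgeBeta fr nm (t := t)); rewrite et.
Qed.

Lemma alpha_block p (i : 'I_(fdeg A p)) : free A p -> ~ tminimal p ->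
  blocks (fvert A p) (free_block (alpha i) (@beta _ A p i)).
Proof. by move=> fr nm; rewrite (free_blocks fr nm); exists i. Qed.

Lemma in_alpha p (i : 'I_(fdeg A p)) :
  free_block (alpha i) (@beta _ A p i) (alpha i).
Proof. by left. Qed.

Lemma in_beta p (i : 'I_(fdeg A p)) (t : 'I_(fbeta i)) :
  free_block (alpha i) (@beta _ A p i) (beta t).
Proof. by right; exists t. Qed.

Lemma alpha_src p (i : 'I_(fdeg A p)) : free A p -> ~ tminimal p ->
  src (alpha i) = fvert A p.
Proof. by move=> fr nm; have [] := free_alpha fr nm i. Qed.

Lemma alpha_rng p (i : 'I_(fdeg A p)) : free A p -> ~ tminimal p ->
  rng (alpha i) = fvert A p.
Proof. by move=> fr nm; have [] := free_alpha fr nm i. Qed.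

Lemma beta_src p (i : 'I_(fdeg A p)) (t : 'I_(fbeta i)) :
  free A p -> ~ tminimal p -> src (beta t) = fvert A p.
Proof.
by move=> fr nm; apply: block_src (alpha_block i fr nm) (in_beta t).
Qed.

Lemma fvert_comp p : free A p -> component (fvert A p) = p.
Proof. by move=> fr; apply/esym/componentE; rewrite (free_vert fr). Qed.

Lemma block_index p (i j : 'I_(fdeg A p)) e : free A p -> ~ tminimal p ->
  free_block (alpha i) (@beta _ A p i) e ->
  free_block (alpha j) (@beta _ A p j) e -> i = j.
Proof.
move=> fr nm ei ej; apply: (free_blocks_inj fr nm).
have [_ tr _] := blocks_partition (fvert A p).
by apply: tr; [exact: alpha_block|exact: alpha_block|exists e].
Qed.

Lemma alpha_neq_beta p q (i : 'I_(fdeg A p)) (j : 'I_(fdeg A q))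
    (t : 'I_(fbeta j)) : free A p -> ~ tminimal p -> free A q ->
  ~ tminimal q -> alpha i <> beta t.
Proof.
move=> frp nmp frq nmq ab.
have pq : p = q.
  rewrite -(fvert_comp frp) -(fvert_comp frq) -(beta_src t frq nmq) -ab.
  by rewrite alpha_src.
subst q; have [q [_ qp] /componentE qE] := free_beta frp nmp t.
by apply: qp; rewrite qE -ab alpha_rng // fvert_comp.
Qed.

Lemma genT_edge b i e :
  exists j, T b i (src e) * E e = E e * T b j (rng e).
Proof.
(* (R6) and (R9) are stated for $t_i$ only; multiplying by the inverses on both sides gives the
   relation for $t_i^{-1}$. *)
have flip j k : T false i (src e) * E e = E e * T false j (rng e) ->
    k = j -> T true i (src e) * E e = E e * T true k (rng e).
  move=> h ->.
  rewrite -[in LHS](genEV e) -(genTK false j) !spmulA.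
  rewrite -(spmulA _ (E e)) -h !spmulA genTK.
  by rewrite genVE.
case: (edgeP e) => [nfr|p j fr nm eE|p j t fr nm eE].
- have h : T false i (src e) * E e = E e * T false i (rng e).
    by rewrite !pmul_cls; apply: pcls_rel; exact: R6 nfr (component_mem _).
  by exists i; case: b => //; exact: flip h _.
- have h : T false i (src e) * E e = E e * T false i (rng e).
    rewrite eE alpha_src // alpha_rng // !pmul_cls; apply: pcls_rel.
    exact: R9.
  by exists i; case: b => //; exact: flip h _.
- exists (i + fdeg A p - 1)%N; rewrite eE beta_src // !pmul_cls.
  by apply: pcls_rel; exact: R7.
Qed.

Lemma genT_comm b i y : exists j,
  T b i (lsrc y) * gen y = gen y * T b j (lrng y).
Proof.
case: y => [v|e|c k v] /=.
- by exists i; rewrite genTV genVT.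
- exact: genT_edge.
- by exists i; rewrite genTC.
Qed.

(** An Ore condition on letters: unless $x^*y=0$, the pair is completed to a commuting square
    $xy'=yx'$ along which the star moves to the right. As $x'$ and $y'$ are again single letters,
    squares fill a grid and the condition passes to words by induction. *)
Definition ore_letter (x y : sgen G) :=
  (gen x)^* * gen y = 0 \/
  exists x' y', [/\ lsrc y' = lrng x, lsrc x' = lrng y, lrng x' = lrng y',
    (gen x)^* * gen y = gen y' * (gen x')^* & gen x * gen y' = gen y * gen x'].

Lemma ore_letter_sym x y : ore_letter x y -> ore_letter y x.
Proof.
move=> [h|[x' [y' [h1 h2 h3 h4 h5]]]].
  by left; rewrite -[LHS]spstarK spstarM spstarK h spstar0.
right; exists y', x'; split => //.
by rewrite -[LHS]spstarK spstarM spstarK h4 spstarM spstarK.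
Qed.

Lemma ore_T b i y : ore_letter (gT b i (lsrc y)) y.
Proof.
have [j h] := genT_comm b i y.
right; exists (gT b j (lrng y)), y; split => //.
rewrite !genT_star -[X in _ * X = _](gen_rng y) -(genTK b j).
by rewrite [X in _ * X = _]spmulA -h !spmulA genKT gen_src.
Qed.

Lemma genAA p (i j : 'I_(fdeg A p)) : free A p -> i <> j ->
  E (alpha i) * E (alpha j) = E (alpha j) * E (alpha i).
Proof. by move=> fr ij; rewrite !pmul_cls; apply: pcls_rel; exact: R3_comm. Qed.

Lemma genAAs p (i j : 'I_(fdeg A p)) : free A p -> i <> j ->
  (E (alpha i))^* * E (alpha j) = E (alpha j) * (E (alpha i))^*.
Proof.
move=> fr ij; rewrite pstar_cls !pmul_cls; apply/esym/pcls_rel.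
by apply: R3_comm_star => // /esym.
Qed.

Lemma genAB p (i j : 'I_(fdeg A p)) (s : 'I_(fbeta j)) : free A p -> i <> j ->
  E (alpha i) * E (beta s) = E (beta s) * T false (unbump j i) (rng (beta s)).
Proof. by move=> fr ij; rewrite !pmul_cls; apply: pcls_rel; exact: R8. Qed.

Lemma genABs p (i j : 'I_(fdeg A p)) (s : 'I_(fbeta j)) : free A p -> i <> j ->
  (E (alpha i))^* * E (beta s) =
  E (beta s) * T true (unbump j i) (rng (beta s)).
Proof.
by move=> fr ij; rewrite pstar_cls !pmul_cls; apply: pcls_rel; exact: R8_star.
Qed.

Lemma genBB p (i j : 'I_(fdeg A p)) (s : 'I_(fbeta i)) (t : 'I_(fbeta j)) :
  free A p -> (nat_of_ord i, nat_of_ord s) <> (nat_of_ord j, nat_of_ord t) ->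
  (E (beta s))^* * E (beta t) = 0.
Proof.
by move=> fr ij; rewrite pstar_cls !pmul_cls; apply: pcls_rel; exact: R4.
Qed.

Lemma ore_same x : ore_letter x x.
Proof.
right; exists (gV (lrng x)), (gV (lrng x)); split => //.
by rewrite gen_iso genV_star genV_idem.
Qed.

(** Two distinct edges of one block are orthogonal by (R2), and two different $\beta$ at a free
    vertex by (R4). The remaining squares come from (R3) for two $\alpha$, and from (R8) for
    $\alpha(p,i)$ and $\beta(p,j,s)$ with $i\ne j$, where the side opposite to $\alpha(p,i)$ is some
    $t$. *)
Lemma ore_edge e f : src e = src f -> ore_letter (gE e) (gE f).
Proof.
move=> ef; have [<-|nef] := pselect (e = f); first exact: ore_same.
have ore_AB p (i j : 'I_(fdeg A p)) (s : 'I_(fbeta j)) : free A p ->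
    ~ tminimal p -> ore_letter (gE (alpha i)) (gE (beta s)).
  move=> fr nm; have [ij|ij] := pselect (i = j).
    subst j; left; apply: (genEE_block (alpha_block i fr nm)).
    - exact: in_alpha.
    - exact: in_beta.
    - exact: alpha_neq_beta.
  right; exists (gT false (unbump j i) (rng (beta s))), (gE (beta s)); split => //=.
  - by rewrite beta_src // alpha_rng.
  - by rewrite genABs // genT_star.
  - by rewrite genAB.
case: (edgeP e) => [nfr|p i fr nm eE|p i s fr nm eE].
- have [X bX] := reg_block nfr (component_mem _).
  left; apply: (@genEE_block (src e) X) => //; first by rewrite bX.
    by have [Y] := block_of e; rewrite bX => ->.
  by have [Y] := block_of f; rewrite -ef bX => ->.
- case: (edgeP f) => [nfr|q j frq nmq fE|q j t frq nmq fE].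
  + by move: nfr; rewrite -ef eE alpha_src // fvert_comp.
  + have qp : q = p.
      by rewrite -(fvert_comp fr) -(fvert_comp frq) -(alpha_src j) // -(alpha_src i) // -eE -fE ef.
    subst q; have ij : i <> j by move=> ij; apply: nef; rewrite eE fE ij.
    right; exists (gE (alpha i)), (gE (alpha j)); rewrite eE fE /=; split => //.
    * by rewrite alpha_src ?alpha_rng.
    * by rewrite alpha_src ?alpha_rng.
    * by rewrite !alpha_rng.
    * exact: genAAs.
    * exact: genAA.
  + have qp : q = p.
      by rewrite -(fvert_comp fr) -(fvert_comp frq) -(beta_src t) // -(alpha_src i) // -eE -fE ef.
    by subst q; rewrite eE fE; exact: ore_AB.
- case: (edgeP f) => [nfr|q j frq nmq fE|q j t frq nmq fE].
  + by move: nfr; rewrite -ef eE beta_src // fvert_comp.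
  + have qp : q = p.
      by rewrite -(fvert_comp fr) -(fvert_comp frq) -(alpha_src j) // -(beta_src s) // -eE -fE ef.
    by subst q; rewrite eE fE; apply: ore_letter_sym; exact: ore_AB.
  + have qp : q = p.
      by rewrite -(fvert_comp fr) -(fvert_comp frq) -(beta_src t) // -(beta_src s) // -eE -fE ef.
    subst q; left; rewrite eE fE; apply: genBB => // -[ij st].
    apply: nef; rewrite eE fE; move/val_inj : ij => ij; subst j.
    by congr (beta _); exact: val_inj.
Qed.

Lemma ore_letterP x y : lsrc x = lsrc y -> ore_letter x y.
Proof.
case: x => [v|e|b i v] /= xy.
- right; exists (gV (lrng y)), y; split => //=; rewrite xy.
  by rewrite genV_star gen_src genV_star gen_rng.
  by rewrite gen_src gen_rng.
- case: y xy => [w|f|c j w] /= xy.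
  + apply: ore_letter_sym; right; exists (gV (rng e)), (gE e); rewrite -xy.
    by split => //=; rewrite ?genV_star ?genVE ?genEV.
  + exact: ore_edge.
  + by apply: ore_letter_sym; rewrite -xy -[src e]/(lsrc (gE e)); exact: ore_T.
- by rewrite xy; exact: ore_T.
Qed.

(** The inverses of the $t_i^v$ are letters as well, so that only the stars of edges are
    excluded. *)
Inductive pos : vert G -> vert G -> S -> Prop :=
| pos_nil v : pos v v (V v)
| pos_cons x w s : pos (lrng x) w s -> pos (lsrc x) w (gen x * s).

Lemma pos_src v w a : pos v w a -> V v * a = a.
Proof.
elim=> [u|x u s _ IH]; first by rewrite genV_idem.
by rewrite spmulA gen_src.
Qed.

Lemma pos_rng v w a : pos v w a -> a * V w = a.
Proof.
elim=> [u|x u s _ IH]; first by rewrite genV_idem.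
by rewrite -spmulA IH.
Qed.

Lemma pos_iso v w a : pos v w a -> a^* * a = V w.
Proof.
elim=> [u|x u s ps IH]; first by rewrite genV_star genV_idem.
by rewrite spstarM spmulA -(spmulA s^*) gen_iso -spmulA (pos_src ps).
Qed.

Lemma pos_gen x : pos (lsrc x) (lrng x) (gen x).
Proof. by rewrite -[gen x]gen_rng; apply: pos_cons; exact: pos_nil. Qed.

Lemma pos_mul u v w a b : pos u v a -> pos v w b -> pos u w (a * b).
Proof.
move=> pa; elim: pa b => [z|x z s ps IH] b pb; first by rewrite (pos_src pb).
by rewrite -spmulA; apply: pos_cons; exact: IH.
Qed.

Lemma pos_rng_star v w a : pos v w a -> V w * a^* = a^*.
Proof. by move=> /pos_rng h; rewrite -{1}(genV_star w) -spstarM h. Qed.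

Lemma pos_src_star v w a : pos v w a -> a^* * V v = a^*.
Proof. by move=> /pos_src h; rewrite -{1}(genV_star v) -spstarM h. Qed.

Lemma ore_letter_word x v w b : lsrc x = v -> pos v w b ->
  (gen x)^* * b = 0 \/
  exists x' b', [/\ pos (lrng x) (lrng x') b', lsrc x' = w,
    (gen x)^* * b = b' * (gen x')^* & gen x * b' = b * gen x'].
Proof.
move=> xv pb; elim: pb x xv => [u|y u s ps IH] x xv.
  right; exists x, (V (lrng x)); split => //; first exact: pos_nil.
    rewrite -xv -(genV_star (lsrc x)) -spstarM gen_src.
    by rewrite (pos_rng_star (pos_gen x)).
  by rewrite gen_rng -xv gen_src.
have [h|[x' [y' [h1 h2 h3 h4 h5]]]] := ore_letterP xv.
  by left; rewrite spmulA h spmul0l.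
have [h|[x'' [b' [p1 p2 p3 p4]]]] := IH x' h2.
  by left; rewrite spmulA h4 -spmulA h spmul0r.
right; exists x'', (gen y' * b'); split => //.
- by rewrite -h1; apply: pos_cons; rewrite -h3.
- by rewrite spmulA h4 -spmulA p3 spmulA.
- by rewrite spmulA h5 -spmulA p4 spmulA.
Qed.

Lemma ore_word v w u a b : pos v w a -> pos v u b ->
  a^* * b = 0 \/
  exists z a' b', [/\ pos w z b', pos u z a', a^* * b = b' * a'^* &
    a * b' = b * a'].
Proof.
move=> pa; elim: pa u b => [y|x z s ps IH] u b pb.
  right; exists u, (V u), b; split => //; first exact: pos_nil.
    by rewrite !genV_star (pos_src pb) (pos_rng pb).
  by rewrite (pos_src pb) (pos_rng pb).
have [h|[x' [b' [h1 h2 h3 h4]]]] := ore_letter_word (erefl _) pb.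
  by left; rewrite spstarM -spmulA h spmul0r.
have [h|[y [a' [b'' [p1 p2 p3 p4]]]]] := IH _ _ h1.
  by left; rewrite spstarM -spmulA h3 spmulA h spmul0l.
right; exists y, (gen x' * a'), b''; split => //.
- by rewrite -h2; exact: pos_cons.
- by rewrite !spstarM -spmulA h3 spmulA p3 spmulA.
- by rewrite -spmulA p4 spmulA h4 spmulA.
Qed.

Lemma pos_orth v v' w u a b : v <> v' -> pos v w a -> pos v' u b ->
  a^* * b = 0.
Proof.
move=> vv' pa pb; rewrite -(pos_src pb) -(pos_src_star pa).
by rewrite -spmulA (spmulA (V v)) (genV_orth vv') spmul0l spmul0r.
Qed.

Lemma pos_decomp (s : S) : s = 0 \/
  exists v u w a b, [/\ pos v w a, pos u w b & s = a * b^*].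
Proof.
have [x ->] := pcls_surj s; elim: x => [|x|x IHx y IHy|x IHx]; first by left.
- right; exists (lsrc x), (lrng x), (lrng x), (gen x), (V (lrng x)).
  split; [exact: pos_gen|exact: pos_nil|by rewrite genV_star gen_rng].
- rewrite -pmul_cls.
  case: IHx => [->|[v1 [u1 [w1 [a1 [b1 [pa1 pb1 ->]]]]]]].
    by left; rewrite spmul0l.
  case: IHy => [->|[v2 [u2 [w2 [a2 [b2 [pa2 pb2 ->]]]]]]].
    by left; rewrite spmul0r.
  rewrite spmulA -(spmulA a1).
  have [uv|uv] := pselect (u1 = v2); last first.
    by left; rewrite (pos_orth uv pb1 pa2) spmul0r spmul0l.
  subst v2; have [->|[z [b' [a' [h1 h2 -> h4]]]]] := ore_word pb1 pa2.
    by left; rewrite spmul0r spmul0l.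
  right; exists v1, u2, z, (a1 * a'), (b2 * b'); split.
  + exact: pos_mul h1.
  + exact: pos_mul h2.
  + by rewrite spstarM !spmulA.
- rewrite -pstar_cls.
  case: IHx => [->|[v1 [u1 [w1 [a1 [b1 [pa1 pb1 ->]]]]]]].
    by left; rewrite spstar0.
  by right; exists u1, v1, w1, b1, a1; rewrite spstarM spstarK.
Qed.

Lemma pos_proj v w a : pos v w a -> (a * a^*) * (a * a^*) = a * a^*.
Proof.
by move=> pa; rewrite spmulA -(spmulA a) (pos_iso pa) (pos_rng pa).
Qed.

(** With $ab'=ba'$ from [ore_word], both products equal $(ab')(ab')^*$; if the sources differ or
    $a^*b=0$, both vanish. *)
Lemma proj_comm v u w z a b : pos v w a -> pos u z b ->
  (a * a^*) * (b * b^*) = (b * b^*) * (a * a^*).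
Proof.
move=> pa pb; have [uv|uv] := pselect (v = u); last first.
  have h1 := pos_orth uv pa pb.
  have h2 : b^* * a = 0 by rewrite -[LHS]spstarK spstarM spstarK h1 spstar0.
  rewrite !spmulA -(spmulA a a^*) h1 spmul0r spmul0l.
  by rewrite -(spmulA b) h2 spmul0r spmul0l.
subst u; have [h1|[y [a' [b' [h1 h2 h3 h4]]]]] := ore_word pa pb.
  have h2 : b^* * a = 0 by rewrite -[LHS]spstarK spstarM spstarK h1 spstar0.
  rewrite !spmulA -(spmulA a a^*) h1 spmul0r spmul0l.
  by rewrite -(spmulA b) h2 spmul0r spmul0l.
have h5 : b^* * a = a' * b'^*.
  by rewrite -[LHS]spstarK spstarM spstarK h3 spstarM spstarK.
rewrite !spmulA -(spmulA a a^*) h3 -(spmulA b) h5 !spmulA h4.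
rewrite -!spmulA; congr (_ * (_ * _)).
by rewrite -!spstarM h4.
Qed.

Lemma idem_pos (e : S) : idem e -> e = 0 \/ exists v w a, pos v w a /\ e = a * a^*.
Proof.
rewrite /idem /=; have [->|[v [u [w [a [b [pa pb ->]]]]]]] := pos_decomp e.
  by left.
move=> ee; right; exists v, w, a; split => //; congr (_ * _^*).
(* Cancelling $a$ and $b$ in $ab^*ab^*=ab^*$ gives $b^*a=w$. Then $a=aa^*b$ and $b=bb^*a$, and
   commutation of the two projections forces $b=bb^*aa^*b=aa^*b=a$. *)
have ba : b^* * a = V w.
  have : a^* * ((a * b^*) * (a * b^*)) * b = a^* * (a * b^*) * b by rewrite ee.
  rewrite !spmulA (pos_iso pa) (pos_rng_star pb) -!spmulA (pos_iso pb).
  by rewrite (pos_rng pa).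
have ab : a^* * b = V w.
  by rewrite -[LHS]spstarK spstarM spstarK ba genV_star.
have h1 : (a * a^*) * b = a by rewrite -spmulA ab (pos_rng pa).
have h2 : (b * b^*) * a = b by rewrite -spmulA ba (pos_rng pb).
rewrite -[LHS]h2 -[X in (b * b^*) * X]h1 spmulA -(proj_comm pa pb) -spmulA.
by rewrite -(spmulA b) (pos_iso pb) (pos_rng pb) h1.
Qed.

Lemma pos_idem v w a : pos v w a -> idem (a * a^*).
Proof. exact: pos_proj. Qed.

Lemma idem0 : idem (0 : S). Proof. exact: spmul0l. Qed.

Lemma idemC (e f : S) : idem e -> idem f -> e * f = f * e.
Proof.
move=> /idem_pos[->|[v [w [a [pa ->]]]]]; first by rewrite spmul0l spmul0r.
move=> /idem_pos[->|[u [z [b [pb ->]]]]]; first by rewrite spmul0l spmul0r.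
exact: proj_comm pa pb.
Qed.

Lemma idem_star (e : S) : idem e -> e^* = e.
Proof.
by move=> /idem_pos[->|[v [w [a [pa ->]]]]]; rewrite ?spstar0 // spstarM spstarK.
Qed.

Lemma idem_mul (e f : S) : idem e -> idem f -> idem (e * f).
Proof.
move=> ie jf; rewrite /idem /= spmulA -(spmulA e) (idemC jf ie) spmulA ie.
by rewrite -spmulA jf.
Qed.

Lemma spregular (s : S) : s * s^* * s = s.
Proof.
have [->|[v [u [w [a [b [pa pb ->]]]]]]] := pos_decomp s.
  by rewrite !spmul0l.
rewrite spstarM spstarK.
rewrite !spmulA -(spmulA a) (pos_iso pb) (pos_rng pa).
by rewrite -(spmulA a) (pos_iso pa) (pos_rng pa).
Qed.

Lemma spregular_star (s : S) : s^* * s * s^* = s^*.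
Proof.
by have := congr1 (@pstar _ _) (spregular s); rewrite !spstarM spstarK spmulA.
Qed.

Lemma idem_ss (s : S) : idem (s^* * s).
Proof. by rewrite /idem /= spmulA -[X in X * s]spmulA -spmulA spregular. Qed.

Lemma idem_ss' (s : S) : idem (s * s^*).
Proof. by have := idem_ss s^*; rewrite spstarK. Qed.

Lemma idem_conj (s e : S) : idem e -> idem (s^* * e * s).
Proof.
move=> ie; rewrite /idem /=.
have -> : s^* * e * s * (s^* * e * s) = s^* * (e * (s * s^*)) * e * s.
  by rewrite !spmulA.
rewrite (idemC ie (idem_ss' s)) !spmulA -[s^* * s * s^*]spmulA.
have -> : s^* * (s * s^*) = s^*.
  by have := congr1 (@pstar _ _) (spregular s); rewrite !spstarM spstarK.
by rewrite -(spmulA s^* e e) ie.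
Qed.

Lemma idem_V v : idem (V v). Proof. exact: genV_idem. Qed.

End Semigroup.

(** * A faithful model of positive elements *)

Section Words.
Variables (G : sepGraph) (A : adaptable G).
Local Notation S := (SE A).

Definition is_alpha (e : edge G) (i : nat) :=
  exists p (j : 'I_(fdeg A p)),
    [/\ free A p, ~ tminimal p, e = alpha j & nat_of_ord j = i].

Definition is_beta (e : edge G) (i : nat) :=
  exists p (j : 'I_(fdeg A p)) (t : 'I_(fbeta j)),
    [/\ free A p, ~ tminimal p, e = beta t & nat_of_ord j = i].

Definition aidx (e : edge G) : option nat :=
  if pselect (exists i, is_alpha e i) is left ex then Some (projT1 (cid ex))
  else None.

Definition bidx (e : edge G) : nat := xget 0%N [set i | is_beta e i].

Definition deg (v : vert G) : nat :=
  if pselect (free A (component v)) then fdeg A (component v) else 0%N.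

(** The shift $k(p)-1$ of (R7) at a free source. As [deg] is $0$ at a regular vertex, it is $0$ for
    a regular edge, in agreement with (R6). *)
Definition shf (e : edge G) : nat := (deg (src e)).-1.

Lemma is_alpha_inj e i j : is_alpha e i -> is_alpha e j -> i = j.
Proof.
move=> [p [k [fr nm eE <-]]] [q [l [frq nmq eF <-]]].
have qp : q = p.
  by rewrite -(fvert_comp fr) -(fvert_comp frq) -(alpha_src l) // -(alpha_src k) // -eE eF.
subst q; congr nat_of_ord; apply: (block_index (e := e) fr nm).
  by rewrite eE; exact: in_alpha.
by rewrite eF; exact: in_alpha.
Qed.

Lemma is_beta_inj e i j : is_beta e i -> is_beta e j -> i = j.
Proof.
move=> [p [k [s [fr nm eE <-]]]] [q [l [t [frq nmq eF <-]]]].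
have qp : q = p.
  by rewrite -(fvert_comp fr) -(fvert_comp frq) -(beta_src t) // -(beta_src s) // -eE eF.
subst q; congr nat_of_ord; apply: (block_index (e := e) fr nm).
  by rewrite eE; exact: in_beta.
by rewrite eF; exact: in_beta.
Qed.

Lemma aidx_alpha p (i : 'I_(fdeg A p)) : free A p -> ~ tminimal p ->
  aidx (alpha i) = Some (nat_of_ord i).
Proof.
move=> fr nm; rewrite /aidx; case: pselect => [ex|]; last first.
  by case; exists i, p, i.
by case: cid => /= j ja; congr Some; apply: is_alpha_inj ja _; exists p, i.
Qed.

Lemma aidx_beta p (i : 'I_(fdeg A p)) (t : 'I_(fbeta i)) :
  free A p -> ~ tminimal p -> aidx (beta t) = None.
Proof.
move=> fr nm; rewrite /aidx; case: pselect => [ex|//]; exfalso.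
move: ex => [j [q [k [frq nmq bE _]]]].
by case: (alpha_neq_beta frq nmq fr nm (esym bE)).
Qed.

Lemma aidx_reg e : ~ free A (component (src e)) -> aidx e = None.
Proof.
move=> nfr; rewrite /aidx; case: pselect => [ex|//]; exfalso.
by move: ex => [j [q [k [frq nmq eE]]]]; move: nfr; rewrite eE alpha_src // fvert_comp.
Qed.

Lemma bidx_beta p (i : 'I_(fdeg A p)) (t : 'I_(fbeta i)) :
  free A p -> ~ tminimal p -> bidx (beta t) = i.
Proof.
move=> fr nm; rewrite /bidx; case: xgetP => [j _ jb|/(_ (nat_of_ord i))].
  by apply: is_beta_inj jb _; exists p, i, t.
by case; exists p, i, t.
Qed.

Lemma deg_fvert p : free A p -> deg (fvert A p) = fdeg A p.
Proof. by move=> fr; rewrite /deg fvert_comp //; case: pselect. Qed.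

Lemma deg_reg v : ~ free A (component v) -> deg v = 0%N.
Proof. by rewrite /deg; case: pselect. Qed.

Lemma shf_beta p (i : 'I_(fdeg A p)) (t : 'I_(fbeta i)) :
  free A p -> ~ tminimal p -> shf (beta t) = (fdeg A p).-1.
Proof. by move=> fr nm; rewrite /shf beta_src // deg_fvert. Qed.

Lemma shf_reg e : ~ free A (component (src e)) -> shf e = 0%N.
Proof. by move=> nfr; rewrite /shf deg_reg. Qed.

(* A normal form of the positive elements of S(E,C): [WEnd f n] stands for
   $\prod_i (t_i)^{f_i} \prod_j \alpha_j^{n_j}$ and [WStep e m w] for
   $\alpha_j^m e w$, where [e] is $\beta(p,j,s)$ (or a regular edge, and
   then [m = 0]). *)
Inductive mword :=
| WEnd (f : nat -> int) (n : nat -> nat)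
| WStep (e : edge G) (m : nat) (w : mword).

Definition shift (e : edge G) (f : nat -> int) : nat -> int :=
  fun i => if (i < shf e)%N then 0 else f (i - shf e)%N.

(** What $\prod_i\alpha(p,i)^{n_i}$ becomes beyond $\beta(p,j,s)$, where $j$ is [bidx e]: by (R8)
    the factor with index [bump j i] turns into a power of $t_i$, [bump] being inverse to [unbump].
    The factor with index $j$ stays in front of the step. *)
Definition sig (e : edge G) (n : nat -> nat) : nat -> int :=
  fun i => (n (bump (bidx e) i))%:Z.

Fixpoint actT (f : nat -> int) (w : mword) : mword :=
  match w with
  | WEnd g n => WEnd (fun i => f i + g i) n
  | WStep e m w' => WStep e m (actT (shift e f) w')
  end.

Definition actA (n : nat -> nat) (w : mword) : mword :=
  match w with
  | WEnd g n' => WEnd g (fun i => n i + n' i)%N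
  | WStep e m w' => WStep e (n (bidx e) + m) (actT (sig e n) w')
  end.

Definition dz (b : bool) (i : nat) : nat -> int :=
  fun j => if i == j then (if b then -1 else 1) else 0.

Definition dn (i : nat) : nat -> nat := fun j => (i == j) : nat.

Definition lact (x : sgen G) (w : mword) : mword :=
  match x with
  | gV _ => w
  | gT b i _ => actT (dz b i) w
  | gE e => if aidx e is Some i then actA (dn i) w else WStep e 0 w
  end.

Lemma actTD f g w : actT f (actT g w) = actT (fun i => f i + g i) w.
Proof.
elim: w f g => [h n|e m w IH] f g /=.
  by congr WEnd; apply/funext => i; rewrite addrA.
rewrite IH; congr (WStep _ _ (actT _ _)); apply/funext => i.
by rewrite /shift; case: ifP => _; rewrite ?addr0.
Qed.

Lemma actT0 w : actT (fun=> 0) w = w.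
Proof.
elim: w => [h n|e m w IH] /=.
  by congr WEnd; apply/funext => i; rewrite add0r.
rewrite -[in RHS]IH; congr (WStep _ _ (actT _ _)); apply/funext => i.
by rewrite /shift if_same.
Qed.

Lemma actTC f g w : actT f (actT g w) = actT g (actT f w).
Proof.
by rewrite !actTD; congr actT; apply/funext => i; rewrite addrC.
Qed.

Lemma actT_inj f w w' : actT f w = actT f w' -> w = w'.
Proof.
move=> h; rewrite -(actT0 w) -(actT0 w').
have -> : (fun=> 0) = (fun i => - f i + f i) :> (nat -> int).
  by apply/funext => i; rewrite addNr.
by rewrite -!actTD h.
Qed.

Lemma actT_injl f g w : actT f w = actT g w -> f = g.
Proof.
elim: w f g => [h n|e m w IH] f g /= [].
  by move=> /funeqP fg; apply/funext => i; move: (fg i) => /addIr.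
move=> /IH /funeqP fg; apply/funext => i; have := fg (i + shf e)%N.
by rewrite /shift addnK ltnNge leq_addl.
Qed.

Lemma actAT n f w : actA n (actT f w) = actT f (actA n w).
Proof. by case: w => [h n'|e m w] //=; rewrite actTC. Qed.

Lemma actAD n n' w : actA n (actA n' w) = actA (fun i => n i + n' i)%N w.
Proof.
case: w => [h m|e m w] /=.
  by congr WEnd; apply/funext => i; rewrite addnA.
by rewrite addnA actTD.
Qed.

Lemma actA0 w : actA (fun=> 0%N) w = w.
Proof. by case: w => [h m|e m w] //=; rewrite actT0. Qed.

Fixpoint wcat (u w : mword) : mword :=
  match u with
  | WEnd f n => actT f (actA n w)
  | WStep e m u' => WStep e m (wcat u' w)
  end.

Lemma actT_wcat f u w : actT f (wcat u w) = wcat (actT f u) w.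
Proof.
elim: u f => [g n|e m u IH] f /=; first by rewrite actTD.
by rewrite IH.
Qed.

Lemma actA_wcat n u w : actA n (wcat u w) = wcat (actA n u) w.
Proof.
by case: u => [g n'|e m u] /=; rewrite ?actAT ?actAD // actT_wcat.
Qed.

Lemma lact_wcat x u w : lact x (wcat u w) = wcat (lact x u) w.
Proof.
case: x => [v|e|b i v] //=; last exact: actT_wcat.
by case: aidx => [i|//]; exact: actA_wcat.
Qed.

Definition w0 : mword := WEnd (fun=> 0) (fun=> 0%N).

Lemma wcat_w0 w : wcat w w0 = w.
Proof.
elim: w => [f n|e m w IH] /=; last by rewrite IH.
by congr WEnd; apply/funext => i; rewrite ?addr0 ?addn0.
Qed.

Fixpoint wlen (w : mword) := if w is WStep _ _ w' then (wlen w').+1 else 0%N.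

Lemma wlen_actT f w : wlen (actT f w) = wlen w.
Proof. by elim: w f => [g n|e m w IH] f //=; rewrite IH. Qed.

Lemma wlen_wcat u w : wlen (wcat u w) = (wlen u + wlen w)%N.
Proof.
elim: u => [f n|e m u IH] /=; last by rewrite IH.
by rewrite wlen_actT; case: w => [g n'|e m w] //=; rewrite wlen_actT.
Qed.

(* [wtyped v w u]: [w] is the normal form of a path from [v] to [u]. *)
Fixpoint wtyped (v : vert G) (w : mword) (u : vert G) : Prop :=
  match w with
  | WEnd f n => v = u /\ forall i, (deg v <= i)%N -> n i = 0%N
  | WStep e m w' => [/\ src e = v, aidx e = None & wtyped (rng e) w' u]
  end.

Lemma bidx_lt e : aidx e = None -> (0 < deg (src e))%N ->
  (bidx e < deg (src e))%N.
Proof.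
case: (edgeP A e) => [nfr|p i fr nm eE|p i t fr nm eE].
- by rewrite deg_reg.
- by rewrite eE aidx_alpha.
- by rewrite eE bidx_beta // beta_src // deg_fvert.
Qed.

(** Lengths add up under [wcat], so [w1] and [w2] have equally many steps and everything reduces to
    two end words in front of [w]. If [w] begins with a step at [e], the exponents of the $t_i$ and
    those of the $\alpha_i$ both become exponents of $t$ beyond [e]. The former are shifted to
    indices from [shf e] on, the latter stay below [shf e], so both can be recovered; the exponent
    with index [bidx e] is read off the step itself. *)
Lemma wcat_inj v u z w1 w2 w : wtyped v w1 u -> wtyped v w2 u ->
  wtyped u w z -> wcat w1 w = wcat w2 w -> w1 = w2.
Proof.
elim: w1 v w2 => [f n|e m w1 IH] v [g n'|e' m' w2] /=; first last.
- move=> [sv _ t1] [_ _ t2] t [? ? /IH]; subst e' m'.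
  by move=> /(_ _ t1 t2 t) ->.
- move=> _ _ _ /(congr1 wlen) /=.
  rewrite wlen_wcat wlen_actT; case: w {IH} => [h k|e' k w] /=; first by lia.
  by rewrite wlen_actT; lia.
- move=> _ _ _ /(congr1 wlen) /=.
  rewrite wlen_wcat wlen_actT; case: w => [h k|e k w] /=; first by lia.
  by rewrite wlen_actT; lia.
- move=> [vu n0] [_ n'0]; subst u; case: w => [h k|e k w] /=.
    move=> _ [/funeqP fg /funeqP nn']; congr WEnd; apply/funext => i.
      by have /addIr := fg i.
    by have /addIn := nn' i.
  move=> [se ae _] [/addIn nj]; rewrite !actTD => /actT_injl /funeqP h.
  have sig0 m : (forall i, (deg v <= i)%N -> m i = 0%N) ->
      forall i, (shf e <= i)%N -> sig e m i = 0.
    move=> m0 i; rewrite /shf se => le_i; rewrite /sig m0 //.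
    have [d0|d0] := posnP (deg v); first by rewrite d0.
    have := bidx_lt ae; rewrite se => /(_ d0).
    by rewrite /bump; lia.
  congr WEnd; apply/funext => i.
    have := h (i + shf e)%N; rewrite (sig0 n) ?(sig0 n') ?leq_addl //.
    by rewrite /shift addnK ltnNge leq_addl /= !addr0.
  have [d_i|i_d] := leqP (deg v) i; first by rewrite n0 ?n'0.
  have [->//|ij] := eqVneq i (bidx e).
  have := h (unbump (bidx e) i); rewrite /shift.
  have d0 : (0 < deg v)%N by lia.
  have := bidx_lt ae; rewrite se => /(_ d0) bd.
  have -> : (unbump (bidx e) i < shf e)%N.
    by rewrite /shf se /unbump; lia.
  by rewrite !add0r /sig unbumpK // => -[].
Qed.

Lemma wtyped_actT f v w u : wtyped v w u -> wtyped v (actT f w) u.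
Proof.
by elim: w v f => [g n|e m w IH] v f //= [? ? ?]; split => //; exact: IH.
Qed.

Lemma wtyped_lact x w u : wtyped (lrng x) w u -> wtyped (lsrc x) (lact x w) u.
Proof.
case: x => [v|e|b i v] //=; last exact: wtyped_actT.
case ae: (aidx e) => [i|] => [|wt]; last by split.
have [p [j [fr nm eE ji]]] : is_alpha e i.
  move: ae; rewrite /aidx; case: pselect => // ex [<-].
  by case: cid.
rewrite {1}eE alpha_rng // eE alpha_src //.
case: w => [f n|f m w] /=.
  move=> [<- n0]; split => // k kd; rewrite n0 // addn0 /dn.
  move: kd; rewrite deg_fvert // -ji => kd.
  by have := ltn_ord j; case: eqP => // ->; lia.
by move=> [? ? ?]; split => //; exact: wtyped_actT.
Qed.

(** [mrel t y z] reads: $t$ maps $z$ to $y$. With relations instead of partial maps the star is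
    simply the converse, and no injectivity has to be known beforehand. The words need not be typed;
    only the vertex is compared. *)
Fixpoint mrel (t : sterm (sgen G)) (y z : vert G * mword) : Prop :=
  match t with
  | SZero => False
  | SGen x => z.1 = lrng x /\ y = (lsrc x, lact x z.2)
  | SMul a b => exists2 u, mrel a y u & mrel b u z
  | SStar a => mrel a z y
  end.

Lemma WStep_actA e n m w w' : WStep e m w = actA n w' ->
  exists k w'', [/\ w' = WStep e k w'', m = (n (bidx e) + k)%N &
    w = actT (sig e n) w''].
Proof. by case: w' => [//|f k w'] /= [-> -> ->]; exists k, w'. Qed.

Lemma dzD b i f : (fun j => dz b i j + (dz (~~ b) i j + f j)) = f.
Proof.
apply/funext => j; rewrite /dz; case: eqP => _; case: b => /=; lia.
Qed.

Lemma actT_dzK b i w : actT (dz b i) (actT (dz (~~ b) i) w) = w.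
Proof.
rewrite actTD -[RHS]actT0; congr actT.
by apply/funext => j; have /funeqP/(_ j) := dzD b i (fun=> 0); rewrite addr0.
Qed.

Lemma shift_dz e b i : shift e (dz b i) = dz b (i + shf e).
Proof.
apply/funext => j; rewrite /shift /dz.
case: ltnP => h; first by case: eqP => //; lia.
by do 2 case: eqP => //; lia.
Qed.

Lemma sig_dn e i : sig e (dn i) =
  if i == bidx e then (fun=> 0) else dz false (unbump (bidx e) i).
Proof.
apply/funext => k; rewrite /sig /dn /dz.
have [->|ij] := eqVneq i (bidx e).
  by rewrite (negbTE (neq_bump _ _)).
have [->|h] := eqVneq i (bump (bidx e) k); first by rewrite bumpK eqxx.
case: eqP => // uk; move: h; rewrite -uk unbumpK ?eqxx //.
Qed.

Lemma free_ord_nonmin p (i : 'I_(fdeg A p)) : free A p -> ~ tminimal p.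
Proof.
by move=> fr mi; move: (i); rewrite (free_min_deg fr mi) => -[].
Qed.

Lemma mrel_alpha p (i : 'I_(fdeg A p)) y1 y2 z1 z2 : free A p ->
  mrel (SGen (gE (alpha i))) (y1, y2) (z1, z2) <->
  [/\ z1 = fvert A p, y1 = fvert A p & y2 = actA (dn i) z2].
Proof.
move=> fr; have nm := free_ord_nonmin i fr.
rewrite /= aidx_alpha // alpha_rng // alpha_src //.
by split=> [[-> [-> ->]]|[-> -> ->]].
Qed.

Lemma mrel_beta p (i : 'I_(fdeg A p)) (t : 'I_(fbeta i)) y1 y2 z1 z2 :
  free A p ->
  mrel (SGen (gE (beta t))) (y1, y2) (z1, z2) <->
  [/\ z1 = rng (beta t), y1 = fvert A p & y2 = WStep (beta t) 0 z2].
Proof.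
move=> fr; have nm := free_ord_nonmin i fr.
by rewrite /= aidx_beta // beta_src //; split=> [[-> [-> ->]]|[-> -> ->]].
Qed.

Lemma actA_inj n w w' : actA n w = actA n w' -> w = w'.
Proof.
case: w => [f m|e m w]; case: w' => [g m'|e' m' w'] //= [].
  move=> -> /funeqP h; congr WEnd; apply/funext => i.
  by have /addnI := h i.
by move=> <- /addnI -> /actT_inj ->.
Qed.

Lemma lact_inj x w w' : lact x w = lact x w' -> w = w'.
Proof.
case: x => [v|e|b i v] //=; last exact: actT_inj.
by case: aidx => [i /actA_inj//|[]].
Qed.

(** This is what $\alpha_i\alpha_j^*=\alpha_j^*\alpha_i$ requires of the model: the ranges of
    $\alpha_i$ and $\alpha_j$ meet in the range of $\alpha_i\alpha_j$. In front of a step at most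
    one of the two raises the exponent of the step, and the other acts by an invertible $t$. *)
Lemma actA_pullback i j w w' : i <> j -> actA (dn i) w = actA (dn j) w' ->
  exists u, w = actA (dn j) u /\ w' = actA (dn i) u.
Proof.
move=> ij; case: w => [f n|e m w]; case: w' => [g n'|e' m' w'] //= [].
  move=> <- /funeqP h; exists (WEnd f (fun k => n k - dn j k)%N) => /=.
  split; congr WEnd; apply/funext => k; have := h k; rewrite /dn;
    by do 2 case: eqP => //=; lia.
move=> <-; rewrite !sig_dn /dn => mm ww.
have [ib|ib] := eqVneq i (bidx e).
  have jb : j != bidx e by apply/eqP => jb; apply: ij; rewrite ib.
  rewrite ib eqxx (negbTE jb) in mm ww.
  exists (WStep e m w') => /=; rewrite !sig_dn /dn ib eqxx (negbTE jb) actT0.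
  by rewrite actT0 in ww; rewrite ww; split; congr WStep; lia.
have [jb|jb] := eqVneq j (bidx e).
  rewrite jb eqxx (negbTE ib) actT0 in mm ww.
  exists (WStep e m' w) => /=; rewrite !sig_dn /dn jb eqxx (negbTE ib) actT0.
  by rewrite -ww; split; congr WStep; lia.
rewrite (negbTE ib) (negbTE jb) in mm ww.
set a := unbump _ _ in ww; set b := unbump _ _ in ww.
exists (WStep e m (actT (dz true b) w)) => /=.
rewrite !sig_dn /dn (negbTE ib) (negbTE jb) -/a -/b (actT_dzK false).
by rewrite (actTC (dz false a)) ww (actT_dzK true); split; congr WStep; lia.
Qed.

Lemma mrel_rel s t y z : srel A s t -> mrel s y z <-> mrel t y z.
Proof.
case: y => y1 y2; case: z => z1 z2.
case=> {s t}.
- move=> v /=; split; first by move=> [[u1 u2] /= [-> [-> ->]] [-> [->]]].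
  by move=> [-> [-> ->]]; exists (v, z2).
- by move=> v w vw /=; split => // -[[u1 u2] /= [-> _] [_ [/vw]]].
- by move=> v /=; split; move=> [-> [-> ->]].
- move=> e /=; split; first by move=> [[u1 u2] /= [_ [-> ->]] [-> [_ ->]]].
  by move=> [-> [-> ->]]; eexists (src e, _).
- move=> e /=; split; first by move=> [[u1 u2] /= [_ [-> ->]] [-> [_ ->]]].
  by move=> [-> [-> ->]]; exists (rng e, z2).
- move=> v X e _ _; split.
    by move=> /= [[u1 u2] /= [-> [-> ->]] [-> /(congr1 snd) /= /(@lact_inj (gE e)) ->]].
  move=> /= [-> [-> ->]]; exists (src e, lact (gE e) z2) => //=.
- move=> v X e f bX Xe Xf ef; split => // -[[u1 u2]].
  case: (edgeP A e) => [nfr|p i fr nm eE|p i s fr nm eE].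
  + rewrite /= aidx_reg // => -[_ [_ ->]] [_].
    rewrite aidx_reg; first by move=> [_ []].
    by rewrite (block_src bX Xf) -(block_src bX Xe).
  + rewrite eE => /(mrel_alpha _ _ _ _ _ fr) [_ -> ->].
    have [X' bX' X'e] := block_of e.
    case: (edgeP A f) => [nfr|q j frq nmq fE|q j t frq nmq fE].
    * by move: nfr; rewrite (block_src bX Xf) -(block_src bX Xe) eE alpha_src // fvert_comp.
    * have qp : q = p.
        rewrite -(fvert_comp fr) -(fvert_comp frq) -(alpha_src j) // -(alpha_src i) //.
        by rewrite -eE -fE (block_src bX Xf) (block_src bX Xe).
      subst q; have pv : v = fvert A p.
        by rewrite -(block_src bX Xe) eE alpha_src.
      move: bX; rewrite pv (free_blocks fr nm) => -[k _ kX].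
      have ki : k = i.
        by apply: (block_index (e := e) fr nm); rewrite ?kX // eE; exact: in_alpha.
      have kj : k = j.
        by apply: (block_index (e := f) fr nm); rewrite ?kX // fE; exact: in_alpha.
      by case: ef; rewrite eE fE -ki -kj.
    * have qp : q = p.
        rewrite -(fvert_comp fr) -(fvert_comp frq) -(beta_src t) // -(alpha_src i) //.
        by rewrite -eE -fE (block_src bX Xf) (block_src bX Xe).
      subst q; have pv : v = fvert A p.
        by rewrite -(block_src bX Xe) eE alpha_src.
      move: bX; rewrite pv (free_blocks fr nm) => -[k _ kX].
      have ki : k = i.
        by apply: (block_index (e := e) fr nm); rewrite ?kX // eE; exact: in_alpha.
      have kj : k = j.
        by apply: (block_index (e := f) fr nm); rewrite ?kX // fE; exact: in_beta.
      have ij : i == j :> nat by rewrite -ki -kj.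
      (* $\alpha(p,i)$ raises the exponent of a step at $\beta(p,i,t)$ to at least $1$, while
         $\beta(p,i,t)$ itself produces the exponent $0$. *)
      rewrite fE => /(mrel_beta _ _ _ _ _ fr) [_ _ /esym /WStep_actA [m [w []]]].
      by rewrite /dn bidx_beta // ij.
  + rewrite eE => /(mrel_beta _ _ _ _ _ fr) [_ -> ->].
    case: (edgeP A f) => [nfr|q j frq nmq fE|q j t frq nmq fE].
    * by move: nfr; rewrite (block_src bX Xf) -(block_src bX Xe) eE beta_src // fvert_comp.
    * have qp : q = p.
        rewrite -(fvert_comp fr) -(fvert_comp frq) -(alpha_src j) // -(beta_src s) //.
        by rewrite -eE -fE (block_src bX Xf) (block_src bX Xe).
      subst q; have pv : v = fvert A p.
        by rewrite -(block_src bX Xe) eE beta_src.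
      move: bX; rewrite pv (free_blocks fr nm) => -[k _ kX].
      have ki : k = i.
        by apply: (block_index (e := e) fr nm); rewrite ?kX // eE; exact: in_beta.
      have kj : k = j.
        by apply: (block_index (e := f) fr nm); rewrite ?kX // fE; exact: in_alpha.
      have ij : j == i :> nat by rewrite -ki -kj.
      rewrite fE => /(mrel_alpha _ _ _ _ _ fr) [_ _ /WStep_actA [m [w []]]].
      by rewrite /dn bidx_beta // ij.
    * rewrite fE => /(mrel_beta _ _ _ _ _ frq) [_ _ [st _]].
      by case: ef; rewrite eE fE.
- move=> p i j fr ij; have nm := free_ord_nonmin i fr.
  have h (a b : 'I_(fdeg A p)) :
      mrel (SGen (gE (alpha a)) * SGen (gE (alpha b)))%sterm (y1, y2) (z1, z2) <->
    [/\ z1 = fvert A p, y1 = fvert A p & y2 = actA (dn a) (actA (dn b) z2)].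
    split.
      by move=> [[u1 u2] /(mrel_alpha _ _ _ _ _ fr) [-> -> ->]
        /(mrel_alpha _ _ _ _ _ fr) [-> _ ->]].
    move=> [-> -> ->]; exists (fvert A p, actA (dn b) z2); exact/mrel_alpha.
  rewrite !h !actAD.
  have -> : (fun k => dn i k + dn j k)%N = (fun k => dn j k + dn i k)%N.
    by apply/funext => k; rewrite addnC.
  by [].
- move=> p i j fr ij; have nm := free_ord_nonmin i fr.
  have nij : nat_of_ord i <> j by move=> /val_inj.
  split.
    move=> [[u1 u2] /(mrel_alpha _ _ _ _ _ fr) [-> -> ->]].
    move=> /(mrel_alpha _ _ _ _ _ fr) [_ -> ->].
    exists (fvert A p, actA (dn i) (actA (dn j) u2)).
      apply/mrel_alpha => //; split => //=; rewrite !actAD; congr actA.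
      by apply/funext => k; rewrite addnC.
    exact/mrel_alpha.
  move=> [[u1 u2] /(mrel_alpha _ _ _ _ _ fr) [-> -> ->]].
  move=> /(mrel_alpha _ _ _ _ _ fr) [-> _ /actA_pullback].
  move=> [|w [-> ->]]; first by move/esym.
  exists (fvert A p, w); exact/mrel_alpha.
- move=> p i j s t fr ne; have nm := free_ord_nonmin i fr.
  split => // -[[u1 u2] /(mrel_beta _ _ _ _ _ fr) [-> -> ->]].
  move=> /(mrel_beta _ _ _ _ _ fr) [_ _ [bb _]]; case: ne.
  have ij : i = j.
    apply: (block_index (e := beta s) fr nm); first exact: in_beta.
    by rewrite bb; exact: in_beta.
  by subst j; rewrite (free_beta_inj fr nm bb).
- move=> v b c i j /=; split; move=> [[u1 u2] /= [_ [-> ->]] [-> [_ ->]]];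
    by eexists (v, _); split => //; rewrite actTC.
- move=> v i /=; split; first by move=> [[u1 u2] /= [_ [-> ->]] [-> [_ ->]]].
  by move=> [-> [-> ->]]; eexists (v, _).
- move=> v i /=; split; first by move=> [[u1 u2] /= [_ [-> ->]] [-> [_ ->]]].
  by move=> [-> [-> ->]]; exists (v, z2).
- move=> v i /=; split.
    by move=> [[u1 u2] /= [_ [-> ->]] [-> [_ ->]]]; rewrite actT_dzK.
  by move=> [-> [-> ->]]; eexists (v, _); split => //; rewrite actT_dzK.
- move=> v i /=; split.
    by move=> [[u1 u2] /= [_ [-> ->]] [-> [_ ->]]]; rewrite actT_dzK.
  by move=> [-> [-> ->]]; eexists (v, _); split => //; rewrite actT_dzK.
- move=> v i /=; split; move=> [-> [-> ->]]; split => //.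
    by rewrite (actT_dzK true).
  by rewrite (actT_dzK false).
- move=> p e i nfr pe; have nfr' : ~ free A (component (src e)) by rewrite -(componentE pe).
  rewrite /= aidx_reg //; split; move=> [[u1 u2] /= [_ [-> ->]] [-> [_ ->]]].
    by exists (rng e, actT (dz false i) z2); split => //=; rewrite shift_dz shf_reg // addn0.
  by exists (src e, WStep e 0 z2); split => //=; rewrite shift_dz shf_reg // addn0.
- move=> p j s b i fr; have nm := free_ord_nonmin j fr.
  have k0 : (0 < fdeg A p)%N by apply: leq_trans (ltn_ord j).
  have iE : (i + fdeg A p - 1 = i + (fdeg A p).-1)%N by lia.
  rewrite /= aidx_beta //; split; move=> [[u1 u2] /= [_ [-> ->]] [-> [_ ->]]].
    exists (rng (beta s), actT (dz b (i + fdeg A p - 1)) z2); split => //=.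
    by rewrite beta_src // shift_dz shf_beta // iE.
  exists (fvert A p, WStep (beta s) 0 z2); split; rewrite ?beta_src //=.
  by rewrite shift_dz shf_beta // iE.
- move=> p i j s fr ij; have nm := free_ord_nonmin j fr.
  have nij : (nat_of_ord i == j) = false by apply/eqP => /val_inj.
  split.
    move=> [[u1 u2] /(mrel_alpha _ _ _ _ _ fr) [-> -> ->]].
    move=> /(mrel_beta _ _ _ _ _ fr) [-> _ ->].
    exists (rng (beta s), actT (dz false (unbump j i)) z2) => //.
    apply/mrel_beta => //; split => //=.
    by rewrite /dn sig_dn bidx_beta // nij.
  move=> [[u1 u2] /(mrel_beta _ _ _ _ _ fr) [-> -> ->]] /= [-> [->]].
  exists (fvert A p, WStep (beta s) 0 z2); last exact/mrel_beta.
  apply/mrel_alpha => //; split => //=.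
  by rewrite /dn sig_dn bidx_beta // nij.
- move=> p i j s fr ij; have nm := free_ord_nonmin j fr.
  have nij : (nat_of_ord i == j) = false by apply/eqP => /val_inj.
  split.
    move=> [[u1 u2] /(mrel_alpha _ _ _ _ _ fr) [-> -> ->]].
    move=> /(mrel_beta _ _ _ _ _ fr) [-> _ /esym /WStep_actA [k [w [-> + ->]]]].
    rewrite /dn sig_dn bidx_beta // nij add0n => <-.
    exists (rng (beta s), w); first exact/mrel_beta.
    by split => //=; rewrite (actT_dzK true).
  move=> [[u1 u2] /(mrel_beta _ _ _ _ _ fr) [-> -> ->]] /= [-> [->]].
  exists (fvert A p, WStep (beta s) 0 z2); last exact/mrel_beta.
  apply/mrel_alpha => //; split => //=.
  by rewrite /dn sig_dn bidx_beta // nij (actT_dzK false).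
- move=> p j i fr; have nm := free_ord_nonmin j fr; split.
    move=> [[u1 u2] /= [-> [-> ->]] /(mrel_alpha _ _ _ _ _ fr) [-> _ ->]].
    exists (fvert A p, actT (dz false i) z2) => //.
    by apply/mrel_alpha => //=; rewrite actAT.
  move=> [[u1 u2] /(mrel_alpha _ _ _ _ _ fr) [-> -> ->]] /= [-> [->]].
  exists (fvert A p, actA (dn j) z2); last exact/mrel_alpha.
  by split => //=; rewrite actAT.
- move=> p j i fr; have nm := free_ord_nonmin j fr; split.
    move=> [[u1 u2] /= [-> [-> ->]] /(mrel_alpha _ _ _ _ _ fr) [_ -> ->]].
    exists (fvert A p, actA (dn j) (actT (dz false i) u2)); first exact/mrel_alpha.
    by split => //=; rewrite actAT.
  move=> [[u1 u2] /(mrel_alpha _ _ _ _ _ fr) [-> -> ->]] /= [-> [h]].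
  exists (fvert A p, actT (dz true i) y2).
    by split => //=; rewrite (actT_dzK false).
  apply/mrel_alpha => //; split => //=.
  by apply: (@actT_inj (dz false i)); rewrite -h actAT (actT_dzK false).
Qed.

Lemma mrel_cong s t : scong (srel A) s t -> forall y z, mrel s y z <-> mrel t y z.
Proof.
elim=> {s t} //=.
- by move=> s t _ IH y z; rewrite IH.
- by move=> s t u _ IH1 _ IH2 y z; rewrite IH1.
- move=> s s' t t' _ IH1 _ IH2 y z.
  by split; move=> [u /IH1 h1 /IH2 h2]; exists u.
- move=> s t u y z; split.
    by move=> [a sa [b tb uc]]; exists b => //; exists a.
  by move=> [b [a sa tb] uc]; exists a => //; exists b.
- by move=> s y z; split => // -[].
- by move=> s y z; split => // -[].
- by move=> s t y z; split; move=> [u h1 h2]; exists u.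
- by move=> s t st y z; exact: mrel_rel.
Qed.

Definition srep (s : S) (y z : vert G * mword) := mrel (repr s) y z.

Lemma srep_cls t y z : srep (pcls (srel A) t) y z <-> mrel t y z.
Proof. exact/mrel_cong/pcls_repr. Qed.

Lemma srep_mul (s t : S) y z :
  srep (pmul s t) y z <-> exists2 u, srep s y u & srep t u z.
Proof.
have [a ->] := pcls_surj s; have [b ->] := pcls_surj t.
rewrite pmul_cls srep_cls /=.
by split; move=> [u /srep_cls h1 /srep_cls h2]; exists u => //; apply/srep_cls.
Qed.

Lemma srep0 y z : ~ srep (pzero (srel A)) y z.
Proof. by move=> /srep_cls. Qed.

Lemma srep_gen x y z : srep (gen A x) y z <->
  z.1 = lrng x /\ y = (lsrc x, lact x z.2).
Proof. exact: srep_cls. Qed.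

Lemma genV_neq0 v : gen A (gV v) <> pzero _.
Proof.
move=> h; apply: (@srep0 (v, w0) (v, w0)); rewrite -h; exact/srep_gen.
Qed.

End Words.

(** * Normal forms, right cancellation and $E^*$-unitarity *)

Section NormalForms.
Variables (G : sepGraph) (A : adaptable G).
Local Notation S := (SE A).
Local Open Scope SE_scope.
Local Notation V := (fun v => gen A (gV v)).
Local Notation E := (fun e => gen A (gE e)).
Local Notation T := (fun b i v => gen A (gT b i v)).

Lemma spow_comm (v : vert G) (s x : S) m : x * s = s * x -> x * V v = V v * x ->
  x * iter m (pmul s) (V v) = iter m (pmul s) (V v) * x.
Proof.
move=> xs xv; elim: m => [//|m IH] /=.
by rewrite spmulA xs -spmulA IH spmulA.
Qed.

(** Total in the index, with the neutral value [V v] outside the range of the $\alpha(p,i)$, so that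
    products over all indices below a bound make sense. *)
Definition alphaS (v : vert G) (i : nat) : S :=
  if pselect (free A (component v)) then
    if insub i is Some j then E (@alpha _ A (component v) j) else V v
  else V v.

Lemma alphaS_alpha p (i : 'I_(fdeg A p)) : free A p ->
  alphaS (fvert A p) i = E (alpha i).
Proof.
move=> fr; rewrite /alphaS fvert_comp //; case: pselect => [fr'|//].
by rewrite valK.
Qed.

Lemma alphaS_cases v i : alphaS v i = V v \/
  exists p (j : 'I_(fdeg A p)),
    [/\ free A p, v = fvert A p, i = j & alphaS v i = E (alpha j)].
Proof.
rewrite /alphaS; case: pselect => [fr|?]; last by left.
case: insubP => [j ? ji|?]; last by left.
right; exists (component v), j; split => //.
by have := component_mem v; rewrite {1}(free_vert fr).
Qed.

Lemma alphaS_src v i : V v * alphaS v i = alphaS v i.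
Proof.
have [->|[p [j [fr -> _ ->]]]] := alphaS_cases v i; first exact: genV_idem.
have nm := free_ord_nonmin j fr.
by have := genVE A (alpha j); rewrite alpha_src.
Qed.

Lemma alphaS_rng v i : alphaS v i * V v = alphaS v i.
Proof.
have [->|[p [j [fr -> _ ->]]]] := alphaS_cases v i; first exact: genV_idem.
have nm := free_ord_nonmin j fr.
by have := genEV A (alpha j); rewrite alpha_rng.
Qed.

Lemma alphaS_comm v i j : alphaS v i * alphaS v j = alphaS v j * alphaS v i.
Proof.
have [->|[p [k [fr pv _ ->]]]] := alphaS_cases v i.
  by rewrite alphaS_src alphaS_rng.
have [->|[q [l [frq qv _ ->]]]] := alphaS_cases v j.
  have nm := free_ord_nonmin k fr; rewrite pv.
  by have := genVE A (alpha k); have := genEV A (alpha k); rewrite alpha_src // alpha_rng // => -> ->.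
have qp : q = p by rewrite -(fvert_comp fr) -(fvert_comp frq) -pv -qv.
subst q; have [<-//|kl] := pselect (k = l).
exact: genAA.
Qed.

Lemma genT_alphaS b i v j : T b i v * alphaS v j = alphaS v j * T b i v.
Proof.
have [->|[p [k [fr -> _ ->]]]] := alphaS_cases v j; first by rewrite genTV genVT.
have nm := free_ord_nonmin k fr.
have h : T false i (fvert A p) * E (alpha k) = E (alpha k) * T false i (fvert A p).
  by rewrite !pmul_cls; apply: pcls_rel; exact: R9.
case: b => //.
have eV : E (alpha k) * V (fvert A p) = E (alpha k).
  by have := genEV A (alpha k); rewrite alpha_rng.
have Ve : V (fvert A p) * E (alpha k) = E (alpha k).
  by have := genVE A (alpha k); rewrite alpha_src.
rewrite -[X in _ * X = _]eV -(genTK A false i) [X in _ * X]spmulA -h.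
by rewrite !spmulA (genTK A true) Ve.
Qed.

Fixpoint mprod (v : vert G) (F : nat -> S) (N : nat) : S :=
  if N is N'.+1 then mprod v F N' * F N' else V v.

Lemma mprod_comm v F N x : (forall i, x * F i = F i * x) ->
  x * V v = V v * x -> x * mprod v F N = mprod v F N * x.
Proof.
move=> xF xv; elim: N => [//|N IH] /=.
by rewrite spmulA IH -!spmulA xF.
Qed.

Lemma mprod_src v F N : V v * mprod v F N = mprod v F N.
Proof. by elim: N => [|N IH] /=; rewrite ?genV_idem // spmulA IH. Qed.

Lemma eq_mprod v F F' N : (forall i, (i < N)%N -> F i = F' i) ->
  mprod v F N = mprod v F' N.
Proof.
elim: N => [//|N IH] h /=; rewrite h // IH // => i iN.
by apply: h; exact: ltnW.
Qed.

Lemma mprod_update v F F' N x k : (k < N)%N -> (forall i, x * F i = F i * x) ->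
  x * V v = V v * x -> F' k = x * F k -> (forall i, i != k -> F' i = F i) ->
  mprod v F' N = x * mprod v F N.
Proof.
move=> kN xF xv Fk Fi; elim: N kN => [//|N IH] /=.
rewrite ltnS leq_eqVlt => /orP[/eqP kE|kN].
  rewrite -kE Fk (eq_mprod v (F' := F)) => [|i ik].
    by rewrite !spmulA mprod_comm.
  by apply: Fi; rewrite neq_ltn ik.
by rewrite IH // Fi ?spmulA // neq_ltn kN orbT.
Qed.

Definition tpow (v : vert G) (i : nat) (z : int) : S :=
  match z with
  | Posz n => iter n (pmul (T false i v)) (V v)
  | Negz n => iter n.+1 (pmul (T true i v)) (V v)
  end.

Lemma tpow_src v i z : V v * tpow v i z = tpow v i z.
Proof.
case: z => [[|n]|n] /=; first exact: genV_idem.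
  by rewrite spmulA genVT.
by rewrite spmulA genVT.
Qed.

Lemma tpow_mul b v i z : T b i v * tpow v i z =
  tpow v i ((if b then -1 else 1) + z).
Proof.
case: b z => [] [[|n]|n].
- by have -> : -1 + Posz 0 = Negz 0 by [].
- have -> : -1 + n.+1%:Z = n by lia.
  by rewrite /= spmulA (genKT A false); exact: (tpow_src v i n).
- by have -> : -1 + Negz n = Negz n.+1 by lia.
- by have -> : 1 + Posz 0 = 1%:Z by [].
- by have -> : 1 + n.+1%:Z = n.+2%:Z by lia.
- have -> : 1 + Negz n = - n%:Z by lia.
  rewrite /= spmulA (genTK A false); case: n => [|n] /=; first by rewrite genV_idem.
  by rewrite !spmulA genVT.
Qed.

Lemma tpow_commT b v i k z : T b i v * tpow v k z = tpow v k z * T b i v.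
Proof.
have h m c : T b i v * iter m (pmul (T c k v)) (V v) =
    iter m (pmul (T c k v)) (V v) * T b i v.
  by apply: spow_comm; rewrite 1?genTC // genTV genVT.
by case: z => n; exact: h.
Qed.

Lemma tpow_commA v i k z :
  alphaS v i * tpow v k z = tpow v k z * alphaS v i.
Proof.
have h m c : alphaS v i * iter m (pmul (T c k v)) (V v) =
    iter m (pmul (T c k v)) (V v) * alphaS v i.
  by apply: spow_comm; rewrite ?genT_alphaS // alphaS_src alphaS_rng.
by case: z => n; exact: h.
Qed.

Definition apow v i m : S := iter m (pmul (alphaS v i)) (V v).

Lemma apow_commT b v i k m : T b i v * apow v k m = apow v k m * T b i v.
Proof. by apply: spow_comm; rewrite ?genT_alphaS // genTV genVT. Qed.

Lemma apow_commA v i k m : alphaS v i * apow v k m = apow v k m * alphaS v i.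
Proof. by apply: spow_comm; rewrite 1?alphaS_comm // alphaS_src alphaS_rng. Qed.

Lemma apow_src v i m : V v * apow v i m = apow v i m.
Proof. by case: m => [|m] /=; rewrite ?genV_idem // spmulA alphaS_src. Qed.

(* The infinite product of commuting factors in [WEnd] is cut at [N]. *)
Fixpoint welem (N : nat) (v : vert G) (w : mword G) : S :=
  match w with
  | WEnd f n => mprod v (fun i => tpow v i (f i)) N *
                mprod v (fun i => apow v i (n i)) N
  | WStep e m w' => apow (src e) (bidx A e) m * E e * welem N (rng e) w'
  end.

(** The cut [N] must exceed the index that $t_i$ has reached when it arrives at the end of the word.
    This index grows by [shf e] at each step, whence a threshold that depends on [w]. *)
Lemma welem_T b i v w u : wtyped A v w u -> exists N0, forall N, (N0 <= N)%N ->
  welem N v (actT A (dz b i) w) = T b i v * welem N v w.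
Proof.
elim: w v i => [f n|e m w IH] v i /=.
  move=> _; exists i.+1 => N iN; rewrite [RHS]spmulA; congr (_ * _).
  apply: (mprod_update (k := i)) => //.
  - by move=> j; rewrite tpow_commT.
  - by rewrite genTV genVT.
  - by rewrite tpow_mul /dz eqxx.
  - by move=> j ji; rewrite /dz eq_sym (negbTE ji) add0r.
move=> [<- ae wt]; rewrite shift_dz.
have [N0 N0P] := IH _ (i + shf A e)%N wt; exists N0 => N NN.
rewrite N0P // [RHS]spmulA [X in _ = X * _]spmulA apow_commT.
rewrite spmulA; congr (_ * _); rewrite -!spmulA; congr (_ * _).
have flip j k : T false i (src e) * E e = E e * T false j (rng e) ->
    k = j -> E e * T true k (rng e) = T true i (src e) * E e.
  move=> h ->.
  rewrite -{2}(genEV A e) -(genTK A false j) (spmulA (E e)) -h.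
  by rewrite !spmulA (genTK A true) genVE.
case: (edgeP A e) => [nfr|p j fr nm eE|p j s fr nm eE].
- have h : T false i (src e) * E e = E e * T false i (rng e).
    by rewrite !pmul_cls; apply: pcls_rel; exact: R6 nfr (component_mem _).
  rewrite shf_reg // addn0; case: b {N0P IH} => //.
  exact: flip h _.
- by move: ae; rewrite eE aidx_alpha.
- rewrite eE shf_beta // beta_src //.
  have -> : (i + (fdeg A p).-1 = i + fdeg A p - 1)%N by have := ltn_ord j; lia.
  by rewrite !pmul_cls; apply/esym/pcls_rel; exact: R7.
Qed.

Lemma apow_alpha_beta p (i j : 'I_(fdeg A p)) (s : 'I_(fbeta j)) m :
  free A p -> i <> j ->
  E (alpha i) * (apow (fvert A p) j m * E (beta s)) =
  apow (fvert A p) j m * E (beta s) * T false (unbump j i) (rng (beta s)).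
Proof.
move=> fr ij; rewrite spmulA -alphaS_alpha // apow_commA -spmulA alphaS_alpha //.
by rewrite genAB // spmulA.
Qed.

Lemma welem_lact x w u : wtyped A (lrng x) w u -> exists N0, forall N,
  (N0 <= N)%N -> welem N (lsrc x) (lact A x w) = gen A x * welem N (lrng x) w.
Proof.
case: x => [v|e|b i v] /= wt.
- exists 0%N => N _; case: w wt => [f n|e m w] /=.
    by rewrite spmulA mprod_src.
  by move=> [<- _ _]; rewrite !spmulA apow_src.
- case: (edgeP A e) => [nfr|p i fr nm eE|p i s fr nm eE].
  + rewrite aidx_reg //; exists 0%N => N _ /=.
    by rewrite genVE.
  + move: wt; rewrite eE aidx_alpha // alpha_src // alpha_rng //.
    case: w => [f n|f m w] /= wt.
      exists i.+1 => N iN; rewrite -alphaS_alpha // [RHS]spmulA.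
      rewrite [X in _ = X * _](_ : _ =
          mprod (fvert A p) (fun k => tpow (fvert A p) k (f k)) N * alphaS (fvert A p) i); last first.
        apply: mprod_comm; last by rewrite alphaS_src alphaS_rng.
        by move=> k; exact: tpow_commA.
      rewrite -spmulA; congr (_ * _).
      apply: (mprod_update (k := i)) => //.
      * by move=> j; rewrite apow_commA.
      * by rewrite alphaS_src alphaS_rng.
      * by rewrite /dn eqxx.
      * by move=> j ji; rewrite /dn eq_sym (negbTE ji).
    case: wt => sf af wt.
    case: (edgeP A f) => [nfr|q j frq nmq fE|q j t frq nmq fE].
    * by move: nfr; rewrite sf fvert_comp.
    * by move: af; rewrite fE aidx_alpha.
    have qp : q = p.
      by rewrite -(fvert_comp fr) -(fvert_comp frq) -(beta_src t) // -fE sf.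
    subst q; rewrite fE in wt *; rewrite /dn sig_dn bidx_beta //.
    have [ij|ij] := eqVneq (nat_of_ord i) (nat_of_ord j).
      exists 0%N => N _; rewrite actT0 /= beta_src // !spmulA -ij.
      by rewrite /apow /= alphaS_alpha.
    have [N0 N0P] := welem_T false (unbump j i) wt; exists N0 => N NN.
    rewrite N0P //= beta_src // [RHS]spmulA apow_alpha_beta //.
      by rewrite !spmulA.
    by move=> ij'; move: ij; rewrite ij' eqxx.
  + rewrite eE aidx_beta //; exists 0%N => N _ /=.
    by rewrite genVE.
- exact: welem_T wt.
Qed.

(** The action recovers [W] from $s$, by applying $s$ to the empty word, and [welem] recovers $s$
    from [W]; so the normal form is a complete invariant of a positive element. *)
Lemma pos_word v w (s : S) : pos v w s -> exists W, [/\ wtyped A v W w,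
  forall y z, srep s y z <-> z.1 = w /\ y = (v, wcat A W z.2) &
  exists N0, forall N, (N0 <= N)%N -> welem N v W = s].
Proof.
elim=> [u|x u t pt [W [wt rW [N0 N0P]]]].
  exists (w0 G); split => //.
    by move=> y z; rewrite srep_gen /= actA0 actT0.
  exists 0%N => N _ /=.
  suff h (F : nat -> S) : (forall i, F i = V u) -> mprod u F N = V u.
    by rewrite !h ?genV_idem.
  by move=> Fu; elim: N => [//|N IH] /=; rewrite IH Fu genV_idem.
exists (lact A x W); split.
- exact: wtyped_lact.
- move=> y z; rewrite srep_mul; split.
    move=> [[a b] /srep_gen [/= -> ->] /rW [-> [->]]].
    by rewrite lact_wcat.
  move=> [zu ->]; exists (lrng x, wcat A W z.2); last exact/rW.
  by apply/srep_gen; split => //=; rewrite lact_wcat.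
- have [N1 N1P] := welem_lact wt.
  exists (maxn N0 N1) => N; rewrite geq_max => /andP[h0 h1].
  by rewrite N1P // N0P.
Qed.

Lemma pos_neq0 v w (a : S) : pos v w a -> a <> 0.
Proof.
move=> /pos_iso h a0; apply: (@genV_neq0 _ A w); rewrite -h a0.
by rewrite spmul0r.
Qed.

(** Applied to the empty word, both sides give concatenations with the normal form of $d$, which
    [wcat_inj] cancels. *)
Lemma pos_rcancel v w u (a b d : S) : pos v w a -> pos v w b -> pos w u d ->
  a * d = b * d -> a = b.
Proof.
move=> /pos_word[Wa [ta ra [Na NaP]]] /pos_word[Wb [tb rb [Nb NbP]]].
move=> /pos_word[Wd [td rd _]] adbd.
have ha : srep (a * d) (v, wcat A Wa Wd) (u, w0 G).
  apply/srep_mul; exists (w, Wd); first exact/ra.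
  by apply/rd; rewrite /= wcat_w0.
move: ha; rewrite adbd => /srep_mul[[x1 x2] /rb [/= -> [h1]]].
move=> /rd /= [_ [h2]]; have ab : Wa = Wb.
  by apply: (wcat_inj ta tb td); rewrite h1 h2 wcat_w0.
by rewrite -(NaP (maxn Na Nb)) ?leq_maxl // ab NbP // leq_maxr.
Qed.

(** Write $u=ab^*$ and $f=cc^*$, so that $uc=c$, and complete $b,c$ to a square $bc'=cb'$. Then
    $ac'=ab^*cb'=cb'=bc'$, and right cancellation gives $a=b$. *)
Lemma Estar_unitary (u f : S) : idem f -> f <> 0 -> u * f = f -> idem u.
Proof.
move=> /idem_pos[->//|[x [y [c [pc ->]]]]] _ uf.
have uc : u * c = c.
  have := congr1 (fun t => t * c) uf => /=.
  by rewrite -!spmulA (pos_iso pc) (pos_rng pc).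
have := pos_neq0 pc; rewrite -uc; have [->|] := pos_decomp u.
  by rewrite spmul0l.
move=> [v [v' [w [a [b [pa pb uE]]]]]] _; rewrite uE in uc *.
have [v'x|v'x] := pselect (v' = x); last first.
  case: (pos_neq0 pc); rewrite -uc -spmulA (pos_orth v'x pb pc).
  by rewrite spmul0r.
subst v'; have [bc0|[z [b' [c' [pc' pb' bc bc']]]]] := ore_word pb pc.
  by case: (pos_neq0 pc); rewrite -uc -spmulA bc0 spmul0r.
have ac' : a * c' = b * c'.
  rewrite bc' -uc -!(spmulA a) bc -spmulA (pos_iso pb').
  by rewrite (pos_rng pc').
have [vx|vx] := pselect (v = x); last first.
  have := pos_neq0 (pos_mul pb pc'); case.
  rewrite -(pos_src (pos_mul pb pc')) -ac' -(pos_src pa) !spmulA.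
  by rewrite genV_orth ?spmul0l // => /esym.
subst v; rewrite (pos_rcancel pa pb pc' ac'); exact: pos_idem pb.
Qed.

Definition compatible (s t : S) := idem (s^* * t) /\ idem (s * t^*).

(** Each of $s^*t$ and $st^*$ fixes a nonzero idempotent, namely $s^*sf$ and $sfs^*$ respectively,
    so [Estar_unitary] applies to both. *)
Lemma compatible_of_eq (s t f : S) : idem f -> s * f = t * f -> s * f <> 0 ->
  compatible s t.
Proof.
move=> jf st sf0; split.
  apply: (@Estar_unitary _ (s^* * s * f)).
  - exact: idem_mul (idem_ss s) jf.
  - by move=> h; apply: sf0; rewrite -(spregular s) -!spmulA (spmulA _ _ f) h spmul0r.
  - have e : s^* * t * f = s^* * s * f by rewrite -!spmulA st.
    rewrite (idemC (idem_ss s) jf) [LHS]spmulA e (idemC (idem_ss s) jf).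
    by rewrite -spmulA (idem_ss s : _ = _).
apply: (@Estar_unitary _ (s * f * s^*)).
- by rewrite -{1}(spstarK s); apply: idem_conj.
- move=> h; apply: sf0.
  have <- : s * f * s^* * s = s * f; last by rewrite h spmul0l.
  rewrite -(spmulA (s * f)) -(spmulA s) (idemC jf (idem_ss s)) !spmulA.
  by rewrite spregular.
- have e1 : s * f * s^* = t * f * t^*.
    have conjE (r : S) : r * f * r^* = (r * f) * (r * f)^*.
      by rewrite spstarM (idem_star jf) !spmulA -(spmulA r f f) (jf : _ = _).
    by rewrite !conjE st.
  rewrite {1}e1 [LHS]spmulA -[X in X * t^*]spmulA (spmulA t^*).
  rewrite (idemC (idem_ss t) jf) (spmulA s) st -spmulA spregular_star.
  by rewrite -e1 st.
Qed.

End NormalForms.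

(** * C*-algebras *)

Section CStarGeneral.
Variables (R : realType).
Local Notation C := R[i].
Implicit Types (B D : cstarAlg R).

Section Basics.
Variable B : cstarAlg R.
Implicit Types x y z : B.

Lemma cmul0l x : cmul 0 x = 0.
Proof. by rewrite -(scale0r x) cmulZl !scale0r. Qed.

Lemma cmul0r x : cmul x 0 = 0.
Proof. by rewrite -(scale0r x) cmulZr !scale0r. Qed.

Lemma cmulNl x y : cmul (- x) y = - cmul x y.
Proof. by rewrite -scaleN1r cmulZl scaleN1r. Qed.

Lemma cmulNr x y : cmul x (- y) = - cmul x y.
Proof. by rewrite -scaleN1r cmulZr scaleN1r. Qed.

Lemma cmulBl x y z : cmul (x - y) z = cmul x z - cmul y z.
Proof. by rewrite cmulDl cmulNl. Qed.

Lemma cmulBr x y z : cmul x (y - z) = cmul x y - cmul x z.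
Proof. by rewrite cmulDr cmulNr. Qed.

Lemma cstar0 : cstar (0 : B) = 0.
Proof. by rewrite -(scale0r 0) cstarZ conjC0 !scale0r. Qed.

Lemma cstarN x : cstar (- x) = - cstar x.
Proof. by rewrite -scaleN1r cstarZ rmorphN1 scaleN1r. Qed.

Lemma cstarB x y : cstar (x - y) = cstar x - cstar y.
Proof. by rewrite cstarD cstarN. Qed.

(** The norm of a normed module over [R[i]] takes its values in [R[i]]; [rn] is the same norm as an
    element of [R], by [normE]. *)
Definition rn x : R := complex.Re `|x|.

Lemma normE x : `|x| = (rn x)%:C%C.
Proof.
have : `|x| \is Num.real by exact: normr_real.
rewrite /rn; case: `|x| => a b; rewrite complex_real => /eqP /= ->.
by [].
Qed.

Lemma rn_ge0 x : 0 <= rn x.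
Proof. by have := normr_ge0 x; rewrite normE lecR. Qed.

Lemma rn0 : rn 0 = 0.
Proof. by rewrite /rn normr0. Qed.

Lemma rn_eq0 x : rn x = 0 -> x = 0.
Proof. by move=> h; apply/eqP; rewrite -normr_eq0 normE h. Qed.

Lemma rnD x y : rn (x + y) <= rn x + rn y.
Proof. by have := ler_normD x y; rewrite !normE -rmorphD lecR. Qed.

Lemma rnN x : rn (- x) = rn x.
Proof. by rewrite /rn normrN. Qed.

Lemma rnB x y : rn (x - y) = rn (y - x).
Proof. by rewrite -rnN opprB. Qed.

Lemma rn_triangle y x z : rn (x - z) <= rn (x - y) + rn (y - z).
Proof. by rewrite -[x - z](subrKA y) rnD. Qed.

Lemma rnM x y : rn (cmul x y) <= rn x * rn y.
Proof. by have := cnormM x y; rewrite !normE -rmorphM lecR. Qed.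

Lemma rnM_le x y p q : rn x <= p -> rn y <= q -> rn (cmul x y) <= p * q.
Proof.
by move=> xp yq; apply: le_trans (rnM x y) _; apply: ler_pM => //; exact: rn_ge0.
Qed.

Lemma rn_starM x : rn (cmul (cstar x) x) = rn x ^+ 2.
Proof.
have := cnorm_star x; rewrite !normE -rmorphXn => /(congr1 (@complex.Re R)).
by [].
Qed.

Lemma rn_star x : rn (cstar x) = rn x.
Proof.
have h y : rn y <= rn (cstar y).
  have := rnM (cstar y) y; rewrite rn_starM expr2.
  have [-> _|y0] := eqVneq (rn y) 0; first exact: rn_ge0.
  by rewrite ler_pM2r // lt_neqAle eq_sym y0 rn_ge0.
by apply/eqP; rewrite eq_le h -{2}(cstarK x) h.
Qed.

Definition rc (a : C) : R := complex.Re `|a|.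

Lemma rcE (a : C) : `|a| = (rc a)%:C%C.
Proof.
have : `|a| \is Num.real by exact: normr_real.
by rewrite /rc; case: `|a| => u v; rewrite complex_real => /eqP /= ->.
Qed.

Lemma rnZ (a : C) x : rn (a *: x) = rc a * rn x.
Proof.
have := normrZ a x; rewrite !normE rcE -rmorphM => /(congr1 (@complex.Re R)).
by [].
Qed.

End Basics.

Lemma rc_ge0 (a : C) : 0 <= rc a.
Proof. by have := normr_ge0 a; rewrite rcE lecR. Qed.

Lemma rcM (a b : C) : rc (a * b) = rc a * rc b.
Proof.
by have := normrM a b; rewrite !rcE -rmorphM => /(congr1 (@complex.Re R)).
Qed.

Lemma rcD (a b : C) : rc (a + b) <= rc a + rc b.
Proof. by have := ler_normD a b; rewrite !rcE -rmorphD lecR. Qed.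

Lemma rcN (a : C) : rc (- a) = rc a.
Proof. by rewrite /rc normrN. Qed.

Lemma rc0 : rc 0 = 0.
Proof. by rewrite /rc normr0. Qed.

Lemma rc1 : rc 1 = 1.
Proof. by rewrite /rc normr1. Qed.

Lemma rc_conj (a : C) : rc a^* = rc a.
Proof. by rewrite /rc norm_conjC. Qed.

Lemma rc_le (a : C) (M : R) : `|a| <= M%:C%C <-> rc a <= M.
Proof. by rewrite rcE lecR. Qed.

(** Otherwise $(r/M)^{2^n}$ would be unbounded, by Bernoulli's inequality, and yet at most $K$. The
    exponents $2^n$ are those for which the C*-identity gives $\|x^{2^n}\|=\|x\|^{2^n}$. *)
Lemma root_bound (r M K : R) : 0 <= r -> 0 <= M ->
  (forall n, r ^+ (2 ^ n) <= K * M ^+ (2 ^ n)) -> r <= M.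
Proof.
move=> r0 M0 h; rewrite leNgt; apply/negP => Mr.
have [M00|Mn0] := eqVneq M 0.
  have := h 0%N; rewrite expn0 !expr1 M00 mulr0 => rle.
  by move: Mr; rewrite M00 ltNge rle.
have Mp : 0 < M by rewrite lt_neqAle eq_sym Mn0.
pose d := r / M - 1.
have d0 : 0 < d by rewrite subr_gt0 ltr_pdivlMr // mul1r.
have rE : r / M = 1 + d by rewrite addrC subrK.
have bern n : 1 + n%:R * d <= (1 + d) ^+ n.
  elim: n => [|n IH]; first by rewrite mul0r addr0 expr0.
  rewrite exprS -natr1.
  have : (1 + d) * (1 + n%:R * d) <= (1 + d) * (1 + d) ^+ n.
    by apply: ler_wpM2l => //; rewrite addr_ge0 // ltW.
  apply: le_trans; have : 0 <= n%:R * d * d by rewrite !mulr_ge0 // ltW.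
  lra.
have bnd n : n%:R * d <= K.
  have := h n; rewrite -ler_pdivrMr ?exprn_gt0 // -expr_div_n rE => le1.
  have := bern (2 ^ n)%N.
  have : n%:R * d <= (2 ^ n)%:R * d.
    by rewrite ler_pM2r // ler_nat ltnW // ltn_expl.
  lra.
have [m Km] : exists m : nat, K / d < m%:R.
  exists (Num.truncn (K / d)).+1; exact: truncnS_gt.
by have := bnd m; rewrite leNgt -ltr_pdivrMr // Km.
Qed.

Definition sqn B (n : nat) (x : B) : B := iter n (fun y => cmul y y) x.

Lemma sqn_star B n (x : B) : cstar x = x -> cstar (sqn n x) = sqn n x.
Proof. by move=> xs; elim: n => [//|n IH] /=; rewrite cstarM IH. Qed.

Lemma rn_sqn B n (x : B) : cstar x = x -> rn (sqn n x) = rn x ^+ (2 ^ n).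
Proof.
move=> xs; elim: n => [|n IH] /=; first by rewrite expn0 expr1.
by rewrite -{1}(sqn_star n xs) rn_starM IH expnSr exprM.
Qed.

Lemma sqn_hom B D (F : B -> D) n x : (forall y z, F (cmul y z) = cmul (F y) (F z)) ->
  F (sqn n x) = sqn n (F x).
Proof. by move=> FM; elim: n => [//|n IH] /=; rewrite FM IH. Qed.

(* The constant K disappears by the C*-identity applied to x^(2^n). *)
Lemma selfadj_bound B (x : B) (M K : R) : cstar x = x -> 0 <= M ->
  (forall n, rn (sqn n x) <= K * M ^+ (2 ^ n)) -> rn x <= M.
Proof.
move=> xs M0 h; apply: (@root_bound _ _ K) => //; first exact: rn_ge0.
by move=> n; rewrite -rn_sqn.
Qed.

Lemma rn_complete B (u : nat -> B) :
  (forall e : R, 0 < e -> exists N, forall m n, (N <= m)%N -> (N <= n)%N ->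
     rn (u m - u n) <= e) ->
  exists l, forall e : R, 0 < e -> exists N, forall n, (N <= n)%N ->
     rn (u n - l) <= e.
Proof.
move=> cu.
(* A positive element of [R[i]] is real, so balls may be given real radii. *)
have eR (e : C) : 0 < e -> exists2 d : R, 0 < d & e = d%:C%C.
  move=> e0; have : e \is Num.real by rewrite realE ltW.
  case: e e0 => a b; rewrite complex_real => e0 /eqP /= b0; subst b.
  by exists a => //; move: e0; rewrite ltcR.
have cF : cauchy (u @ \oo).
  apply: cauchy_exP => e /eR [d d0 ->].
  have [N NP] := cu (d / 2) (divr_gt0 d0 (ltr0n _ 2)).
  exists (u N); exists N => // n /= Nn.
  rewrite -ball_normE /ball_ /= normE ltcR.
  by apply: le_lt_trans (NP _ _ (leqnn _) Nn) _; lra.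
have /cvg_ex [l ul] : cvg (u @ \oo) by apply: cauchy_cvg.
exists l => e e0.
have eC0 : 0 < (e%:C)%C by rewrite ltcR.
move/cvgrPdistC_le : ul => /(_ _ eC0) [N _ NP]; exists N => n Nn.
by have := NP n Nn; rewrite /= normE lecR.
Qed.

Lemma le_eps0 (r K : R) : (forall e, 0 < e -> e <= 1 -> r <= K * e) -> r <= 0.
Proof.
move=> h; rewrite leNgt; apply/negP => r0.
(* Chosen so that $Ke\le r/2$, against $r\le Ke$. *)
pose e := Num.min 1 (r / (2 * (`|K| + 1))).
have K1 : 0 < 2 * (`|K| + 1) by rewrite mulr_gt0 // ltr_wpDl.
have e0 : 0 < e by rewrite lt_min ltr01 divr_gt0.
have e1 : e <= 1 by rewrite ge_min lexx.
have eK : e * (2 * (`|K| + 1)) <= r.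
  by rewrite -ler_pdivlMr // ge_min lexx orbT.
have := h e e0 e1; have := ler_norm K; nra.
Qed.

Lemma rn_eps_eq B (x y : B) K :
  (forall e, 0 < e -> e <= 1 -> rn (x - y) <= K * e) -> x = y.
Proof.
move=> /le_eps0 h; apply/eqP; rewrite -subr_eq0; apply/eqP/rn_eq0.
by apply/eqP; rewrite eq_le h rn_ge0.
Qed.

(** * Automatic contractivity of star-homomorphisms *)

Section QuasiSqrt.
Variables (B : cstarAlg R) (a : B).
Hypotheses (as_ : cstar a = a) (ale : rn a <= 1 / 2).

(** Fixed-point iteration for $2c=a^2+c^2$, that is $(1-c)^2=1-a^2$: the limit plays the part of
    $1-\sqrt{1-a^2}$ in an algebra that may have no unit. *)
Fixpoint qs n : B :=
  if n is m.+1 then 2^-1 *: (cmul a a + cmul (qs m) (qs m)) else 0.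

Lemma rc_half : rc (2^-1 : C) = 1 / 2.
Proof.
rewrite /rc normfV normr_nat -(rmorph_nat (real_complex R)) -fmorphV /=.
by rewrite mul1r.
Qed.

Lemma rn_half (x : B) : rn (2^-1 *: x) = rn x / 2.
Proof. by rewrite rnZ rc_half; lra. Qed.

Lemma half_conj : (2^-1 : C)^* = 2^-1.
Proof. by rewrite fmorphV rmorph_nat. Qed.

Lemma qs_star n : cstar (qs n) = qs n.
Proof.
elim: n => [|n IH] /=; first exact: cstar0.
by rewrite cstarZ cstarD !cstarM as_ IH half_conj.
Qed.

Lemma qs_comm n : cmul (qs n) a = cmul a (qs n).
Proof.
elim: n => [|n IH] /=; first by rewrite cmul0l cmul0r.
rewrite cmulZl cmulZr cmulDl cmulDr cmulA; congr (_ *: (_ + _)).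
by rewrite -cmulA IH !cmulA IH.
Qed.

Lemma qs_le n : rn (qs n) <= 1 / 2.
Proof.
elim: n => [|n IH] /=; first by rewrite rn0; lra.
rewrite rn_half; have := rnD (cmul a a) (cmul (qs n) (qs n)).
by have := rnM_le ale ale; have := rnM_le IH IH; lra.
Qed.

Lemma sq_sub (x y : B) : cmul x x - cmul y y = cmul x (x - y) + cmul (x - y) y.
Proof. by rewrite cmulBr cmulBl addrA subrK. Qed.

(** On the ball of radius $1/2$ the map $x\mapsto(a^2+x^2)/2$ has Lipschitz constant $1/2$; the
    bound on $a$ keeps the iterates in this ball. *)
Lemma qs_step n : rn (qs n.+1 - qs n) <= (1 / 2) ^+ n.
Proof.
elim: n => [|n IH].
  by rewrite subr0 expr0; apply: le_trans (qs_le 1) _; lra.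
rewrite [qs n.+2]/= [X in _ - X]/= -/(qs n) -scalerBr rn_half opprD addrACA subrr add0r.
rewrite -[2^-1 *: _]/(qs n.+1) sq_sub.
have := rnD (cmul (qs n.+1) (qs n.+1 - qs n)) (cmul (qs n.+1 - qs n) (qs n)).
have := rnM_le (qs_le n.+1) IH; have := rnM_le IH (qs_le n).
by rewrite exprS; lra.
Qed.

Lemma qs_dist n k : rn (qs (n + k) - qs n) <= 2 * (1 / 2) ^+ n.
Proof.
suff : rn (qs (n + k) - qs n) <= 2 * (1 / 2) ^+ n - 2 * (1 / 2) ^+ (n + k).
  have : 0 <= (1 / 2 : R) ^+ (n + k) by rewrite exprn_ge0 // ; lra.
  lra.
elim: k => [|k IH]; first by rewrite addn0 !subrr rn0.
have := rn_triangle (qs (n + k)) (qs (n + k.+1)) (qs n).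
have := qs_step (n + k); rewrite addnS exprS.
lra.
Qed.

Lemma half_exp_small (e : R) : 0 < e -> exists N, forall n, (N <= n)%N ->
  (1 / 2 : R) ^+ n <= e.
Proof.
move=> e0; have [m Km] : exists m : nat, e^-1 < m%:R.
  exists (Num.truncn (e^-1)).+1; exact: truncnS_gt.
exists m => n mn.
have : e^-1 <= 2 ^+ n.
  apply: le_trans (ltW Km) _; rewrite -natrX ler_nat.
  by apply: leq_trans mn _; rewrite ltnW // ltn_expl.
rewrite mul1r exprVn => h; rewrite -[e]invrK lef_pV2 ?posrE ?invr_gt0 //.
Qed.

Lemma quasi_sqrt : exists c : B,
  [/\ cstar c = c, cmul c a = cmul a c & c + c = cmul a a + cmul c c].
Proof.
have [e e0|l ul] := @rn_complete B qs.
  have [N NP] := half_exp_small (divr_gt0 e0 (ltr0n _ 4)).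
  exists N => m n Nm Nn.
  have := rn_triangle (qs N) (qs m) (qs n).
  have := qs_dist N (m - N); have := qs_dist N (n - N).
  rewrite !subnKC // (rnB (qs N)); have := NP N (leqnn _); lra.
(* An identity holds for the limit [l] as soon as its defect is linear in the distances of two
   successive iterates to [l]. *)
have lim K (x y : B) : (forall n, rn (x - y) <= K * (rn (qs n - l) + rn (qs n.+1 - l))) ->
    0 <= K -> x = y.
  move=> h K0; apply: (@rn_eps_eq _ _ _ (2 * K)) => e e0 _.
  have [N NP] := ul e e0; apply: le_trans (h N) _.
  have := NP N (leqnn _); have := NP N.+1 (leqnSn _) => h1 h2.
  have : rn (qs N - l) + rn (qs N.+1 - l) <= 2 * e by lra.
  by move=> /(ler_wpM2l K0); lra.
exists l; split.
- apply: (lim 2) => // n; have := rn_triangle (qs n) (cstar l) l.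
  rewrite -{1}(qs_star n) -cstarB rn_star (rnB l); have := rn_ge0 (qs n.+1 - l); lra.
- apply: (lim (2 * rn a)) => [n|]; last by rewrite mulr_ge0 // rn_ge0.
  have := rn_triangle (cmul (qs n) a) (cmul l a) (cmul a l).
  rewrite -cmulBl qs_comm -cmulBr.
  have := rnM (l - qs n) a; have := rnM a (qs n - l); rewrite (rnB l).
  by have := mulr_ge0 (rn_ge0 a) (rn_ge0 (qs n.+1 - l)); rewrite (rnB (cmul l a)); lra.
- apply: (lim (3 + rn l)) => [n|]; last by rewrite addr_ge0 // rn_ge0.
  have e1 : qs n.+1 + qs n.+1 = cmul a a + cmul (qs n) (qs n).
    rewrite /= -scalerDl; have -> : (2^-1 + 2^-1 : C) = 1 by field.
    by rewrite scale1r.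
  have -> : l + l - (cmul a a + cmul l l) =
      (l - qs n.+1) + (l - qs n.+1) + (cmul (qs n) (qs n) - cmul l l).
    have -> : cmul a a = qs n.+1 + qs n.+1 - cmul (qs n) (qs n) by rewrite e1 addrK.
    rewrite [X in _ = X + _]addrACA -[RHS]addrA; congr (_ + _).
    by rewrite opprD opprB -opprD [RHS]addrA [X in _ = X - _]addrC.
  have := rnD (l - qs n.+1 + (l - qs n.+1)) (cmul (qs n) (qs n) - cmul l l).
  have := rnD (l - qs n.+1) (l - qs n.+1); rewrite sq_sub.
  have := rnD (cmul (qs n) (qs n - l)) (cmul (qs n - l) l).
  have := rnM_le (qs_le n) (lexx (rn (qs n - l))); have := rnM (qs n - l) l.
  rewrite (rnB l); have := mulr_ge0 (rn_ge0 l) (rn_ge0 (qs n.+1 - l)).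
  by have := rn_ge0 (qs n.+1 - l); have := rn_ge0 (qs n - l); lra.
Qed.

End QuasiSqrt.

Section Contractive.
Variables (B D : cstarAlg R) (F : B -> D).
Hypothesis FH : is_star_hom F.

Lemma star_hom0 : F 0 = 0.
Proof. by have := star_homZ FH 0 0; rewrite !scale0r. Qed.

Lemma star_homN x : F (- x) = - F x.
Proof. by rewrite -scaleN1r (star_homZ FH) scaleN1r. Qed.

Lemma star_homB x y : F (x - y) = F x - F y.
Proof. by rewrite (star_homD FH) star_homN. Qed.

Lemma rc_i : rc ('i%C : C) = 1.
Proof. by rewrite /rc normc_def /= expr0n expr1n add0r sqrtr1. Qed.

(* z = -c - ia satisfies z^* z + z + z^* = 0, i.e. 1 + z is "unitary". Hence
   so does F z, whose norm is then at most 2. *)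
Lemma star_hom_half_ball a : cstar a = a -> rn a <= 1 / 2 -> rn (F a) <= 2.
Proof.
move=> sa ale; have [c [sc ca cE]] := quasi_sqrt sa ale.
pose i : C := 'i%C.
have i2 : i * i = -1 by rewrite -expr2 /i sqr_i.
have ic : i^* = - i by apply/eqP; rewrite eq_complex /= oppr0 !eqxx.
pose z := - c - i *: a.
have zs : cstar z = - c + i *: a.
  by rewrite /z cstarB cstarN cstarZ sc sa ic scaleNr opprK.
have zz : cmul (cstar z) z = - (z + cstar z).
  have cq : cmul c (i *: a) = cmul (i *: a) c by rewrite cmulZl cmulZr ca.
  have qq : cmul (i *: a) (i *: a) = - cmul a a.
    by rewrite cmulZl cmulZr scalerA i2 scaleN1r.
  rewrite zs /z cmulDl !cmulBr !(cmulNl, cmulNr) !opprK cq qq opprK.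
  rewrite addrA addrK [X in - X]addrACA addNr addr0 -opprD opprK.
  by rewrite cE addrC.
have w2 : rn (F z) <= 2.
  have := rn_starM (F z); rewrite -(star_hom_star FH) -(star_homM FH) zz.
  rewrite star_homN (star_homD FH) rnN (star_hom_star FH).
  have := rnD (F z) (cstar (F z)); rewrite rn_star.
  by have := rn_ge0 (F z); nra.
(* $z^*-z=2ia$ recovers $a$ from $z$. *)
have : rn (F ((2 * i) *: a)) <= 4.
  have -> : (2 * i) *: a = cstar z - z.
    rewrite zs /z opprB opprK (addrC _ c) addrACA addNr add0r -scalerDl.
    by congr (_ *: _); ring.
  rewrite star_homB (star_hom_star FH).
  by have := rnD (cstar (F z)) (- F z); rewrite rnN rn_star; lra.
rewrite (star_homZ FH) rnZ rcM rc_i.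
have -> : rc (2 : C) = 2 by rewrite /rc normr_nat -(rmorph_nat (real_complex R)).
by lra.
Qed.

Lemma rc_real (r : R) : 0 <= r -> rc (r%:C%C) = r.
Proof. by move=> r0; rewrite /rc ger0_norm // lecR. Qed.

(** Scaling [star_hom_half_ball] bounds $F$ by $4$ on self-adjoint elements. Applied to the powers
    $a^{2^n}$ the constant disappears, and the C*-identity leads from $x^*x$ to $x$. *)
Lemma star_hom_contractive x : rn (F x) <= rn x.
Proof.
have h1 a : cstar a = a -> rn (F a) <= 4 * rn a.
  move=> sa; have [a0|a0] := eqVneq (rn a) 0.
    by rewrite (rn_eq0 a0) star_hom0 !rn0; lra.
  have ap : 0 < rn a by rewrite lt_neqAle eq_sym a0 rn_ge0.
  pose k := (2 * rn a)^-1.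
  have k0 : 0 <= k by rewrite invr_ge0 mulr_ge0 // rn_ge0.
  have := @star_hom_half_ball (k%:C%C *: a).
  have kc : (k%:C%C)^* = k%:C%C by exact: conjc_real.
  rewrite cstarZ sa kc (star_homZ FH) !rnZ rc_real // => /(_ erefl).
  have -> : k * rn a = 1 / 2 by rewrite /k; field.
  move=> /(_ (lexx _)).
  by rewrite /k ler_pdivrMl; lra.
have h2 a : cstar a = a -> rn (F a) <= rn a.
  move=> sa; apply: (@selfadj_bound _ _ _ 4); first by rewrite -(star_hom_star FH) sa.
    exact: rn_ge0.
  move=> n; rewrite -(sqn_hom n a (star_homM FH)) -rn_sqn //.
  by apply: h1; exact: sqn_star.
have := h2 (cmul (cstar x) x); rewrite cstarM cstarK => /(_ erefl).
rewrite (star_homM FH) (star_hom_star FH) !rn_starM => h.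
by rewrite -(@ler_pXn2r _ 2) // nnegrE rn_ge0.
Qed.

End Contractive.

Lemma dense_rn B (X : set B) : dense X -> forall x (e : R), 0 < e ->
  exists2 y, X y & rn (x - y) <= e.
Proof.
move=> dX x e e0; have eC : 0 < e%:C%C by rewrite ltcR.
have [|y [+ Xy]] := dX (ball (x : B) e%:C%C) _ (@ball_open _ B x _).
  by exists x; exact: ballxx.
rewrite -ball_normE /= normE ltcR => /ltW; by exists y.
Qed.

Lemma rn_dense B (X : set B) : (forall x (e : R), 0 < e ->
  exists2 y, X y & rn (x - y) <= e) -> dense X.
Proof.
move=> h O [x Ox] oO; have : nbhs x O by exact: open_nbhs_nbhs.
rewrite -nbhs_ballE => -[e /= e0 eO].
have : e \is Num.real by rewrite realE ltW.
case: e e0 eO => a b; rewrite complex_real => e0 eO /eqP /= b0; subst b.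
have a0 : 0 < a by move: e0; rewrite ltcR.
have [y Xy xy] := h x (a / 2) (divr_gt0 a0 (ltr0n _ 2)).
exists y; split => //; apply: eO; rewrite -ball_normE /= normE ltcR.
by apply: le_lt_trans xy _; lra.
Qed.

(** * Extension of densely defined homomorphisms *)

Section GraphExtension.
Variables (B D : cstarAlg R) (Gr : B -> D -> Prop).
Hypotheses (GrD : forall x y x' y', Gr x y -> Gr x' y' -> Gr (x + x') (y + y'))
  (GrZ : forall a x y, Gr x y -> Gr (a *: x) (a *: y))
  (GrM : forall x y x' y', Gr x y -> Gr x' y' -> Gr (cmul x x') (cmul y y'))
  (Gr_star : forall x y, Gr x y -> Gr (cstar x) (cstar y))
  (Gr_le : forall x y, Gr x y -> rn y <= rn x)
  (Gr_dense : forall x (e : R), 0 < e ->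
     exists x' y', Gr x' y' /\ rn (x - x') <= e).

(** The error is kept in the form $Ke$ so that sums, multiples and products have it again without
    rescaling $e$; the restriction $e\le1$ absorbs the quadratic terms of a product. *)
Definition Gr_cl x y := exists2 K : R, 0 <= K & forall e : R, 0 < e -> e <= 1 ->
  exists x' y', [/\ Gr x' y', rn (x - x') <= K * e & rn (y - y') <= K * e].

Lemma GrB x y x' y' : Gr x y -> Gr x' y' -> Gr (x - x') (y - y').
Proof.
by move=> h /(GrZ (-1)); rewrite !scaleN1r; exact: GrD.
Qed.

Lemma Gr_sub_cl x y : Gr x y -> Gr_cl x y.
Proof.
move=> h; exists 0 => // e _ _; exists x, y.
by rewrite !subrr !rn0 mul0r.
Qed.

Lemma Gr_cl_ex x : exists y, Gr_cl x y.
Proof.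
pose e n : R := (1 / 2) ^+ n.
have e0 n : 0 < e n by rewrite exprn_gt0 //; lra.
have /choice [u uP] : forall n, exists p : B * D, Gr p.1 p.2 /\ rn (x - p.1) <= e n.
  by move=> n; have [x' [y' h]] := Gr_dense x (e0 n); exists (x', y').
have [d d0|l ul] := @rn_complete D (fun n => (u n).2).
  have [N NP] := half_exp_small (divr_gt0 d0 (ltr0n _ 2)).
  exists N => m n /NP em /NP en.
  have [g1 h1] := uP m; have [g2 h2] := uP n.
  apply: le_trans (Gr_le (GrB g1 g2)) _.
  have := rn_triangle x (u m).1 (u n).1; rewrite (rnB (u m).1 x).
  by move: em en h1 h2; rewrite /e; lra.
exists l, 1 => // d d0 _; have [N NP] := ul d d0.
have [M MP] := half_exp_small d0.
have [g h] := uP (maxn M N); exists (u (maxn M N)).1, (u (maxn M N)).2.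
split => //; rewrite mul1r.
  by apply: le_trans h _; apply: MP; exact: leq_maxl.
by rewrite rnB; apply: NP; exact: leq_maxr.
Qed.

Lemma Gr_cl_uniq x y y' : Gr_cl x y -> Gr_cl x y' -> y = y'.
Proof.
move=> [K K0 h] [K' K'0 h']; apply: (@rn_eps_eq _ _ _ (2 * (K + K'))) => e e0 e1.
have [a [b [g ha hb]]] := h e e0 e1; have [a' [b' [g' ha' hb']]] := h' e e0 e1.
have := Gr_le (GrB g g'); have := rn_triangle x a a'.
have := rn_triangle b y y'; have := rn_triangle b' b y'.
by rewrite (rnB a x) (rnB b' y'); lra.
Qed.

Lemma Gr_clD x y x' y' : Gr_cl x y -> Gr_cl x' y' -> Gr_cl (x + x') (y + y').
Proof.
move=> [K K0 h] [K' K'0 h']; exists (K + K'); first exact: addr_ge0.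
move=> e e0 e1.
have [a [b [g ha hb]]] := h e e0 e1; have [a' [b' [g' ha' hb']]] := h' e e0 e1.
exists (a + a'), (b + b'); split; first exact: GrD.
  by rewrite opprD addrACA; have := rnD (x - a) (x' - a'); lra.
by rewrite opprD addrACA; have := rnD (y - b) (y' - b'); lra.
Qed.

Lemma Gr_clZ (k : C) x y : Gr_cl x y -> Gr_cl (k *: x) (k *: y).
Proof.
move=> [K K0 h]; exists (rc k * K); first by rewrite mulr_ge0 // rc_ge0.
move=> e e0 e1; have [a [b [g ha hb]]] := h e e0 e1.
exists (k *: a), (k *: b); split; first exact: GrZ.
  by rewrite -scalerBr rnZ -mulrA; apply: ler_wpM2l => //; exact: rc_ge0.
by rewrite -scalerBr rnZ -mulrA; apply: ler_wpM2l => //; exact: rc_ge0.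
Qed.

Lemma rn_mul_approx (E : cstarAlg R) (x a x' a' : E) (K K' e : R) : 0 < e -> e <= 1 ->
  0 <= K -> 0 <= K' -> rn (x - a) <= K * e -> rn (x' - a') <= K' * e ->
  rn (cmul x x' - cmul a a') <= (rn x * K' + K * (rn x' + K')) * e.
Proof.
move=> e0 e1 K0 K'0 h h'.
have -> : cmul x x' - cmul a a' = cmul x (x' - a') + cmul (x - a) a'.
  by rewrite cmulBr cmulBl addrA subrK.
have ha' : rn a' <= rn x' + K'.
  have := rnD x' (a' - x'); rewrite addrC subrK (rnB a').
  by have : K' * e <= K' * 1 by [apply: ler_wpM2l]; lra.
apply: le_trans (rnD _ _) _.
have := rnM_le (lexx (rn x)) h'; have := rnM_le h ha'; lra.
Qed.

Lemma Gr_clM x y x' y' : Gr_cl x y -> Gr_cl x' y' -> Gr_cl (cmul x x') (cmul y y').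
Proof.
move=> [K K0 h] [K' K'0 h'].
pose L := (rn x * K' + K * (rn x' + K')) + (rn y * K' + K * (rn y' + K')).
have p1 (E : cstarAlg R) (a b : E) : 0 <= rn a * K' + K * (rn b + K').
  by rewrite addr_ge0 // mulr_ge0 // ?rn_ge0 // addr_ge0 // rn_ge0.
exists L => [|e e0 e1]; first by rewrite addr_ge0.
have [a [b [g ha hb]]] := h e e0 e1; have [a' [b' [g' ha' hb']]] := h' e e0 e1.
exists (cmul a a'), (cmul b b'); split; first exact: GrM.
  apply: le_trans (rn_mul_approx e0 e1 K0 K'0 ha ha') _.
  by rewrite ler_pM2r // lerDl.
apply: le_trans (rn_mul_approx e0 e1 K0 K'0 hb hb') _.
by rewrite ler_pM2r // lerDr.
Qed.

Lemma Gr_cl_star x y : Gr_cl x y -> Gr_cl (cstar x) (cstar y).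
Proof.
move=> [K K0 h]; exists K => // e e0 e1; have [a [b [g ha hb]]] := h e e0 e1.
by exists (cstar a), (cstar b); rewrite -!cstarB !rn_star; split => //; exact: Gr_star.
Qed.

(** Contractivity makes the closure of [Gr] single-valued; density and completeness make it
    total. *)
Lemma graph_star_hom : exists2 F : B -> D, is_star_hom F &
  forall x y, Gr x y -> F x = y.
Proof.
have [F FP] := choice Gr_cl_ex; exists F; last first.
  by move=> x y /Gr_sub_cl; exact: Gr_cl_uniq.
split.
- by move=> x y; apply: Gr_cl_uniq (FP _) _; exact: Gr_clD.
- by move=> a x; apply: Gr_cl_uniq (FP _) _; exact: Gr_clZ.
- by move=> x y; apply: Gr_cl_uniq (FP _) _; exact: Gr_clM.
- by move=> x; apply: Gr_cl_uniq (FP _) _; exact: Gr_cl_star.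
Qed.

End GraphExtension.

Lemma star_hom_dense_eq B D (F H : B -> D) (X : set B) :
  is_star_hom F -> is_star_hom H -> dense X -> (forall x, X x -> F x = H x) ->
  F = H.
Proof.
move=> sF sH dX FH; apply/funext => x.
apply: (@rn_eps_eq _ _ _ 2) => e e0 _.
have [y Xy xy] := dense_rn dX x e0.
have h1 : rn (F x - F y) <= rn (x - y).
  by rewrite -(star_homB sF); exact: star_hom_contractive.
have h2 : rn (F y - H x) <= rn (y - x).
  by rewrite FH // -(star_homB sH); exact: star_hom_contractive.
by have := rn_triangle (F y) (F x) (H x); rewrite (rnB y) in h2; lra.
Qed.

End CStarGeneral.

(** * Representations and covers *)

Section BlockCover.
Variables (G : sepGraph) (A : adaptable G).
Local Notation S := (SE A).
Local Open Scope SE_scope.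
Local Notation V := (fun v => gen A (gV v)).
Local Notation E := (fun e => gen A (gE e)).

Lemma gen_neq0 x : gen A x <> 0.
Proof. exact: pos_neq0 (pos_gen A x). Qed.

Lemma gen_star_neq0 x : (gen A x)^* <> 0.
Proof. by move=> h; apply: (@gen_neq0 x); rewrite -(spstarK (gen A x)) h spstar0. Qed.

Lemma gen_mull_neq0 x (s : S) : V (lrng x) * s = s -> s <> 0 -> gen A x * s <> 0.
Proof.
move=> vs s0 h; apply: s0; rewrite -vs -(gen_iso A x) -spmulA h.
by rewrite spmul0r.
Qed.

(* That is, the ee^* with e in X form a cover of v. *)
Lemma block_cover v w (a : S) (X : set (edge G)) : pos v w a -> blocks v X ->
  exists2 e, X e & (E e)^* * a <> 0.
Proof.
move=> pa; elim: pa X => [u|x u s ps IH] X bX.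
  have [_ _ ne] := blocks_partition u.
  have [e Xe] := ne X bX; exists e => //.
  have := genVE A e; rewrite (block_src bX Xe) => h.
  rewrite -(genV_star A u) -spstarM h; exact: gen_star_neq0.
case: x ps IH bX => [v'|e|b i v'] /= ps IH bX.
- by have [e Xe h] := IH X bX; exists e; rewrite ?(pos_src ps).
- have [Xe|nXe] := pselect (X e).
    exists e => //; rewrite spmulA genEE (pos_src ps); exact: pos_neq0 ps.
  case: (edgeP A e) => [nfr|p j fr nm eE|p j t fr nm eE].
  + have [Y bY] := reg_block nfr (component_mem _).
    have [Z bZ Ze] := block_of e.
    by case: nXe; move: bX bZ; rewrite bY => -> <-.
  (* A loop $\alpha_j$ outside [X] returns to the same vertex, so the induction hypothesis for [X]
     provides $f$. Then $f^*$ moves past $\alpha_j$ by (R3) or, if $f$ is a $\beta$, by (R8) at the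
     cost of a $t$. *)
  + move: bX; rewrite {1}eE alpha_src // => bX.
    move: (bX); rewrite (free_blocks fr nm) => -[i _ iX].
    have ij : i <> j.
      by move=> ij; apply: nXe; rewrite -iX eE ij; exact: in_alpha.
    move: bX ps IH; rewrite eE alpha_rng // => bX ps IH.
    have [f Xf fs] := IH X bX.
    case: (edgeP A f) => [nfr|q k frq nmq fE|q k t frq nmq fE].
    * by move: nfr; rewrite (block_src bX Xf) fvert_comp.
    * have qp : q = p.
        by rewrite -(fvert_comp fr) -(fvert_comp frq) -(alpha_src k) // -fE (block_src bX Xf).
      subst q; have ki : k = i.
        apply: (block_index (e := f) fr nm); first by rewrite fE; exact: in_alpha.
        by rewrite iX.
      exists f => //; rewrite fE ki spmulA genAAs // -spmulA -[gen A _]/(gen A (gE (alpha j))).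
      apply: gen_mull_neq0; last by rewrite -ki -fE.
      rewrite /= alpha_rng // spmulA -{1}(genV_star A) -spstarM.
      have := genEV A (alpha i); rewrite alpha_rng // => ->.
      by [].
    * have qp : q = p.
        by rewrite -(fvert_comp fr) -(fvert_comp frq) -(beta_src t) // -fE (block_src bX Xf).
      subst q; have ki : k = i.
        apply: (block_index (e := f) fr nm); first by rewrite fE; exact: in_beta.
        by rewrite iX.
      have jk : j <> k by rewrite ki => /esym.
      exists f => //; rewrite fE spmulA.
      have -> : (E (beta t))^* * E (alpha j) =
          gen A (gT false (unbump k j) (rng (beta t))) * (E (beta t))^*.
        rewrite -[LHS]spstarK spstarM spstarK genABs // spstarM genT_star.
        by [].
      rewrite -spmulA; apply: gen_mull_neq0; last by rewrite -fE.
      rewrite /= spmulA -{1}(genV_star A) -spstarM.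
      by rewrite genEV.
  (* The path leaves the vertex by a $\beta$ of another block. The loop $\alpha(p,i)$ of [X] works,
     since by (R8) its star passes this $\beta$ and becomes an invertible $t$. *)
  + move: bX; rewrite {1}eE beta_src // => bX.
    move: (bX); rewrite (free_blocks fr nm) => -[i _ iX].
    have ij : i <> j.
      by move=> ij; subst j; apply: nXe; rewrite -iX eE; exact: in_beta.
    exists (alpha i); first by rewrite -iX; exact: in_alpha.
    rewrite eE spmulA genABs // -spmulA; apply: gen_mull_neq0.
      by rewrite /= spmulA genVT.
    apply: gen_mull_neq0; first by rewrite /= -eE (pos_src ps).
    exact: pos_neq0 ps.
- have [e Xe h] := IH X bX; exists e => //.
  have se := block_src bX Xe.
  have [j hj] := genT_edge A (~~ b) i e; rewrite se in hj.
  have -> : (E e)^* * (gen A (gT b i v') * s) = gen A (gT b j (rng e)) * ((E e)^* * s).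
    rewrite !spmulA; congr (_ * _).
    have := congr1 (@pstar _ _) hj; rewrite !spstarM !genT_star negbK.
    by [].
  apply: gen_mull_neq0 => //=.
  by rewrite spmulA -{1}(genV_star A) -spstarM genEV.
Qed.

Lemma block_cover_idem v (X : set (edge G)) (f : S) : blocks v X ->
  idem f -> ile f (V v) -> f <> 0 -> exists2 e, X e & f * (E e * (E e)^*) <> 0.
Proof.
move=> bX jf fv f0; have [//|[u [w [a [pa fE]]]]] := idem_pos jf.
have uv : u = v.
  apply: contrapT => uv; apply: f0; rewrite -fv fE -(pos_src_star pa).
  by rewrite -!spmulA (genV_orth A uv) !spmul0r.
subst u; have [e Xe h] := block_cover pa bX; exists e => //.
move=> h0; apply: h.
have := congr1 (fun t => a^* * t * E e) h0 => /=.
rewrite fE spmul0r spmul0l !spmulA (pos_iso pa) (pos_rng_star pa).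
rewrite -[X in X = _]spmulA genEE -spmulA genEV.
by move=> /(congr1 (@pstar _ _)); rewrite spstarM spstarK spstar0.
Qed.

Lemma edge_orth v (X : set (edge G)) e f : blocks v X -> X e -> X f -> e <> f ->
  (E e * (E e)^*) * (E f * (E f)^*) = 0.
Proof.
move=> bX Xe Xf ef; rewrite !spmulA -(spmulA (E e)).
by rewrite (genEE_block A bX Xe Xf ef) spmul0r spmul0l.
Qed.

End BlockCover.

(** * Tightness of the representations of (R1)-(R10) *)

Section Representations.
Variables (R : realType) (G : sepGraph) (A : adaptable G).
Variables (B : cstarAlg R) (phi : sgen G -> B).
Hypothesis phiP : satisfies_R1_R10 A phi.
Local Notation S := (SE A).
Local Notation V := (fun v => gen A (gV v)).
Local Notation E := (fun e => gen A (gE e)).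
Local Notation io := (iotaS phi : S -> B).
Local Open Scope SE_scope.

Lemma iotaM s t : io (s * t) = cmul (io s) (io t).
Proof.
have [x ->] := pcls_surj s; have [y ->] := pcls_surj t.
by rewrite pmul_cls !iotaS_cls.
Qed.

Lemma iota_star s : io s^* = cstar (io s).
Proof. by have [x ->] := pcls_surj s; rewrite pstar_cls !iotaS_cls. Qed.

Lemma iota0 : io 0 = 0%R.
Proof. by rewrite /pzero iotaS_cls. Qed.

Lemma iota_gen x : io (gen A x) = phi x.
Proof. by rewrite /gen iotaS_cls. Qed.

Lemma rn_proj (p : B) : cstar p = p -> cmul p p = p -> (rn p <= 1)%R.
Proof.
move=> ps pp; have := rn_starM p; rewrite ps pp; have := rn_ge0 p.
nra.
Qed.

Lemma iota_idem_star e : idem e -> cstar (io e) = io e.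
Proof. by move=> ie; rewrite -iota_star idem_star. Qed.

Lemma iota_idem e : idem e -> cmul (io e) (io e) = io e.
Proof. by move=> ie; rewrite -iotaM ie. Qed.

Lemma iotaC e f : idem e -> idem f -> cmul (io e) (io f) = cmul (io f) (io e).
Proof. by move=> ie jf; rewrite -!iotaM idemC. Qed.

Lemma rn_iota s : (rn (io s) <= 1)%R.
Proof.
have := rn_starM (io s); rewrite -iota_star -iotaM.
have := rn_proj (iota_idem_star (idem_ss s)) (iota_idem (idem_ss s)).
by have := rn_ge0 (io s); nra.
Qed.

Lemma iota_block v (X : set (edge G)) : blocks v X -> exists s : seq (edge G),
  [/\ uniq s, X = [set` s] & io (V v) = (\sum_(e <- s) io (E e * (E e)^*)%SE)%R].
Proof.
move=> bX; have /finite_seqP[s0 sX] := ad_finsep A bX.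
have sX' : X = [set` undup s0].
  by rewrite sX; apply/seteqP; split=> e /=; rewrite mem_undup.
exists (undup s0); split => //; first exact: undup_uniq.
have := phiP.2 v X bX; rewrite {1}sX' -fsbig_seq ?undup_uniq // iota_gen => ->.
by apply: eq_bigr => e _; rewrite iotaM iota_star !iota_gen.
Qed.

Definition decides (d c : S) :=
  (d * d^*) * (c * c^*) = d * d^* \/ (d * d^*) * (c * c^*) = 0.

Definition expansion v (ds : seq S) :=
  (forall d, d \in ds -> exists w, pos v w d) /\
  io (V v) = (\sum_(d <- ds) io (d * d^*)%SE)%R.

Lemma decides_mul v w u (x d c : S) : pos v w x -> pos w u d ->
  decides d c -> decides (x * d) (x * c).
Proof.
move=> px pd dc; rewrite /decides.
have -> : x * d * (x * d)^* * (x * c * (x * c)^*) =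
    x * ((d * d^*) * (c * c^*)) * x^*.
  rewrite !spstarM !spmulA.
  have -> : x * d * d^* * x^* * x = x * d * (d^* * (x^* * x)) by rewrite !spmulA.
  by rewrite (pos_iso px) (pos_src_star pd).
case: dc => ->; last by right; rewrite spmul0r spmul0l.
by left; rewrite spstarM !spmulA.
Qed.

Lemma expansion_conj v w (x : S) ds : pos v w x -> expansion w ds ->
  (forall d, d \in [seq x * d | d <- ds] -> exists u, pos v u d) /\
  io (x * x^*) = (\sum_(d <- [seq (x * d)%SE | d <- ds]) io (d * d^*)%SE)%R.
Proof.
move=> px [pd dE]; split.
  move=> d /mapP[d' /pd [u pd'] ->]; exists u; exact: pos_mul px pd'.
rewrite -{1}(pos_rng px) !iotaM dE.
rewrite big_map; elim: (ds) => [|d l IH].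
  by rewrite !big_nil cmul0r cmul0l.
rewrite !big_cons cmulDr cmulDl IH; congr +%R.
by rewrite -!iotaM spstarM !spmulA.
Qed.

(** Induction along [c]: (R10) for the block of the first edge writes the vertex as a sum of
    projections $ff^*$. The summand of that edge is refined by the expansion for the rest of [c],
    and the others are orthogonal to [c] by (R2). All other letters $x$ satisfy $xx^*=v$ and merely
    transport the expansion. *)
Lemma expand v w (c : S) : pos v w c -> exists ds,
  expansion v ds /\ (forall d, d \in ds -> decides d c).
Proof.
elim=> [u|x u s ps [ds [dsX dec]]].
  exists [:: V u]; split.
    split; last by rewrite big_seq1 genV_star genV_idem.
    by move=> d; rewrite inE => /eqP ->; exists u; exact: pos_nil.
  by move=> d; rewrite inE => /eqP ->; left; rewrite genV_star !genV_idem.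
have unit_case : gen A x * (gen A x)^* = V (lsrc x) -> exists ds,
    expansion (lsrc x) ds /\ (forall d, d \in ds -> decides d (gen A x * s)).
  move=> xx; exists [seq gen A x * d | d <- ds].
  have := expansion_conj (pos_gen A x) dsX; rewrite xx; split => //.
  move=> d /mapP[d' d'ds ->]; have [z pd'] := dsX.1 _ d'ds.
  exact: decides_mul (pos_gen A x) pd' (dec _ d'ds).
case: x ps dsX unit_case => [v'|e|b i v'] ps dsX uc.
- by apply: uc; rewrite genV_star genV_idem.
- have [X bX Xe] := block_of e.
  have [l [lu lX lE]] := iota_block bX.
  have [cd cE] := expansion_conj (pos_gen A (gE e)) dsX.
  pose g f := if f == e then [seq E e * d | d <- ds] else [:: E f].
  exists (flatten (map g l)); split; first split.
  + move=> d /flattenP[_ /mapP[f fl ->]]; rewrite /g.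
    case: eqP => [_ /cd //|_]; rewrite inE => /eqP ->.
    have Xf : X f by rewrite lX.
    exists (rng f); have := pos_gen A (gE f).
    by rewrite /= (block_src bX Xf).
  + rewrite big_flatten big_map /= lE; apply: eq_bigr => f _; rewrite /g.
    by case: eqP => [->|_]; rewrite ?big_seq1.
  + move=> d /flattenP[_ /mapP[f fl ->]]; rewrite /g.
    case: eqP => [_ /mapP[d' d'ds ->]|fe].
      have [z pd'] := dsX.1 _ d'ds.
      exact: decides_mul (pos_gen A (gE e)) pd' (dec _ d'ds).
    have Xf : X f by rewrite lX.
    rewrite inE => /eqP ->; right; rewrite !spmulA -(spmulA (E f)).
    by rewrite (genEE_block A bX Xf Xe fe) spmul0r !spmul0l.
- by apply: uc; rewrite genT_star genTK.
Qed.

(** A common refinement is obtained one [c] at a time: if $d^*c=d'c'^*$ is the Ore completion, the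
    piece $d$ is refined by an expansion of its range with respect to $d'$. Pieces below $d$ inherit
    what $d$ has already decided. *)
Lemma expand_seq v (cs : seq S) : (forall c, c \in cs -> exists w, pos v w c) ->
  exists ds, expansion v ds /\ (forall d c, d \in ds -> c \in cs -> decides d c).
Proof.
elim: cs => [_|c cs IH pcs].
  exists [:: V v]; split=> //; split; last by rewrite big_seq1 genV_star genV_idem.
  by move=> d; rewrite inE => /eqP ->; exists v; exact: pos_nil.
have [|ds [[pds dsE] dec]] := IH.
  by move=> d dcs; apply: pcs; rewrite inE dcs orbT.
have [w pc] := pcs c (mem_head _ _).
have refine d : exists l : seq S, d \in ds ->
    [/\ forall d', d' \in l -> exists u, pos v u d',
        forall d', d' \in l -> decides d' c /\ (d' * d'^*) * (d * d^*) = d' * d'^* &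
        io (d * d^*) = (\sum_(d' <- l) io (d' * d'^*)%SE)%R].
  have [dds|ndds] := boolP (d \in ds); last by exists [::].
  have [u pd] := pds d dds.
  have [dc0|[z [c' [d' [pd' pc' h1 h2]]]]] := ore_word pd pc.
    exists [:: d] => _; split; last by rewrite big_seq1.
      by move=> d'; rewrite inE => /eqP ->; exists u.
    move=> d'; rewrite inE => /eqP ->; split; last exact: pos_proj pd.
    by right; rewrite !spmulA -(spmulA d) dc0 spmul0r spmul0l.
  have [l [lX ldec]] := expand pd'.
  have [cd cE] := expansion_conj pd lX.
  exists [seq d * x | x <- l] => _; split => // _ /mapP[x xl ->].
  have [y px] := lX.1 x xl.
  have le1 : (d * x) * (d * x)^* * (d * d^*) = (d * x) * (d * x)^*.
    rewrite !spstarM !spmulA.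
    have -> : d * x * x^* * d^* * d * d^* = d * x * (x^* * (d^* * d)) * d^*.
      by rewrite !spmulA.
    by rewrite (pos_iso pd) (pos_src_star px).
  split=> //.
  have e1 : (d * x) * (d * x)^* * (c * c^*) = d * ((x * x^*) * (d' * d'^*)) * d^*.
    rewrite -le1.
    have -> : d * x * (d * x)^* * (d * d^*) * (c * c^*) =
       d * x * (d * x)^* * d * (d^* * c) * c^* by rewrite !spmulA.
    rewrite h1.
    have -> : d * x * (d * x)^* * d = d * x * (x^* * (d^* * d)).
      by rewrite spstarM !spmulA.
    rewrite (pos_iso pd) (pos_src_star px).
    have -> : d * x * x^* * (d' * c'^*) * c^* = d * x * x^* * d' * (c * c')^*.
      by rewrite spstarM !spmulA.
    by rewrite -h2 spstarM !spmulA.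
  rewrite /decides e1; case: (ldec x xl) => ->.
    by left; rewrite spstarM !spmulA.
  by right; rewrite spmul0r spmul0l.
have [g gP] := choice refine.
exists (flatten (map g ds)); split; first split.
- move=> d /flattenP[_ /mapP[f fds ->]]; have [h _ _] := gP f fds; exact: h.
- rewrite big_flatten big_map /= dsE big_seq [RHS]big_seq.
  by apply: eq_bigr => d dds; have [_ _] := gP d dds.
- move=> d c1 /flattenP[_ /mapP[f fds ->]] df.
  have [_ /(_ d df) [h1 h2] _] := gP f fds.
  rewrite inE => /orP[/eqP ->//|c1cs]; rewrite /decides -h2 -spmulA.
  case: (dec f c1 fds c1cs) => ->; first by left.
  by right; rewrite spmul0r.
Qed.

(** The product $y\prod_z(1-z)$, written without a unit. *)
Definition negs (zs : seq S) (y : B) : B :=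
  foldr (fun z t => (t - cmul t (io z))%R) y zs.

Lemma negsD zs x y : negs zs (x + y)%R = (negs zs x + negs zs y)%R.
Proof.
by elim: zs => [//|z zs IH] /=; rewrite IH cmulDl opprD addrACA.
Qed.

Lemma negs0 zs : negs zs 0%R = 0%R.
Proof. by elim: zs => [//|z zs IH] /=; rewrite IH cmul0l subrr. Qed.

Lemma negs_sum zs (l : seq S) (F : S -> B) :
  negs zs (\sum_(i <- l) F i)%R = (\sum_(i <- l) negs zs (F i))%R.
Proof.
elim: l => [|i l IH]; first by rewrite !big_nil negs0.
by rewrite !big_cons negsD IH.
Qed.

Lemma negs_mul zs z y : idem z -> (forall z', z' \in zs -> idem z') ->
  negs zs (cmul y (io z)) = cmul (negs zs y) (io z).
Proof.
move=> iz; elim: zs => [//|z' zs IH] izs /=.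
rewrite IH => [|t tzs]; last by apply: izs; rewrite inE tzs orbT.
by rewrite cmulBl -!cmulA (iotaC iz (izs _ (mem_head _ _))).
Qed.

Lemma negs_le zs z y : (forall z', z' \in zs -> idem z') -> z \in zs ->
  cmul y (io z) = y -> negs zs y = 0%R.
Proof.
elim: zs => [//|z' zs IH] izs; rewrite inE => /orP[/eqP zz'|zzs] yz /=.
  subst z'; have := @negs_mul zs z y (izs _ (mem_head _ _)).
  rewrite yz => <-; first by rewrite subrr.
  by move=> t tzs; apply: izs; rewrite inE tzs orbT.
rewrite IH ?cmul0l ?subrr // => t tzs.
by apply: izs; rewrite inE tzs orbT.
Qed.

(** Expand $e=aa^*$ into range projections that decide every $z$. Each piece is nonzero, so it meets
    some $z$ of the cover; then it lies below this $z$ and is killed by $1-z$. *)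
Lemma iota_tight e Z zs : idem e -> finite_cover e Z -> Z = [set` zs] ->
  negs zs (io e) = 0%R.
Proof.
move=> /idem_pos[->|[v [w [a [pa ->]]]]] [_ Ze cov] ZE; first by rewrite iota0 negs0.
have izs z : z \in zs -> idem z by move=> zz; have [] := Ze z; rewrite ?ZE.
(* Compression by $a$ moves each $z\le aa^*$ to the range vertex of $a$, where [expand_seq] is
   applied; [None] stands for a zero compression. *)
have compress z : exists o : option S, z \in zs ->
    if o is Some c then (exists u, pos w u c) /\ a^* * z * a = c * c^*
    else a^* * z * a = 0.
  have [zz|] := boolP (z \in zs); last by exists None.
  have := idem_pos (idem_conj a (izs z zz)).
  move=> [->|[v' [u [c [pc h]]]]]; first by exists None.
  exists (Some c) => _; split=> //; exists u.
  suff -> : w = v' by [].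
  apply: contrapT => wv; apply: (pos_neq0 pc).
  have cc : c = a^* * z * a * c by rewrite h -spmulA (pos_iso pc) (pos_rng pc).
  have Vwc : V w * c = c by rewrite {1}cc !spmulA (pos_rng_star pa) -cc.
  by rewrite -Vwc -(pos_src pc) spmulA (genV_orth A wv) spmul0l.
have [oc ocP] := choice compress.
have [|ds [dsX dec]] := @expand_seq w (pmap oc zs).
  by move=> c; rewrite mem_pmap => /mapP[z zz oz]; have := ocP z zz; rewrite -oz => -[].
have [pd ->] := expansion_conj pa dsX.
rewrite negs_sum big_seq big1 // => f /[dup] /pd [u pf] /mapP[d dds fE].
have [y pd'] := dsX.1 d dds.
have f0 : f * f^* <> 0.
  by move=> h; apply: (pos_neq0 pf); rewrite -(pos_rng pf) -(pos_iso pf) spmulA h spmul0l.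
have fe : f * f^* * (a * a^*) = f * f^*.
  rewrite fE !spstarM !spmulA.
  have -> : a * d * d^* * a^* * a * a^* = a * d * (d^* * (a^* * a)) * a^*.
    by rewrite !spmulA.
  by rewrite (pos_iso pa) (pos_src_star pd').
have [z Zz fz] := cov _ (conj (pos_idem pf) fe) f0.
have zz : z \in zs by move: Zz; rewrite ZE.
apply: (@negs_le _ z) => //; rewrite -iotaM; congr (iotaS _ _).
have [iz ze] := Ze z Zz.
have zE : z = a * (a^* * z * a) * a^*.
  rewrite -{1}ze (idemC iz (pos_idem pa)) -{1}ze.
  by rewrite !spmulA.
have := ocP z zz; case oz : (oc z) => [c|] => [[_ h]|h].
  have e1 : f * f^* * z = a * ((d * d^*) * (c * c^*)) * a^*.
    rewrite zE h fE spstarM.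
    have -> : a * d * (d^* * a^*) * (a * (c * c^*) * a^*) =
       a * d * (d^* * (a^* * a)) * (c * c^*) * a^* by rewrite !spmulA.
    by rewrite (pos_iso pa) (pos_src_star pd') !spmulA.
  have : decides d c.
    by apply: dec => //; rewrite mem_pmap; apply/mapP; exists z.
  move=> [dc|dc]; first by rewrite e1 dc fE spstarM !spmulA.
  by case: fz; rewrite e1 dc spmul0r spmul0l.
by case: fz; rewrite zE h spmul0r spmul0l spmul0r.
Qed.

End Representations.

(** * Tight filters and germs *)

Section TightFilters.
Variables (G : sepGraph) (A : adaptable G).
Local Notation S := (SE A).
Local Open Scope SE_scope.
Local Notation X := (tight A).
Implicit Types (e f s t : S) (x y : X).

Lemma tightP x : is_tight (val x).
Proof. exact: set_mem (valP x). Qed.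

Lemma Dom_idem e x : Dom e x -> idem e.
Proof. by have [[_ h _ _ _] _] := tightP x; exact: h. Qed.

Lemma Dom0 x : ~ Dom 0 x.
Proof. by have [[]] := tightP x. Qed.

Lemma DomM e f x : Dom e x -> Dom f x -> Dom (e * f) x.
Proof. by have [[_ _ _ h _] _] := tightP x; exact: h. Qed.

Lemma Dom_le e f x : Dom e x -> idem f -> e * f = e -> Dom f x.
Proof. by have [[_ _ _ _ h] _] := tightP x; exact: h. Qed.

Lemma DomMl e f x : idem e -> idem f -> Dom (e * f) x -> Dom e x.
Proof.
move=> ie jf h; apply: (Dom_le h ie).
by rewrite (idemC ie jf) -spmulA ie.
Qed.

Lemma DomMr e f x : idem e -> idem f -> Dom (e * f) x -> Dom f x.
Proof. by move=> ie jf; rewrite (idemC ie jf); exact: DomMl. Qed.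

Lemma Dom_cover e Z x : Dom e x -> finite_cover e Z ->
  exists2 z, Z z & Dom z x.
Proof.
by have [_ h] := tightP x => ex /(h _ _ ex) [z [Zz xz]]; exists z.
Qed.

Lemma conj_mul s e f : idem e -> idem f ->
  (s^* * e * s) * (s^* * f * s) = s^* * (e * f) * s.
Proof.
move=> ie jf.
have -> : s^* * e * s * (s^* * f * s) = s^* * (e * (s * s^*)) * f * s.
  by rewrite !spmulA.
by rewrite (idemC ie (idem_ss' s)) !spmulA spregular_star.
Qed.

(** A cover $Z$ of $e$ is pulled back to the cover $s^*Zs$ of $s^*es$: a nonzero $f$ below $s^*es$
    is tested through $sfs^*$, which lies below $e$. *)
Lemma act_tight s x : Dom (s^* * s) x -> is_tight (act s (val x)).
Proof.
move=> sx; split; first split.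
- exists (s * s^*); split; first exact: idem_ss'.
  by rewrite !spmulA spregular_star.
- by move=> e [].
- by move=> [_]; rewrite spmul0r spmul0l; exact: Dom0.
- move=> e f [ie xe] [jf xf]; split; first exact: idem_mul.
  by rewrite -conj_mul //; exact: DomM xe xf.
- move=> e f [ie xe] jf ef; split => //.
  by apply: (Dom_le xe); [exact: idem_conj|rewrite conj_mul // ef].
move=> e Z [ie xe] [fZ Ze cov].
pose c (z : S) := s^* * z * s.
have le1 f : f * (s^* * e * s) = f -> f * (s^* * s) = f.
  by move=> fe; rewrite -fe -spmulA; congr (_ * _); rewrite !spmulA -(spmulA (s^* * e)) -spmulA spregular.
have [|z [z' Zz' <-] xz] := @Dom_cover (s^* * e * s) (c @` Z) x xe.
  split; first exact: finite_image.
    move=> _ [z Zz <-]; have [iz ze] := Ze z Zz; split; first exact: idem_conj.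
    by rewrite /ile /c conj_mul // ze.
  move=> f [jf fe] f0.
  have ig : idem (s * f * s^*) by rewrite -{1}(spstarK s); exact: idem_conj.
  have fs : s^* * (s * f * s^*) * s = f.
    have -> : s^* * (s * f * s^*) * s = (s^* * s * f) * (s^* * s).
      by rewrite !spmulA.
    by rewrite (idemC (idem_ss s) jf) !(le1 f fe).
  have [|h|z Zz gz] := cov (s * f * s^*).
  - split => //; rewrite /ile.
    have -> : s * f * s^* * e = s * f * (s^* * e) by rewrite !spmulA.
    have es : s^* * e = s^* * e * s * s^*.
      rewrite -(spmulA _ s) -(spmulA s^*) (idemC ie (idem_ss' s)) !spmulA.
      by rewrite spregular_star.
    rewrite es.
    have -> : s * f * (s^* * e * s * s^*) = s * (f * (s^* * e * s)) * s^*.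
      by rewrite !spmulA.
    by rewrite fe.
  - by apply: f0; rewrite -fs h spmul0r spmul0l.
  - exists (c z); first by exists z.
    move=> h; apply: gz; have [iz _] := Ze z Zz.
    rewrite -{1}(spregular_star s) .
    have -> : s * f * (s^* * s * s^*) * z = s * f * s^* * (s * s^* * z).
      by rewrite !spmulA.
    rewrite (idemC (idem_ss' s) iz).
    have -> : s * f * s^* * (z * (s * s^*)) = s * (f * c z) * s^*.
      by rewrite /c !spmulA.
    by rewrite h spmul0r spmul0l.
exists z'; split => //; split => //.
by have [] := Ze z' Zz'.
Qed.

Lemma act_ex s x : Dom (s^* * s) x -> exists y, val y = act s (val x).
Proof.
by move=> /act_tight h; exists (SigSub (mem_set h) : tight_set A).
Qed.

Lemma act_eq s t f x : Dom f x -> s * f = t * f ->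
  act s (val x) `<=` act t (val x).
Proof.
move=> xf st e [ie xe]; split => //.
have jf := Dom_idem xf.
have h r : f * (r^* * e * r) * f = (r * f)^* * e * (r * f).
  by rewrite spstarM (idem_star jf) !spmulA.
have : Dom (f * (s^* * e * s) * f) x by apply: DomM => //; apply: DomM.
rewrite h st -h => h1; apply: (DomMr jf (idem_conj t ie)).
exact: DomMl (idem_mul jf (idem_conj t ie)) jf h1.
Qed.

Lemma act_starK s x : Dom (s^* * s) x ->
  forall y, val y = act s (val x) -> act s^* (val y) = val x.
Proof.
move=> sx y ->; apply/seteqP; split => e.
  move=> [ie [_]]; rewrite spstarK => h.
  have h1 : Dom (s^* * s * e * (s^* * s)) x by move: h; rewrite !spmulA.
  apply: (DomMr (idem_ss s) ie).
  exact: DomMl (idem_mul (idem_ss s) ie) (idem_ss s) h1.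
move=> xe; have ie : idem e := Dom_idem (xe : Dom e x).
split => //; split; first by rewrite spstarK -{1}(spstarK s); exact: idem_conj.
rewrite spstarK; have h : Dom (s^* * s * e * (s^* * s)) x.
  by apply: DomM => //; apply: DomM.
by move: h; rewrite !spmulA.
Qed.

Definition filter_at e (eta : set S) := is_filter eta /\ eta e.

Lemma principal_filter e : idem e -> e <> 0 ->
  filter_at e [set f | idem f /\ ile e f].
Proof.
move=> ie e0; split; last by split.
split.
- by exists e; split.
- by move=> f [].
- by move=> [_]; rewrite /ile spmul0r => /esym.
- move=> f g [jf ef] [ig eg]; split; first exact: idem_mul.
  by rewrite /ile spmulA ef.
- move=> f g [jf ef] ig fg; split => //.
  by rewrite /ile -ef -spmulA fg.
Qed.

Lemma maximal_filter e : idem e -> e <> 0 ->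
  exists2 eta, filter_at e eta &
    forall eta', filter_at e eta' -> eta `<=` eta' -> eta' = eta.
Proof.
move=> ie e0.
have [F FP tot|eta [eta_or mx]] := @Zorn_bigcup S
    [set eta | eta = set0 \/ filter_at e eta].
  have [[c0 [Fc0 [f0 c0f0]]]|nF] := pselect (exists c, F c /\ c !=set0); last first.
    left; apply/seteqP; split=> // f [c Fc cf].
    by apply: nF; exists c; split => //; exists f.
  have FA c f : F c -> c f -> filter_at e c.
    by move=> /FP [->|].
  right; split; last by exists c0 => //; case: (FA _ _ Fc0 c0f0).
  split.
  - by exists f0; exists c0.
  - by move=> f [c Fc cf]; case: (FA _ _ Fc cf) => -[_ h _ _ _] _; exact: h.
  - by move=> [c Fc cf]; case: (FA _ _ Fc cf) => -[_ _ h _ _] _.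
  - move=> f g [c Fc cf] [d Fd dg].
    have [cd|dc] := tot c d Fc Fd.
      exists d => //; case: (FA _ _ Fd dg) => -[_ _ _ h _] _; apply: h => //.
      exact: cd.
    exists c => //; case: (FA _ _ Fc cf) => -[_ _ _ h _] _; apply: h => //.
    exact: dc.
  - move=> f g [c Fc cf] ig fg; exists c => //.
    by case: (FA _ _ Fc cf) => -[_ _ _ _ h] _; exact: h cf ig fg.
have He : filter_at e eta.
  case: eta_or => // eta0; exfalso.
  apply: (mx [set f | idem f /\ ile e f]); last by right; exact: principal_filter.
  rewrite eta0; split; first by move=> ?.
  by move=> /(_ e) h; apply: h; split.
exists eta => // eta' He' sub; apply/seteqP; split => //.
apply: contrapT => nsub; apply: (mx eta'); last by right.
by split.
Qed.

(** Maximal filters are tight: by maximality, an idempotent that meets every member is itself a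
    member. If a filter with this property missed a finite cover of its member $f$, finitely many
    members would multiply to one below $f$ that is orthogonal to the whole cover. *)
Lemma tight_ex e : idem e -> e <> 0 -> exists x, Dom e x.
Proof.
move=> ie e0; have [eta [[ne idm n0 mul up] etae] mx] := maximal_filter ie e0.
have adj z : idem z -> (forall g, eta g -> g * z <> 0) -> eta z.
  move=> iz hz; rewrite -(mx [set h | idem h /\ exists2 g, eta g & ile (g * z) h]).
  - by split=> //; exists e => //; rewrite /ile -spmulA iz.
  - split; last first.
      split=> //; exists e => //.
      by rewrite /ile (idemC ie iz) -spmulA ie.
    split.
    + exists z; split=> //; exists e => //; by rewrite /ile -spmulA iz.
    + by move=> h [].
    + move=> [_ [g eg]]; rewrite /ile spmul0r => /esym; exact: hz.
    + move=> h h' [ih [g eg gh]] [ih' [g' eg' gh']].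
      split; first exact: idem_mul.
      exists (g * g'); first exact: mul.
      have ig := idm _ eg; have ig' := idm _ eg'.
      rewrite /ile.
      have e1 : g * g' * z = (g * z) * (g' * z).
        rewrite -!spmulA; congr (_ * _); rewrite [RHS]spmulA (idemC iz ig').
        by rewrite -spmulA iz.
      rewrite {1}e1 (idemC (idem_mul ig iz) (idem_mul ig' iz)) spmulA.
      rewrite -(spmulA (g' * z)) gh (idemC (idem_mul ig' iz) (idem_mul ig iz)).
      by rewrite -spmulA gh' -e1.
    + move=> h h' [ih [g eg gh]] ih' hh'; split=> //; exists g => //.
      by rewrite /ile -gh -spmulA hh'.
  - move=> g eg; have ig := idm _ eg; split=> //; exists g => //.
    by rewrite /ile (idemC ig iz) -spmulA ig.
suff ht : is_tight eta by exists (SigSub (mem_set ht) : tight_set A).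
split=> // f Z ef [/finite_seqP[zs ZE] Zf cov].
have jf := idm _ ef.
apply: contrapT => nZ.
have [g [eg gf gz]] : exists g, [/\ eta g, g * f = g & forall z, z \in zs -> g * z = 0].
  have {cov} : forall z, z \in zs -> idem z /\ ~ eta z.
    move=> z zz; have Zz : Z z by rewrite ZE.
    by split; [have [] := Zf z Zz|move=> ez; apply: nZ; exists z].
  elim: (zs) => [_|z l IH hl].
    by exists f.
  have [|g [eg gf gl]] := IH; first by move=> z' z'l; apply: hl; rewrite inE z'l orbT.
  have [iz nz] := hl z (mem_head _ _).
  have [g' eg' gz'] : exists2 g', eta g' & g' * z = 0.
    apply: contrapT => h; apply: nz; apply: adj => // g' eg' g'z.
    by apply: h; exists g'.
  have ig := idm _ eg; have ig' := idm _ eg'.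
  exists (g' * g); split; first exact: mul.
    by rewrite -spmulA gf.
  move=> z'; rewrite inE => /orP[/eqP ->|/gl z'0]; last by rewrite -spmulA z'0 spmul0r.
  by rewrite (idemC ig' ig) -spmulA gz' spmul0r.
have [||z Zz] := cov g.
- by split=> //; exact: idm.
- by move=> g0; apply: n0; rewrite -g0.
- by apply; apply: gz; move: Zz; rewrite ZE.
Qed.

(** A nonzero $f\le e$ lies in some tight filter by [tight_ex]; this filter contains some $n$, hence
    $fen\ne0$. *)
Lemma cover_of_Dom e (ns : seq S) : idem e -> (forall n, n \in ns -> idem n) ->
  (forall x, Dom e x -> exists2 n, n \in ns & Dom n x) ->
  finite_cover e [set` [seq e * n | n <- ns]].
Proof.
move=> ie ins h; split.
- by apply/finite_seqP; eexists.
- move=> _ /= /mapP[n /ins nn ->]; split; first exact: idem_mul.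
  by rewrite /ile (idemC ie nn) -spmulA ie.
- move=> f [jf fe] f0; have [x xf] := tight_ex jf f0.
  have [n nn xn] := h x (Dom_le xf ie fe).
  exists (e * n); first by apply: map_f.
  move=> fen; apply: (@Dom0 x); rewrite -fen spmulA fe.
  exact: DomM.
Qed.

End TightFilters.

(** * Germs, bisections and the topology of the groupoid *)

Section Germs.
Variables (G : sepGraph) (A : adaptable G).
Local Notation S := (SE A).
Local Open Scope SE_scope.
Local Notation X := (tight A).
Local Notation gG := (germ A).
Implicit Types (e f s t : S) (x y : X) (g h k : gG).

Lemma germ_exP s x : Dom (s^* * s) x -> exists g, is_germ g s x.
Proof.
move=> sx.
pose P := [set g : set (S * X) |
  exists s0 x0, Dom (s0^* * s0) x0 /\ g = germ_class s0 x0].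
have h : P (germ_class s x) by exists s, x.
by exists (SigSub (mem_set h) : gG); split.
Qed.

Lemma germ_rep g : exists p : S * X, is_germ g p.1 p.2.
Proof.
case: g => g gP; have [s [x [sx gE]]] := set_mem gP.
by exists (s, x); split.
Qed.

Lemma germ_memE g s x t y : is_germ g s x ->
  is_germ g t y <-> [/\ Dom (t^* * t) y, y = x & exists2 f, Dom f x & s * f = t * f].
Proof.
move=> [sx gE]; split.
  move=> [ty gE']; have : germ_class t y (t, y) by split => //; exists (t^* * t).
  by rewrite -gE' gE => -[] /=.
move=> [ty yx [f xf st]]; subst y; split; first by [].
rewrite gE.
apply/seteqP; split => -[r z] /= [rz zx [f' xf' sr]]; split => //.
  exists (f * f'); first exact: DomM.
  rewrite (spmulA t) -st -!spmulA (idemC (Dom_idem xf) (Dom_idem xf')).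
  by rewrite !spmulA sr.
exists (f * f'); first exact: DomM.
rewrite (spmulA s) st -!spmulA (idemC (Dom_idem xf) (Dom_idem xf')).
by rewrite !spmulA sr.
Qed.

Lemma is_germ_inj g h s x : is_germ g s x -> is_germ h s x -> g = h.
Proof. by move=> [_ gE] [_ hE]; apply: val_inj; exact: etrans gE (esym hE). Qed.

Lemma is_germ_src g s t x y : is_germ g s x -> is_germ g t y -> y = x.
Proof. by move=> gs /(germ_memE _ _ gs) []. Qed.

Definition srcg g : X := (projT1 (cid (germ_rep g))).2.

Lemma srcgE g s x : is_germ g s x -> srcg g = x.
Proof. by rewrite /srcg; case: cid => -[t y] /= h gs; exact: is_germ_src gs h. Qed.

Definition Th s g := is_germ g s (srcg g).

Lemma is_germ_Th g s x : is_germ g s x -> Th s g.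
Proof. by move=> h; rewrite /Th (srcgE h). Qed.

Lemma Th_ex g : exists s, Th s g.
Proof. by have [[s x] h] := germ_rep g; exists s; exact: is_germ_Th h. Qed.

Lemma ThetaE s : Theta s (Dom (s^* * s)) = [set g | Th s g].
Proof.
apply/seteqP; split => g; first by move=> [x _]; exact: is_germ_Th.
by move=> h; exists (srcg g) => //; case: h.
Qed.

Lemma ThP s t g : Th s g ->
  Th t g <-> Dom (t^* * t) (srcg g) /\ exists2 f, Dom f (srcg g) & s * f = t * f.
Proof.
move=> sg; split; first by move=> /(germ_memE _ _ sg) [].
by move=> [h1 h2]; apply/(germ_memE _ _ sg); split.
Qed.

Lemma Th_dom s g : Th s g -> Dom (s^* * s) (srcg g).
Proof. by case. Qed.

Lemma Th_inj s g h : Th s g -> Th s h -> srcg g = srcg h -> g = h.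
Proof. by move=> sg sh gh; apply: is_germ_inj sg _; rewrite gh. Qed.

Lemma Th0 g : ~ Th 0 g.
Proof. by move=> [+ _]; rewrite spmul0r; exact: Dom0. Qed.

Lemma Th_mulr s f g : idem f -> Th (s * f) g <-> Th s g /\ Dom f (srcg g).
Proof.
move=> jf; have dE : (s * f)^* * (s * f) = f * (s^* * s) * f.
  by rewrite spstarM (idem_star jf) !spmulA.
split.
  move=> h; have := Th_dom h; rewrite dE => d.
  have df : Dom f (srcg g) by apply: (DomMr (idem_mul jf (idem_ss s)) jf d).
  split => //; apply/(ThP _ h); split.
    exact: (DomMr jf (idem_ss s) (DomMl (idem_mul jf (idem_ss s)) jf d)).
  by exists f => //; rewrite -spmulA jf.
move=> [h df]; apply/(ThP _ h); split.
  by rewrite dE; apply: DomM => //; apply: DomM => //; exact: Th_dom.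
by exists f => //; rewrite -spmulA jf.
Qed.

(** For compatible $s,t$ this is $s$ restricted to the source of $t$. Incompatible elements have no
    germ in common, by [compatible_of_eq], which makes $0$ the right value. *)
Definition meet s t : S :=
  if pselect (compatible s t) then s * t^* * t else 0.

Lemma compatible_meetE s t : compatible s t -> s * t^* * t = t * s^* * s.
Proof.
move=> [c1 c2].
have h1 : t^* * s = s^* * t by rewrite -[RHS](idem_star c1) spstarM spstarK.
have h2 : t * s^* = s * t^* by rewrite -[RHS](idem_star c2) spstarM spstarK.
have e1 : s * t^* * t = t * t^* * s by rewrite -h2 -spmulA -h1 spmulA.
have c2' : idem (t * s^*) by rewrite h2.
have c1' : idem (t^* * s) by rewrite h1.
have -> : t * s^* * s = (t * s^*) * (s * t^*) * s by rewrite -{1}c2' {2}h2.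
have -> : t * s^* * (s * t^*) * s = t * ((s^* * s) * (t^* * s)).
  by rewrite !spmulA.
rewrite (idemC (idem_ss s) c1') e1.
have -> : t * (t^* * s * (s^* * s)) = t * t^* * (s * s^* * s) by rewrite !spmulA.
by rewrite spregular.
Qed.

Lemma Th_meet s t g : Th (meet s t) g <-> Th s g /\ Th t g.
Proof.
rewrite /meet; case: pselect => [c|nc]; last first.
  split; first by move/Th0.
  move=> [hs ht]; exfalso; have [_ [f df st]] := (ThP t hs).1 ht; apply: nc.
  apply: (compatible_of_eq (f := f * (s^* * s))).
  - exact: idem_mul (Dom_idem df) (idem_ss s).
  - by rewrite !spmulA st.
  - move=> h; apply: (@Dom0 _ A (srcg g)).
    have <- : s^* * (s * (f * (s^* * s))) = 0 by rewrite h spmul0r.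
    rewrite spmulA; apply: DomM; first exact: Th_dom.
    by apply: DomM => //; exact: Th_dom.
split.
  move=> h; split.
    by move: h; rewrite -spmulA => /(Th_mulr _ _ (idem_ss t)) [].
  by move: h; rewrite compatible_meetE // -spmulA => /(Th_mulr _ _ (idem_ss s)) [].
by move=> [hs ht]; rewrite -spmulA; apply/(Th_mulr _ _ (idem_ss t)); split => //; exact: Th_dom.
Qed.

Lemma meet_dom s t : exists2 e, idem e & [/\ meet s t = s * e, e * (s^* * s) = e &
  (meet s t)^* * meet s t = e].
Proof.
rewrite /meet; case: pselect => c; last first.
  by exists 0; [exact: idem0|rewrite !spmul0r spmul0l].
have i1 := idem_ss s; have i2 := idem_ss t; have i12 := idem_mul i1 i2.
exists (s^* * s * (t^* * t)) => //.
split.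
- by rewrite !spmulA spregular.
- by rewrite -spmulA (idemC i2 i1) spmulA i1.
- rewrite -spmulA spstarM (idem_star i2).
  have -> : t^* * t * s^* * (s * (t^* * t)) = t^* * t * ((s^* * s) * (t^* * t)).
    by rewrite !spmulA.
  by rewrite (idemC i1 i2) spmulA i2.
Qed.

Lemma germ_mul_Th g h k s t : germ_mul g h k -> Th s g -> Th t h ->
  [/\ Th (s * t) k, srcg h = srcg k & val (srcg g) = act t (val (srcg k))].
Proof.
move=> [s0 [t0 [x [y [yE gE hE kE]]]]] sg th.
have [_ [f yf sf]] := (ThP s (is_germ_Th gE)).1 sg.
have [tx [f' xf' tf]] := (ThP t (is_germ_Th hE)).1 th.
rewrite (srcgE gE) in yf; rewrite (srcgE hE) in tx xf'.
have jf := Dom_idem yf; have jf' := Dom_idem xf'.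
have t0x : Dom (t0^* * t0) x by case: hE.
rewrite (srcgE hE) (srcgE kE) (srcgE gE).
have yE' : val y = act t (val x).
  rewrite yE; apply/seteqP; split; first exact: act_eq xf' tf.
  by apply: act_eq xf' _; rewrite tf.
split => //; apply/(ThP _ (is_germ_Th kE)); rewrite (srcgE kE); split.
  have sy : Dom (s^* * s) y by have := Th_dom sg; rewrite (srcgE gE).
  have : act t (val x) (s^* * s) by rewrite -yE'.
  by move=> [_]; rewrite spstarM !spmulA.
have yf0 : act t0 (val x) f by rewrite -yE.
(* $t_0$ and $t$ agree on [f'], while $s_0$ and $s$ agree on [f], which $t_0$ carries back to the
   source; the two products agree on the meet. *)
exists (f' * (t0^* * f * t0)); first by apply: DomM => //; case: yf0.
have ic := idem_conj t0 jf.
have tf0 : t0 * (t0^* * f * t0) = f * t0.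
  have -> : t0 * (t0^* * f * t0) = (t0 * t0^*) * f * t0 by rewrite !spmulA.
  by rewrite (idemC (idem_ss' t0) jf) -spmulA spregular.
have lhs : s0 * t0 * (f' * (t0^* * f * t0)) = s0 * f * (t0 * f').
  by rewrite (idemC jf' ic) spmulA -(spmulA s0) tf0 !spmulA.
have rhs : s * t * (f' * (t0^* * f * t0)) = s * f * (t0 * f').
  rewrite spmulA -(spmulA s) -tf -(spmulA s) -(spmulA t0) (idemC jf' ic).
  by rewrite (spmulA t0) tf0 !spmulA.
by rewrite lhs rhs sf.
Qed.

Lemma germ_mul_ex k s t : Th (s * t) k ->
  exists g h, [/\ germ_mul g h k, Th s g & Th t h].
Proof.
move=> hk; have := Th_dom hk; set x := srcg k => dst.
have stE : (s * t)^* * (s * t) = t^* * (s^* * s) * t by rewrite spstarM !spmulA.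
rewrite stE in dst.
have tx : Dom (t^* * t) x.
  apply: (Dom_le dst (idem_ss t)).
  by rewrite -spmulA (spmulA t) spregular.
have [y yE] := act_ex tx.
have sy : Dom (s^* * s) y by rewrite /Dom /= yE; split => //; exact: idem_ss.
have [g gE] := germ_exP sy; have [h hE] := germ_exP tx.
exists g, h; split; [|exact: is_germ_Th gE|exact: is_germ_Th hE].
by exists s, t, x, y; split.
Qed.

Lemma germ_mul_uniq s t k g h g' h' : germ_mul g h k -> germ_mul g' h' k ->
  Th s g -> Th s g' -> Th t h -> Th t h' -> g = g' /\ h = h'.
Proof.
move=> m m' sg sg' th th'.
have [_ h1 a1] := germ_mul_Th m sg th; have [_ h2 a2] := germ_mul_Th m' sg' th'.
split; first by apply: Th_inj sg sg' _; apply: val_inj; rewrite a1 a2.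
by apply: Th_inj th th' _; rewrite h1 h2.
Qed.

Lemma germ_star_congr g h s t x y : is_germ g s x -> is_germ g t x ->
  val y = act s (val x) -> is_germ h s^* y -> is_germ h t^* y.
Proof.
move=> gs gt yE hs; apply/(germ_memE _ _ hs).
have [tx _ [f xf st]] := (germ_memE _ _ gs).1 gt; have jf := Dom_idem xf.
split => //.
  have : act t (val x) (t^*^* * t^*).
    split; first exact: idem_ss.
    by rewrite spstarK !spmulA spregular_star.
  by rewrite /Dom /= yE; apply: act_eq xf (esym st) _.
exists (s * f * s^*).
  rewrite /Dom /= yE; split.
    by rewrite -{1}(spstarK s); exact: idem_conj.
  have -> : s^* * (s * f * s^*) * s = (s^* * s) * f * (s^* * s) by rewrite !spmulA.
  by have sx : Dom (s^* * s) x by [case: gs]; apply: DomM => //; apply: DomM.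
have fst : f * s^* = f * t^*.
  by have := congr1 (@pstar _ _) st; rewrite !spstarM (idem_star jf).
have -> : s^* * (s * f * s^*) = (s^* * s) * f * s^* by rewrite !spmulA.
rewrite (idemC (idem_ss s) jf) -spmulA spregular_star.
have -> : t^* * (s * f * s^*) = t^* * (s * f) * s^* by rewrite !spmulA.
rewrite st.
have -> : t^* * (t * f) * s^* = (t^* * t) * f * s^* by rewrite !spmulA.
by rewrite -spmulA fst spmulA (idemC (idem_ss t) jf) -spmulA spregular_star.
Qed.

Lemma germ_inv_spec g : exists s x y,
  [/\ val y = act s (val x), is_germ g s x & is_germ (germ_inv g) s^* y].
Proof.
rewrite /germ_inv; case: xgetP => [h _ //|nh]; exfalso.
have [s gs] := Th_ex g; have sx := Th_dom gs.
have [y yE] := act_ex sx.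
have [|h hE] := @germ_exP s^* y.
  rewrite /Dom /= yE; split; first exact: idem_ss.
  by rewrite spstarK !spmulA spregular_star.
by apply: (nh h); exists s, (srcg g), y.
Qed.

Lemma Th_star s g : Th s^* g <-> Th s (germ_inv g).
Proof.
have [s0 [x [y [yE gE hE]]]] := germ_inv_spec g.
split=> h.
  rewrite /Th (srcgE hE) -(spstarK s).
  apply: (germ_star_congr gE _ yE hE).
  by rewrite -(srcgE gE); exact: h.
rewrite /Th (srcgE gE).
have s0x : Dom (s0^* * s0) x by case: gE.
apply: (germ_star_congr hE _ (esym (act_starK s0x yE))).
  by rewrite -(srcgE hE); exact: h.
by rewrite spstarK.
Qed.

Lemma tight_cvg (F : set_system X) x : Filter F ->
  (forall e, Dom e x -> F (Dom e)) ->
  (forall e, idem e -> ~ Dom e x -> F (~` Dom e)) -> F --> x.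
Proof.
move=> FF Fin Fout.
have cv : (@filter_indicator _ A @ F) --> @filter_indicator _ A x.
  apply/cvg_sup => i W /= [_ [[V oV <-] Vx] VW].
  suff : F [set y | V (filter_indicator y i)].
    move=> h; rewrite nbhs_simpl /=; apply: (@filterS _ F FF _ _ _ h) => y Vy; exact: VW.
  have [xi|xi] := pselect (Dom (val i) x).
    apply: filterS (Fin _ xi) => y yi.
    move: Vx; rewrite /preimage /= /filter_indicator.
    by rewrite (asboolT (xi : val x (val i))) (asboolT (yi : val y (val i))).
  have ii : idem (val i) by exact: set_mem (valP i).
  apply: filterS (Fout _ ii xi) => y yi.
  move: Vx; rewrite /preimage /= /filter_indicator.
  by rewrite (asboolF (xi : ~ val x (val i))) (asboolF (yi : ~ val y (val i))).
move=> W /= [_ [[V oV <-] Vx] VW].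
have h := cv V (open_nbhs_nbhs (conj oV Vx)).
by rewrite nbhs_simpl /=; apply: (@filterS _ F FF _ _ _ h) => y Vy; exact: VW.
Qed.

Lemma Dom_preimage e (ie : idem e) (b : bool) :
  open [set x : X | `[< Dom e x >] = b].
Proof.
pose i : set_type (@idem _ A) := SigSub (mem_set ie).
exists ((@proj _ (fun _ : set_type (@idem _ A) => bool) i) @^-1` [set b]) => //.
apply: open_comp; last exact: discrete_open.
by move=> f _; exact: proj_continuous.
Qed.

Lemma Dom_open e : idem e -> open (Dom e : set X).
Proof.
move=> ie; have := Dom_preimage ie true; congr open.
by apply/seteqP; split=> x /=; [move/asboolP|move=> h; apply/asboolP].
Qed.

Lemma Dom_closed e : idem e -> open (~` Dom e : set X).
Proof.
move=> ie; have := Dom_preimage ie false; congr open.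
by apply/seteqP; split=> x /=; [move/asboolPn|move=> h; apply/asboolPn].
Qed.

(** An ultrafilter [F] converges to the set of those $f$ for which $D_f$ is in [F]. This set is
    tight, since an ultrafilter avoiding $D_z$ for all $z$ in a finite cover of $f$ avoids $D_f$ as
    well. *)
Lemma Dom_compact e : idem e -> compact (Dom e : set X).
Proof.
move=> ie; rewrite compact_ultra => F FU Fe; have FF : ProperFilter F := ultra_proper.
pose eta : set S := [set f | idem f /\ F (Dom f)].
have eta_tight : is_tight eta.
  split; first split.
  - by exists e.
  - by move=> f [].
  - move=> [_ F0]; apply: (@filter_not_empty _ F); apply: filterS F0 => x.
    exact: Dom0.
  - move=> f g [jf Ff] [ig Fg]; split; first exact: idem_mul.
    by apply: filterS (filterI Ff Fg) => x [xf xg]; exact: DomM.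
  - move=> f g [jf Ff] ig fg; split => //.
    by apply: filterS Ff => x xf; exact: Dom_le xf ig fg.
  move=> f Z [jf Ff] [/finite_seqP[zs ZE] Zf cov].
  apply: contrapT => nZ.
  have hz z : z \in zs -> F (~` Dom z).
    move=> zz; have [Fz|//] := in_ultra_setVsetC (Dom z) FU.
    have Zz : Z z by rewrite ZE.
    by case: nZ; exists z; split => //; split => //; have [] := Zf z Zz.
  have hall : F [set x | forall z, z \in zs -> ~ Dom z x].
    elim: (zs) hz => [_|z l IH hz]; first by apply: (@filterS _ F _ _ _ _ filterT).
    have h1 := hz z (mem_head _ _).
    have h2 := IH (fun z' z'l => hz z' (introT orP (or_intror z'l))).
    apply: filterS (filterI h1 h2) => x [xz xl] z'.
    by rewrite inE => /orP[/eqP ->//|]; exact: xl.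
  apply: (@filter_not_empty _ F); apply: filterS (filterI Ff hall) => x [xf xz].
  have [z Zz xz'] : exists2 z, Z z & Dom z x.
    by apply: (Dom_cover xf); split => //; apply/finite_seqP; exists zs.
  by apply: (xz z) => //; move: Zz; rewrite ZE.
exists (SigSub (mem_set eta_tight) : tight_set A); split; first by split.
apply: tight_cvg => [f [] //|f jf nf].
by have [Ff|//] := in_ultra_setVsetC (Dom f) FU; case: nf; split.
Qed.

Lemma germ_cvg (F : set_system gG) g : Filter F ->
  (forall s (U : set X), open U -> U `<=` Dom (s^* * s) -> Theta s U g ->
     F (Theta s U)) -> F --> g.
Proof.
move=> FF h W /=; rewrite nbhsE /= => -[_ [[B sB <-] [C BC Cg] sUBW]].
rewrite /nbhs /=; apply: filterS sUBW _; apply: (@filterS _ _ _ C).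
  by move=> ? ?; exists C.
have /sB [D sD IDeC] := BC; rewrite -IDeC; apply: filter_bigI => E DE.
have /set_mem[s [U [oU sU EE]]] := sD _ DE; rewrite EE; apply: h => //.
by rewrite -EE; move: Cg; rewrite -IDeC => /(_ _ DE).
Qed.

Lemma Theta_open s (U : set X) : open U -> U `<=` Dom (s^* * s) ->
  open (Theta s U : set gG).
Proof.
move=> oU sU; exists [set Theta s U]; last by rewrite bigcup_set1.
move=> _ ->; exists [fset Theta s U]%fset.
  by move=> ?; rewrite inE => /eqP->; apply/mem_set; exists s, U.
apply/seteqP; split => g /=.
  by move=> h; apply: (h (Theta s U)); rewrite /= inE.
by move=> gU W /=; rewrite inE => /eqP ->.
Qed.

(** Near $g$ the topology is that of the unit space, transported by the section of germs of $s$: if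
    $\Theta(t,U)$ contains $g$, then $sf=tf$ for some $f$ in the source of $g$, and $\Theta(t,U)$
    contains the germs of $s$ over $U\cap D_f$. *)
Lemma germ_nbhsE g s (W : set gG) : Th s g ->
  nbhs g W <-> nbhs (srcg g) [set y | forall h, is_germ h s y -> W h].
Proof.
move=> sg; pose F : set_system gG :=
  [set W | nbhs (srcg g) [set y | forall h, is_germ h s y -> W h]].
split.
  have FF : Filter F.
    split; first by apply: (@filterS _ (nbhs (srcg g)) _ _ _ _ filterT).
      move=> P Q FP FQ; apply: (@filterS _ (nbhs (srcg g)) _ _ _ _
          (@filterI _ (nbhs (srcg g)) _ _ _ FP FQ)) => y [Py Qy] h hs.
        by split; [exact: Py|exact: Qy].
    move=> P Q PQ FP; apply: (@filterS _ (nbhs (srcg g)) _ _ _ _ FP) => y Py h hs.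
      by apply: PQ; exact: Py.
  suff : F --> g by apply.
  apply: germ_cvg => t U oU sU [x Ux gt].
  have [tx xE [f xf st]] := (germ_memE _ _ sg).1 gt; subst x => {gt}.
  apply: (@filterS _ (nbhs (srcg g)) _ _ _ _ (filterI
    (open_nbhs_nbhs (conj oU Ux))
    (open_nbhs_nbhs (conj (Dom_open (Dom_idem xf)) xf)))) => y [Uy yf] h hs.
  exists y => //; apply/(germ_memE _ _ hs); split => //; first exact: sU.
  by exists f.
rewrite nbhsE => -[U [oU Ux] UW].
pose U' := U `&` Dom (s^* * s).
have oU' : open (Theta s U' : set gG).
  apply: Theta_open; last by move=> ? [].
  by apply: openI => //; exact: Dom_open (idem_ss s).
rewrite nbhsE; exists (Theta s U').
  split => //; exists (srcg g) => //; split => //; exact: Th_dom.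
by move=> h [y [Uy _] hs]; exact: UW Uy _ hs.
Qed.

Lemma srcg_continuous : continuous srcg.
Proof.
move=> g O /= gO; have [s sg] := Th_ex g; apply/(germ_nbhsE _ sg).
by apply: filterS gO => y Oy h /srcgE; rewrite /preimage /= => ->.
Qed.

Lemma Th_open s : open [set g | Th s g].
Proof.
rewrite -ThetaE; apply: Theta_open => //; exact: Dom_open (idem_ss s).
Qed.

(** Since [meet t s] has the form $te$, the germs of $t$ that are also germs of $s$ are those with
    source in the clopen set $D_e$. This is how $E^*$-unitarity enters the topology. *)
Lemma Th_closed s : open (~` [set g | Th s g]).
Proof.
rewrite openE => g /= ng; rewrite /interior; have [t tg] := Th_ex g.
apply/(germ_nbhsE _ tg).
have [e ie [mE et me]] := meet_dom t s.
have ne : ~ Dom e (srcg g).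
  by move=> ge; apply: ng; have /Th_meet[] : Th (meet t s) g by rewrite mE; apply/Th_mulr.
apply: filterS (open_nbhs_nbhs (conj (Dom_closed ie) ne)) => y ny h ht hs; apply: ny.
rewrite -(srcgE ht) -me; apply: Th_dom; apply/Th_meet; split => //.
exact: is_germ_Th ht.
Qed.

Lemma Th_compact s : compact [set g | Th s g].
Proof.
move=> F FF Fs.
have Fsrc : (srcg @ F) (Dom (s^* * s)).
  by rewrite /nbhs /=; apply: filterS Fs => g; exact: Th_dom.
have [x [sx clx]] := Dom_compact (idem_ss s) (fmap_proper_filter srcg FF) Fsrc.
have [g gs] := germ_exP sx; exists g; split; first exact: is_germ_Th gs.
move=> W N FW; rewrite (germ_nbhsE _ (is_germ_Th gs)) (srcgE gs) => nN.
have [y [[h [Wh hs] hy] yN]] : (srcg @` (W `&` [set g | Th s g]) `&`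
    [set y | forall h, is_germ h s y -> N h]) !=set0.
  apply: clx nN; rewrite /nbhs /=; apply: filterS (filterI FW Fs) => h Wh.
  by exists h.
exists h; split => //; apply: yN; rewrite -hy; exact: hs.
Qed.

End Germs.

(** * Norm bounds in representations of S(E,C) *)

Section FormalSums.
Variables (R : realType) (G : sepGraph) (A : adaptable G).
Local Notation C := R[i].
Local Notation S := (SE A).
Local Notation gG := (germ A).
Implicit Types (L : seq (C * S)) (K : seq S) (s t : S).

Definition chi s : gG -> C := \1_(Theta s (Dom (s^* * s)%SE)).

Lemma chiE s g : chi s g = if `[< Th s g >] then 1 else 0.
Proof.
rewrite /chi indicE ThetaE; case: asboolP => h.
  by rewrite mem_set.
by rewrite memNset.
Qed.

Lemma chi_neq0 s g : chi s g != 0 -> Th s g.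
Proof. by rewrite chiE; case: asboolP => //; rewrite eqxx. Qed.

Lemma rc_chi s g : rc (chi s g) <= 1.
Proof. by rewrite chiE; case: asboolP; rewrite ?rc0 ?rc1 //. Qed.

Lemma chi_meet s t g : chi (meet s t) g = chi s g * chi t g.
Proof.
rewrite !chiE; case: asboolP => [/Th_meet [h1 h2]|h].
  by rewrite !asboolT // mulr1.
case: asboolP => h1; last by rewrite mul0r.
case: asboolP => h2; last by rewrite mulr0.
by case: h; apply/Th_meet.
Qed.

Definition ev L (g : gG) : C := \sum_(p <- L) p.1 * chi p.2 g.

Definition lscale (a : C) L := [seq (a * p.1, p.2) | p <- L].
Definition lmeet s L := [seq (p.1, meet s p.2) | p <- L].
(** The formal version of multiplication by $1-1_{\Theta(s)}$. *)
Definition lminus L s := L ++ lscale (-1) (lmeet s L).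
Definition lmul L L' := [seq (p.1 * q.1, (p.2 * q.2)%SE) | p <- L, q <- L'].
Definition lstar L := [seq (p.1^*, (p.2^*)%SE) | p <- L].

Lemma ev_cat L L' g : ev (L ++ L') g = ev L g + ev L' g.
Proof. exact: big_cat. Qed.

Lemma ev_scale a L g : ev (lscale a L) g = a * ev L g.
Proof.
rewrite /ev big_map mulr_sumr; apply: eq_bigr => p _ /=.
by rewrite mulrA.
Qed.

Lemma ev_meet s L g : ev (lmeet s L) g = ev L g * chi s g.
Proof.
rewrite /ev big_map mulr_suml; apply: eq_bigr => p _ /=.
by rewrite chi_meet mulrCA mulrC -mulrA mulrC -!mulrA [chi s g * _]mulrC.
Qed.

Lemma ev_minus L s g : ev (lminus L s) g = ev L g * (1 - chi s g).
Proof. by rewrite ev_cat ev_scale ev_meet mulrBr mulr1 mulN1r. Qed.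

Lemma ev_foldminus L K g : (exists2 s, s \in K & Th s g) ->
  ev (foldl lminus L K) g = 0.
Proof.
elim: K L => [|s K IH] L; first by case.
have ev0 : forall M, ev M g = 0 -> ev (foldl lminus M K) g = 0.
  elim: (K) => [//|t K' IH'] M M0 /=; apply: IH'.
  by rewrite ev_minus M0 mul0r.
move=> [t]; rewrite inE => /orP[/eqP -> h|tK h] /=.
  by apply: ev0; rewrite ev_minus chiE asboolT // subrr mulr0.
by apply: IH; exists t.
Qed.

Lemma ev_foldminus0 L K g : ev L g = 0 -> ev (foldl lminus L K) g = 0.
Proof.
elim: K L => [//|s K IH] L L0 /=; apply: IH.
by rewrite ev_minus L0 mul0r.
Qed.

(** Supports are controlled by a finite list of bisections, so that the constants in the estimates
    can depend on the length of [K] alone. *)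
Definition bsupp K (F : gG -> C) := forall g, F g != 0 -> exists2 s, s \in K & Th s g.

Lemma bsupp_ev L : bsupp [seq p.2 | p <- L] (ev L).
Proof.
move=> g; rewrite /ev; elim: L => [|[a s] L IH]; first by rewrite big_nil eqxx.
rewrite big_cons /=; have [sg|sg] := eqVneq (chi s g) 0; last first.
  by move=> _; exists s; [rewrite inE eqxx|exact: chi_neq0].
rewrite sg mulr0 add0r => /IH [t tL h]; exists t => //.
by rewrite inE tL orbT.
Qed.

Lemma sub_bsupp K K' F : {subset K <= K'} -> bsupp K F -> bsupp K' F.
Proof. by move=> KK' h g /h [s /KK' sK' sg]; exists s. Qed.

Section Bounds.
Variables (B : cstarAlg R) (phi : sgen G -> B).
Hypothesis phiP : satisfies_R1_R10 A phi.
Local Notation io := (iotaS phi : S -> B).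

Definition iol L : B := \sum_(p <- L) p.1 *: io p.2.

Lemma iol_cat L L' : iol (L ++ L') = iol L + iol L'.
Proof. exact: big_cat. Qed.

Lemma iol_scale a L : iol (lscale a L) = a *: iol L.
Proof.
rewrite /iol big_map scaler_sumr; apply: eq_bigr => p _ /=.
by rewrite scalerA.
Qed.

Lemma iol_cons p L : iol (p :: L) = p.1 *: io p.2 + iol L.
Proof. by rewrite /iol big_cons. Qed.

Lemma iol_mul L L' : iol (lmul L L') = cmul (iol L) (iol L').
Proof.
elim: L => [|p L IH]; first by rewrite /iol big_nil cmul0l.
rewrite /lmul /= iol_cat IH iol_cons cmulDl; congr (_ + _).
elim: (L') => [|q M IHq]; first by rewrite /iol big_nil cmul0r.
rewrite /= !iol_cons cmulDr -IHq; congr (_ + _).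
by rewrite /= (iotaM phiP) cmulZl cmulZr scalerA.
Qed.

Lemma iol_star L : iol (lstar L) = cstar (iol L).
Proof.
elim: L => [|p L IH]; first by rewrite /iol big_nil cstar0.
by rewrite /= !iol_cons cstarD -IH cstarZ (iota_star phiP).
Qed.

(** With $w=z^*z$, the elements $X=wp$ and $Y=w-wp$ are orthogonal, so $w^{2^n}=X^{2^n}+Y^{2^n}$ has
    norm at most $2(M^2)^{2^n}$; the factor $2$ disappears by [selfadj_bound]. *)
Lemma commuting_split (z p : B) (M : R) : cstar p = p -> cmul p p = p ->
  cmul z p = cmul p z -> 0 <= M -> rn (cmul z p) <= M ->
  rn (z - cmul z p) <= M -> rn z <= M.
Proof.
move=> ps pp zp M0 h1 h2.
pose x := cmul z p; pose y := z - x; pose w := cmul (cstar z) z.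
have zsp : cmul (cstar z) p = cmul p (cstar z).
  by have := congr1 (@cstar _ _) zp; rewrite !cstarM ps.
have wp : cmul w p = cmul p w by rewrite /w -cmulA zp !cmulA zsp.
have xx : cmul (cstar x) x = cmul w p.
  by rewrite /x cstarM ps -zsp -!cmulA (cmulA p) -zp -(cmulA z) pp.
have yy : cmul (cstar y) y = w - cmul w p.
  rewrite /y cstarB cmulBl !cmulBr xx.
  have -> : cmul (cstar z) x = cmul w p by rewrite /x cmulA.
  have -> : cmul (cstar x) z = cmul w p by rewrite /x cstarM ps -cmulA -wp.
  by rewrite subrr subr0.
have ws : cstar w = w by rewrite /w cstarM cstarK.
have rw : rn w = rn z ^+ 2 by rewrite /w rn_starM.
have bnd (v : B) : rn v <= M -> forall n, rn (sqn n (cmul (cstar v) v)) <= (M ^+ 2) ^+ (2 ^ n).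
  move=> vM n; rewrite rn_sqn ?cstarM ?cstarK // rn_starM.
  by apply: lerXn2r; rewrite ?nnegrE ?exprn_ge0 ?rn_ge0 // lerXn2r // nnegrE ?rn_ge0.
have {}h1 := bnd _ h1; have {}h2 := bnd _ h2; rewrite -/x -/y xx yy in h1 h2.
clearbody w; set X := cmul w p in xx yy h1 h2; set Y := w - X in yy h2.
have XY : cmul X Y = 0.
  by rewrite /Y cmulBr /X -!cmulA (cmulA p w) -wp -(cmulA w) pp subrr.
have YX : cmul Y X = 0.
  by rewrite /Y cmulBl /X !cmulA -(cmulA _ p) -wp -!cmulA pp subrr.
have ortho n : cmul (sqn n X) (sqn n Y) = 0 /\ cmul (sqn n Y) (sqn n X) = 0.
  elim: n => [//|n [IH1 IH2]] /=; split.
    by rewrite -cmulA (cmulA (sqn n X) (sqn n Y)) IH1 cmul0l cmul0r.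
  by rewrite -cmulA (cmulA (sqn n Y) (sqn n X)) IH2 cmul0l cmul0r.
have sq n : sqn n w = sqn n X + sqn n Y.
  elim: n => [|n IH] /=; first by rewrite /Y addrC subrK.
  have [h3 h4] := ortho n.
  by rewrite IH cmulDl !cmulDr h3 h4 addr0 add0r.
have : rn w <= M ^+ 2.
  apply: (@selfadj_bound _ _ _ _ 2) => //; first by rewrite exprn_ge0.
  move=> n; rewrite sq; apply: le_trans (rnD _ _) _.
  by have := h1 n; have := h2 n; lra.
by rewrite rw ler_pXn2r // nnegrE ?rn_ge0.
Qed.

Lemma negs_proj (ns : seq S) e : idem e -> (forall n, n \in ns -> idem n) ->
  let q := negs phi ns (io e) in
  [/\ cstar q = q, cmul q q = q &
      forall f, idem f -> cmul q (io f) = cmul (io f) q].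
Proof.
move=> ie; elim: ns => [_|n ns IH ins] /=.
  by split; [exact: iota_idem_star|exact: iota_idem|move=> f jf; exact: iotaC].
have [|qs qq qc] := IH; first by move=> m mn; apply: ins; rewrite inE mn orbT.
have jn : idem n := ins n (mem_head _ _).
set q := negs _ _ _ in qs qq qc *.
have qpq : cmul (cmul q (io n)) q = cmul q (io n).
  by rewrite -cmulA -(qc _ jn) cmulA qq.
split.
- by rewrite cstarB cstarM qs (iota_idem_star phiP jn) qc.
- rewrite cmulBl !cmulBr qq cmulA qq qpq -[X in _ - X]opprB.
  rewrite cmulA qpq -cmulA (iota_idem phiP jn) subrr oppr0 subr0.
  by [].
- move=> f jf; rewrite cmulBl cmulBr (qc _ jf); congr (_ - _).
  by rewrite -cmulA (iotaC phiP jn jf) cmulA (qc _ jf) cmulA.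
Qed.

Lemma negs_map_mul (ns : seq S) e : idem e -> (forall n, n \in ns -> idem n) ->
  negs phi [seq (e * n)%SE | n <- ns] (io e) = negs phi ns (io e).
Proof.
move=> ie; elim: ns => [//|n ns IH] ins /=.
have ins' m : m \in ns -> idem m by move=> mn; apply: ins; rewrite inE mn orbT.
rewrite (IH ins') (iotaM phiP) cmulA -(negs_mul phiP _ ie ins').
by rewrite (iota_idem phiP ie).
Qed.

Definition dchi e (x : tight A) : C := if `[< Dom e x >] then 1 else 0.

(* Splits off one projection at a time; on a non-empty atom the sum is the
   value of the function, and empty atoms vanish by tightness. *)
Lemma comm_bound L e (ns : seq S) (c : C) (M : R) : 0 <= M -> idem e ->
  (forall n, n \in ns -> idem n) -> (forall p, p \in L -> idem p.2) ->
  (forall x, Dom e x -> (forall n, n \in ns -> ~ Dom n x) ->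
     rc (c + \sum_(p <- L) p.1 * dchi p.2 x) <= M) ->
  let q := negs phi ns (io e) in
  rn (c *: q + \sum_(p <- L) p.1 *: cmul q (io p.2)) <= M.
Proof.
move=> M0; elim: L e ns c => [|[a f] L IH] e ns c ie ins iL h /=.
  rewrite big_nil addr0.
  have [[x [xe xn]]|nx] := pselect (exists x, Dom e x /\ forall n, n \in ns -> ~ Dom n x).
    have := h x xe xn; rewrite big_nil addr0 => cM.
    have [qs qq _] := negs_proj ie ins.
    have := rn_proj qs qq; rewrite rnZ => q1.
    by apply: le_trans (ler_wpM2l (rc_ge0 c) q1) _; rewrite mulr1.
  have fc : finite_cover e [set` [seq (e * n)%SE | n <- ns]].
    apply: cover_of_Dom => // x xe; apply: contrapT => hx; apply: nx.
    by exists x; split => // n nn xn; apply: hx; exists n.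
  have := iota_tight phiP ie fc erefl; rewrite negs_map_mul // => ->.
  by rewrite scaler0 rn0.
have jf : idem f := iL _ (mem_head _ _).
have iL' p : p \in L -> idem p.2 by move=> pL; apply: iL; rewrite inE pL orbT.
have [qs qq qc] := negs_proj ie ins.
set q := negs _ _ _ in qs qq qc *.
rewrite big_cons /=; set z := _ + _.
have zf : cmul z (io f) = (c + a) *: cmul q (io f) +
    \sum_(p <- L) p.1 *: cmul (cmul q (io f)) (io p.2).
  rewrite /z !cmulDl !cmulZl -cmulA (iota_idem phiP jf) scalerDl -!addrA.
  congr (_ + (_ + _)).
  elim: (L) iL' => [|p l IHl] iL'; first by rewrite !big_nil cmul0l.
  rewrite !big_cons cmulDl IHl => [|r rl]; last by apply: iL'; rewrite inE rl orbT.
  rewrite cmulZl -!cmulA (iotaC phiP jf) //; exact: iL' _ (mem_head _ _).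
apply: (@commuting_split _ (io f)) => //.
- exact: iota_idem_star.
- exact: iota_idem.
- have hc g : idem g -> cmul (cmul q (io g)) (io f) = cmul (io f) (cmul q (io g)).
    by move=> jg; rewrite [RHS]cmulA -(qc _ jf) -!cmulA (iotaC phiP jf jg).
  have hf := hc _ jf; rewrite (qc _ jf) in hf.
  rewrite /z !(cmulDl, cmulDr) !(cmulZl, cmulZr) (qc _ jf) hf.
  congr (_ + (_ + _)).
  elim: (L) iL' => [|p l IHl] iL'; first by rewrite !big_nil cmul0l cmul0r.
  rewrite !big_cons cmulDl cmulDr IHl => [|r rl]; last by apply: iL'; rewrite inE rl orbT.
  by rewrite cmulZl cmulZr hc //; exact: iL' _ (mem_head _ _).
- rewrite zf /q -(negs_mul phiP _ jf ins) -(iotaM phiP).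
  apply: IH => //; first exact: idem_mul.
  move=> x xef xn; have xf := DomMr ie jf xef.
  have := h x (DomMl ie jf xef) xn; rewrite big_cons /= /dchi asboolT // mulr1.
  by rewrite addrA.
- have -> : z - cmul z (io f) = c *: (q - cmul q (io f)) +
      \sum_(p <- L) p.1 *: cmul (q - cmul q (io f)) (io p.2).
    rewrite zf /z scalerBr scalerDl.
    have -> : \sum_(p <- L) p.1 *: cmul (q - cmul q (io f)) (io p.2) =
       \sum_(p <- L) p.1 *: cmul q (io p.2) -
       \sum_(p <- L) p.1 *: cmul (cmul q (io f)) (io p.2).
      by rewrite -sumrB; apply: eq_bigr => p _; rewrite cmulBl scalerBr.
    rewrite -[X in _ - X]addrA opprD addrACA; congr (_ + _).
    by rewrite opprD addrACA subrr add0r.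
  have := IH e (f :: ns) c; apply => //.
    by move=> n; rewrite inE => /orP[/eqP ->|/ins].
  move=> x xe xn; have nf : ~ Dom f x by apply: xn; exact: mem_head.
  have := h x xe (fun n nn => xn n (introT orP (or_intror nn))).
  by rewrite big_cons /= /dchi asboolF // mulr0 add0r.
Qed.

End Bounds.
End FormalSums.

(** * Norm bounds with constants depending on the support *)

Section SupportBound.
Variables (R : realType) (G : sepGraph) (A : adaptable G).
Local Notation C := R[i].
Local Notation S := (SE A).
Implicit Types (L : seq (C * S)) (K : seq S) (s t : S).
Variables (B : cstarAlg R) (phi : sgen G -> B).
Hypothesis phiP : satisfies_R1_R10 A phi.
Local Notation io := (iotaS phi : S -> B).
Local Notation iol := (iol phi).

(** [lmeet s L] is $s$ times a combination of idempotents below $s^*s$. The value of this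
    combination at a unit is that of [ev L] at the germ of $s$ there, so [comm_bound] applies. *)
Lemma iol_meet_bound L s (M : R) : 0 <= M -> (forall g, rc (ev L g) <= M) ->
  rn (iol (lmeet s L)) <= M.
Proof.
move=> M0 h.
pose ed t := ((meet s t)^* * meet s t)%SE.
have edE t : [/\ idem (ed t), meet s t = (s * ed t)%SE & ((s^* * s) * ed t)%SE = ed t].
  have [e ie [mE es me]] := meet_dom s t.
  by rewrite /ed me; split => //; rewrite (idemC (idem_ss s) ie).
pose L' := [seq (p.1, ed p.2) | p <- L].
have -> : iol (lmeet s L) = cmul (io s) (0 *: io (s^* * s)%SE +
    \sum_(p <- L') p.1 *: cmul (io (s^* * s)%SE) (io p.2)).
  rewrite scale0r add0r /L' /lmeet; elim: (L) => [|p l IH].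
    by rewrite /iol !big_nil cmul0r.
  rewrite /= iol_cons IH /= big_cons cmulDr; congr (_ + _).
  have [_ -> e1] := edE p.2.
  by rewrite cmulZr -!(iotaM phiP) e1.
apply: le_trans (rnM _ _) _.
suff : rn (0 *: io (s^* * s)%SE +
    \sum_(p <- L') p.1 *: cmul (io (s^* * s)%SE) (io p.2)) <= M.
  move=> hM; apply: le_trans (ler_pM _ _ (rn_iota phiP s) hM) _; rewrite ?rn_ge0 //.
  by rewrite mul1r.
apply: (comm_bound phiP (ns := [::]) M0) => //.
- exact: idem_ss.
- by move=> p /mapP[p' _ ->] /=; have [] := edE p'.2.
move=> x sx _; rewrite add0r.
have [g gs] := germ_exP sx; have sg := is_germ_Th gs.
suff -> : \sum_(p <- L') p.1 * dchi R p.2 x = ev L g by exact: h.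
rewrite /L' /ev big_map; apply: eq_bigr => p _ /=; congr (_ * _).
have [ie mE _] := edE p.2.
have hiff : Dom (ed p.2) x <-> Th p.2 g.
  rewrite -(srcgE gs); split.
    by move=> d; have /Th_meet[] : Th (meet s p.2) g by rewrite mE; apply/Th_mulr.
  move=> h2; have : Th (meet s p.2) g by apply/Th_meet.
  by rewrite mE => /(Th_mulr _ _ ie) [].
rewrite /dchi chiE; case: asboolP => d; case: asboolP => d' //.
  by case: d'; apply/hiff.
by case: d; apply/hiff.
Qed.

(** The bisections of [K] are split off one at a time, each at the cost $M$. The function of the
    rest is that of [L] multiplied by $0$ or $1$ at each germ, so the bound persists. *)
Lemma iol_foldminus_bound L K (M : R) : 0 <= M -> (forall g, rc (ev L g) <= M) ->
  rn (iol L) <= (size K)%:R * M + rn (iol (foldl (@lminus _ _ _) L K)).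
Proof.
move=> M0; elim: K L => [|s K IH] L h /=; first by rewrite mul0r add0r.
have h' g : rc (ev (lminus L s) g) <= M.
  rewrite ev_minus rcM chiE; case: asboolP => _.
    by rewrite subrr rc0 mulr0.
  by rewrite subr0 rc1 mulr1.
have := IH _ h'; have := iol_meet_bound s M0 h.
have -> : iol L = iol (lmeet s L) + iol (lminus L s).
  by rewrite /lminus iol_cat iol_scale scaleN1r addrCA subrr addr0.
have := rnD (iol (lmeet s L)) (iol (lminus L s)).
rewrite -addn1 natrD mulrDl mul1r; lra.
Qed.

Lemma lmeet_scale s a L : lmeet s (lscale a L) = lscale a (lmeet s L).
Proof. by rewrite /lmeet /lscale -!map_comp. Qed.

Lemma iol_foldminus_cat L L' K : iol (foldl (@lminus _ _ _) (L ++ L') K) =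
  iol (foldl (@lminus _ _ _) L K) + iol (foldl (@lminus _ _ _) L' K).
Proof.
elim: K L L' => [|s K IH] L L' /=; first exact: iol_cat.
rewrite /lminus !IH /lmeet map_cat /lscale map_cat !IH.
by rewrite addrACA.
Qed.

Lemma iol_foldminus_scale a L K : iol (foldl (@lminus _ _ _) (lscale a L) K) =
  a *: iol (foldl (@lminus _ _ _) L K).
Proof.
elim: K L => [|s K IH] L /=; first exact: iol_scale.
have -> : lminus (lscale a L) s = lscale a (lminus L s).
  rewrite /lminus lmeet_scale /lscale map_cat -!map_comp; congr (_ ++ _).
  by apply: eq_map => p /=; rewrite mulrCA.
exact: IH.
Qed.

Lemma meetE s t : compatible s t -> meet s t = (s * t^* * t)%SE.
Proof. by rewrite /meet; case: pselect. Qed.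

Lemma meet_incompatible s t : ~ compatible s t -> meet s t = 0%SE.
Proof. by rewrite /meet; case: pselect. Qed.

Lemma meet_self_mul t e : idem e -> meet t (t * e)%SE = (t * e)%SE.
Proof.
move=> ie; rewrite meetE.
  rewrite spstarM (idem_star ie).
  have -> : (t * (e * t^*) * (t * e) = t * (e * (t^* * t) * e))%SE by rewrite !spmulA.
  by rewrite (idemC ie (idem_ss t)) -(spmulA _ e) ie spmulA spmulA spregular.
split; first by rewrite spmulA; exact: idem_mul (idem_ss t) ie.
rewrite spstarM (idem_star ie) spmulA -{1}(spstarK t).
exact: idem_conj.
Qed.

Definition under t (u : S) := exists2 e, idem e & u = (t * e)%SE.

Lemma under_meet t s u : under t u -> under t (meet s u).
Proof.
move=> [e ie uE]; have [c|nc] := pselect (compatible s u); last first.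
  by exists 0%SE; [exact: idem0|rewrite meet_incompatible // spmul0r].
rewrite meetE // compatible_meetE // uE -spmulA -spmulA.
exists (e * (s^* * s))%SE => //; exact: idem_mul ie (idem_ss s).
Qed.

(** Subtractions made before the turn of $t$ leave only restrictions of $t$, and the subtraction of
    $t$ itself cancels those formally. *)
Lemma iol_foldminus_under t K L : t \in K ->
  (forall p, p \in L -> under t p.2) -> iol (foldl (@lminus _ _ _) L K) = 0.
Proof.
elim: K L => [//|s K IH] L; rewrite inE => /orP[/eqP <-|tK] uL /=.
  have -> : lminus L t = L ++ lscale (-1) L.
    rewrite /lminus; congr (_ ++ lscale _ _).
    rewrite /lmeet -[RHS]map_id; apply/eq_in_map => -[a u] /uL /= [e ie ->].
    by rewrite meet_self_mul.
  by rewrite iol_foldminus_cat iol_foldminus_scale scaleN1r subrr.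
apply: IH => // p; rewrite mem_cat => /orP[/uL //|].
move=> /mapP[p' /mapP[p'' /uL h ->] ->] /=; exact: under_meet.
Qed.

Lemma iol_foldminus_mem L K : (forall p, p \in L -> p.2 \in K) ->
  iol (foldl (@lminus _ _ _) L K) = 0.
Proof.
elim: L => [_|p L IH hL].
  have -> : foldl (@lminus _ _ _) ([::] : seq (C * S)) K = [::].
    by elim: (K) => [//|s K' /=].
  by rewrite /iol big_nil.
rewrite -cat1s iol_foldminus_cat IH ?addr0 => [|q qL]; last first.
  by apply: hL; rewrite inE qL orbT.
apply: (@iol_foldminus_under p.2); first by apply: hL; exact: mem_head.
move=> q; rewrite inE => /eqP ->; exists (p.2^* * p.2)%SE; first exact: idem_ss.
by rewrite spmulA spregular.
Qed.

(** Take for [K] the elements occurring in [L]: with $M=0$ the parts on the bisections contribute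
    nothing, and the remainder vanishes formally. So [iol L] depends only on the function [ev L]. *)
Lemma iol_ev0 L : (forall g, ev L g = 0) -> iol L = 0.
Proof.
move=> h; apply: rn_eq0; apply/eqP; rewrite eq_le rn_ge0 andbT.
have := @iol_foldminus_bound L [seq p.2 | p <- L] 0 (lexx _).
rewrite iol_foldminus_mem ?rn0 ?mulr0 ?addr0.
  by apply => g; rewrite h rc0.
by move=> p pL; exact: map_f.
Qed.

(** Once all of [K] has been split off, the remainder represents the zero function, because [K]
    covers the support, and [iol_ev0] removes it. *)
Lemma iol_bound L K (M : R) : 0 <= M -> bsupp K (ev L) ->
  (forall g, rc (ev L g) <= M) -> rn (iol L) <= (size K)%:R * M.
Proof.
move=> M0 sL h; have := @iol_foldminus_bound L K M M0 h.
rewrite (iol_ev0 (L := foldl _ _ _)) ?rn0 ?addr0 // => g.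
have [h0|/sL] := eqVneq (ev L g) 0; first exact: ev_foldminus0.
exact: ev_foldminus.
Qed.

End SupportBound.

(** * Convolution and involution of finite sums *)

Section Convolution.
Variables (R : realType) (G : sepGraph) (A : adaptable G).
Local Notation C := R[i].
Local Notation S := (SE A).
Local Notation gG := (germ A).
Implicit Types (L : seq (C * S)) (K : seq S) (s t : S) (F : gG -> C).

(** The factorisation of $k$ into a germ of $s$ and a germ of $t$ is unique. Hence one list,
    independent of [F] and [F'], serves all functions with these supports, and bilinearity and
    bounds of the convolution can be read off it. *)
Lemma conv_list K K' (k : gG) : exists ql : seq (gG * gG),
  (size ql <= size K * size K')%N /\
  forall F F', bsupp K F -> bsupp K' F' ->
    groupoid_conv F F' k = \sum_(gh <- ql) F gh.1 * F' gh.2.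
Proof.
have hst (p : S * S) : exists l : seq (gG * gG), (size l <= 1)%N /\
    [set gh | [/\ germ_mul gh.1 gh.2 k, Th p.1 gh.1 & Th p.2 gh.2]] = [set` l].
  have [[gh [m h1 h2]]|nh] := pselect (exists gh : gG * gG,
      [/\ germ_mul gh.1 gh.2 k, Th p.1 gh.1 & Th p.2 gh.2]).
    exists [:: gh]; split => //; apply/seteqP; split => [[g h] /= [m' h1' h2']|[g h]].
      rewrite inE; have [e1 e2] := germ_mul_uniq m m' h1 h1' h2 h2'.
      by apply/eqP; rewrite -e1 -e2 -surjective_pairing.
    by rewrite /= inE => /eqP e; move: m h1 h2; rewrite -e.
  exists [::]; split => //; apply/seteqP; split => // -[g h] /= gh.
  by case: nh; exists (g, h).
have [f fP] := choice hst.
pose al := flatten [seq f p | p <- [seq (s, t) | s <- K, t <- K']].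
exists (undup al); split.
  apply: leq_trans (size_undup _) _.
  rewrite /al size_flatten -(size_allpairs pair K K') /shape -map_comp.
  elim: [seq _ | _ <- K, _ <- K'] => [//|p l IH] /=.
  by have [h _] := fP p; rewrite -[(size l).+1]add1n leq_add.
move=> F F' sF sF'; rewrite (fsbig_seq _ _ (undup_uniq al)) /groupoid_conv.
symmetry; apply: fsbig_widen.
  move=> gh /=; rewrite mem_undup => /flattenP[_ /mapP[p _ ->]] ghp.
  have [_ h] := fP p; have : [set` f p] gh by [].
  by rewrite -h => -[].
move=> [g h] /= [m nal]; apply: contrapT => /eqP ne.
have Fg : F g != 0 by apply: contra_neq ne => ->; rewrite mul0r.
have F'h : F' h != 0 by apply: contra_neq ne => ->; rewrite mulr0.
have [s sK sg] := sF _ Fg; have [t tK th] := sF' _ F'h.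
apply: nal; rewrite mem_undup; apply/flattenP; exists (f (s, t)).
  by apply/mapP; exists (s, t) => //; apply/allpairsP; exists (s, t).
by have [_ e] := fP (s, t); have : [set` f (s, t)] (g, h) by rewrite -e.
Qed.

Lemma conv_bound K K' F F' (M M' : R) k : 0 <= M -> 0 <= M' ->
  bsupp K F -> bsupp K' F' ->
  (forall g, rc (F g) <= M) -> (forall g, rc (F' g) <= M') ->
  rc (groupoid_conv F F' k) <= (size K * size K')%:R * (M * M').
Proof.
move=> M0 M'0 sF sF' hF hF'; have [ql [szq qE]] := conv_list K K' k.
rewrite qE //; apply: (@le_trans _ _ ((size ql)%:R * (M * M'))).
  elim: ql {szq qE} => [|q l IH]; first by rewrite big_nil rc0 mul0r.
  rewrite big_cons /= -addn1 natrD mulrDl mul1r [X in _ <= X]addrC.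
  apply: le_trans (rcD _ _) _; apply: lerD => //.
  by rewrite rcM; apply: ler_pM => //; exact: rc_ge0.
by apply: ler_wpM2r; [exact: mulr_ge0|rewrite ler_nat].
Qed.

Lemma bsupp_chi s : bsupp [:: s] (chi R s).
Proof. by move=> g /chi_neq0 h; exists s => //; rewrite inE. Qed.

Lemma conv_chi s t : groupoid_conv (chi R s) (chi R t) = chi R (s * t)%SE.
Proof.
apply/funext => k; rewrite chiE /groupoid_conv; case: asboolP => hk.
  have [g [h [m sg th]]] := germ_mul_ex hk.
  rewrite -(@fsbig_widen _ _ _ _ [set (g, h)]).
  - by rewrite fsbig_set1 /= !chiE !asboolT // mulr1.
  - by move=> _ ->.
  - move=> [g' h'] /= [m' ne]; apply: contrapT => /eqP ne0.
    have sg' : Th s g' by apply: (@chi_neq0 R); apply: contra_neq ne0 => ->; rewrite mul0r.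
    have th' : Th t h' by apply: (@chi_neq0 R); apply: contra_neq ne0 => ->; rewrite mulr0.
    by have [e1 e2] := germ_mul_uniq m m' sg sg' th th'; apply: ne; rewrite e1 e2.
rewrite fsbig1 // => -[g h] /= m; apply: contrapT => /eqP ne0.
have sg : Th s g by apply: (@chi_neq0 R); apply: contra_neq ne0 => ->; rewrite mul0r.
have th : Th t h by apply: (@chi_neq0 R); apply: contra_neq ne0 => ->; rewrite mulr0.
by have [] := germ_mul_Th m sg th.
Qed.

Lemma conv_ev L L' : groupoid_conv (ev L) (ev L') = ev (lmul L L').
Proof.
apply/funext => k.
pose K := [seq p.2 | p <- L]; pose K' := [seq p.2 | p <- L'].
have [ql [_ qE]] := conv_list K K' k.
rewrite qE; [|exact: bsupp_ev|exact: bsupp_ev].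
have chis s t : s \in K -> t \in K' ->
    \sum_(gh <- ql) chi R s gh.1 * chi R t gh.2 = chi R (s * t)%SE k.
  move=> sK tK; rewrite -conv_chi qE //.
    by move=> g /chi_neq0 h; exists s.
  by move=> g /chi_neq0 h; exists t.
transitivity (\sum_(p <- L) \sum_(q <- L') (p.1 * q.1) * chi R (p.2 * q.2)%SE k).
  transitivity (\sum_(gh <- ql) \sum_(p <- L) \sum_(q <- L')
      (p.1 * q.1) * (chi R p.2 gh.1 * chi R q.2 gh.2)).
    apply: eq_bigr => gh _; rewrite /ev mulr_suml; apply: eq_bigr => p _.
    by rewrite mulr_sumr; apply: eq_bigr => q _; rewrite mulrACA.
  rewrite exchange_big /= !big_seq; apply: eq_bigr => p pL.
  rewrite exchange_big /= !big_seq; apply: eq_bigr => q qL.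
  by rewrite -mulr_sumr chis //; exact: map_f.
by rewrite /ev /lmul big_allpairs_dep.
Qed.

Lemma conv_Dl K K' F1 F2 F' : bsupp K F1 -> bsupp K F2 -> bsupp K' F' ->
  groupoid_conv (fun g => F1 g - F2 g) F' =
  (fun k => groupoid_conv F1 F' k - groupoid_conv F2 F' k).
Proof.
move=> s1 s2 s'; apply/funext => k; have [ql [_ qE]] := conv_list K K' k.
have s12 : bsupp K (fun g => F1 g - F2 g).
  move=> g; have [h1|/s1 //] := eqVneq (F1 g) 0.
  by rewrite h1 sub0r oppr_eq0 => /s2.
rewrite !qE // -sumrB; apply: eq_bigr => q _; by rewrite mulrBl.
Qed.

Lemma conv_Dr K K' F F1 F2 : bsupp K F -> bsupp K' F1 -> bsupp K' F2 ->
  groupoid_conv F (fun g => F1 g - F2 g) =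
  (fun k => groupoid_conv F F1 k - groupoid_conv F F2 k).
Proof.
move=> s' s1 s2; apply/funext => k; have [ql [_ qE]] := conv_list K K' k.
have s12 : bsupp K' (fun g => F1 g - F2 g).
  move=> g; have [h1|/s1 //] := eqVneq (F1 g) 0.
  by rewrite h1 sub0r oppr_eq0 => /s2.
rewrite !qE // -sumrB; apply: eq_bigr => q _; by rewrite mulrBr.
Qed.

Lemma bsupp_conv K K' F F' : bsupp K F -> bsupp K' F' ->
  bsupp [seq (s * t)%SE | s <- K, t <- K'] (groupoid_conv F F').
Proof.
move=> sF sF' k; apply: contra_neqP => nk; rewrite /groupoid_conv fsbig1 //.
move=> [g h] /= m; apply: contrapT => /eqP ne.
have Fg : F g != 0 by apply: contra_neq ne => ->; rewrite mul0r.
have F'h : F' h != 0 by apply: contra_neq ne => ->; rewrite mulr0.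
have [s sK sg] := sF _ Fg; have [t tK th] := sF' _ F'h.
apply: nk; have [hk _ _] := germ_mul_Th m sg th.
by exists (s * t)%SE => //; apply/allpairsP; exists (s, t).
Qed.

Lemma star_chi s : groupoid_star (chi R s) = chi R (s^*)%SE.
Proof.
apply/funext => g; rewrite /groupoid_star !chiE.
case: asboolP => h; case: asboolP => h'; rewrite ?conjC1 ?conjC0 //.
  by case: h'; apply/Th_star.
by case: h; apply/Th_star.
Qed.

Lemma star_ev L : groupoid_star (ev L) = ev (lstar L).
Proof.
apply/funext => g; rewrite /groupoid_star /ev rmorph_sum /= big_map.
by apply: eq_bigr => p _ /=; rewrite rmorphM -star_chi.
Qed.

Lemma bsupp_star K F : bsupp K F -> bsupp [seq (s^*)%SE | s <- K] (groupoid_star F).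
Proof.
move=> sF g; rewrite /groupoid_star conjC_eq0 => /sF [s sK sg].
by exists (s^*)%SE; [exact: map_f|apply/Th_star].
Qed.

End Convolution.

(** * Functions of compact support *)

Lemma compact_finite_cover (T : topologicalType) (I : eqType) (K : set T)
    (f : I -> set T) : compact K -> (forall i, open (f i)) ->
  (forall x, K x -> exists i, f i x) ->
  exists l : seq I, forall x, K x -> exists2 i, i \in l & f i x.
Proof.
move=> cK fop cov; apply: contrapT => ncov.
pose D (l : seq I) := [set x | K x /\ forall i, i \in l -> ~ f i x].
pose F : set_system T := [set W | exists l, D l `<=` W].
have FF : ProperFilter F.
  apply: Build_ProperFilter_ex.
    move=> W [l lW]; apply: contrapT => nW; apply: ncov; exists l => x Kx.
    apply: contrapT => nx; apply: nW; exists x; apply: lW; split => // i il fx.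
    by apply: nx; exists i.
  split; first by exists [::].
    move=> P Q [l lP] [m mQ]; exists (l ++ m) => x [Kx h]; split.
      by apply: lP; split => // i il; apply: h; rewrite mem_cat il.
    by apply: mQ; split => // i im; apply: h; rewrite mem_cat im orbT.
  by move=> P Q PQ [l lP]; exists l; exact: subset_trans PQ.
have [p [Kp clp]] : K `&` cluster F !=set0 by apply: cK; exists [::] => x [].
have [i fip] := cov p Kp.
have [x [nx fx]] : (~` f i) `&` f i !=set0.
  apply: clp; last exact: open_nbhs_nbhs.
  by exists [:: i] => x [_]; apply; exact: mem_head.
exact: nx fx.
Qed.

(** * Uniform approximation by combinations of bisections *)

Section Density.
Variables (R : realType) (G : sepGraph) (A : adaptable G).
Local Notation C := R[i].
Local Notation S := (SE A).
Local Notation gG := (germ A).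
Local Notation X := (tight A).
Implicit Types (L : seq (C * S)) (K : seq S) (s t : S) (F : gG -> C).

Lemma continuous_near F (g : gG) (e : R) : continuous (F : gG -> R[i]^o) ->
  0 < e -> nbhs g [set h | rc (F h - F g) <= e].
Proof.
move=> cF e0; have e0' : 0 < (e%:C)%C :> C by rewrite ltcR.
have /cvgrPdistC_le /(_ _ e0') hF := cF g.
by apply: (@filterS _ _ (nbhs_filter g) _ _ _ hF) => h /= hg; apply/rc_le.
Qed.

Lemma near_continuous F : (forall (g : gG) (e : R), 0 < e ->
    nbhs g [set h | rc (F h - F g) <= e]) -> continuous (F : gG -> R[i]^o).
Proof.
move=> h g; apply/(@cvgrPdistC_le _ _ _ _ (nbhs_filter g)) => e e0.
have : e \is Num.real by rewrite realE ltW.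
case: e e0 => a b; rewrite complex_real => e0 /eqP /= b0; subst b.
have a0 : 0 < a by move: e0; rewrite ltcR.
by apply: (@filterS _ _ (nbhs_filter g) _ _ _ (h g a a0)) => k /= hk; apply/rc_le.
Qed.

Lemma tight_basis (x : X) W : nbhs x W -> exists e (ns : seq S),
  [/\ Dom e x, forall n, n \in ns -> idem n /\ ~ Dom n x &
      forall y : X, Dom e y -> (forall n, n \in ns -> ~ Dom n y) -> W y].
Proof.
pose F : set_system X := [set W | exists e (ns : seq S),
  [/\ Dom e x, forall n, n \in ns -> idem n /\ ~ Dom n x &
      forall y : X, Dom e y -> (forall n, n \in ns -> ~ Dom n y) -> W y]].
have [e0 xe0] : exists e, Dom e x by have [[[e xe] _ _ _ _] _] := tightP x; exists e.
have FF : Filter F.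
  split; first by exists e0, [::].
    move=> P Q [e [ns [xe hn hP]]] [f [ms [xf hm hQ]]].
    exists (e * f)%SE, (ns ++ ms); split; first exact: DomM.
      by move=> n; rewrite mem_cat => /orP[/hn|/hm].
    have ie := Dom_idem xe; have jf := Dom_idem xf.
    move=> y yef yn; split.
      apply: hP; first exact: DomMl yef.
      by move=> n nn; apply: yn; rewrite mem_cat nn.
    apply: hQ; first exact: DomMr yef.
    by move=> n nn; apply: yn; rewrite mem_cat nn orbT.
  move=> P Q PQ [e [ns [xe hn hP]]]; exists e, ns; split => // y ye yn.
  by apply: PQ; exact: hP.
suff : F --> x by apply.
apply: tight_cvg => [e xe|e ie nxe]; first by exists e, [::]; split.
exists e0, [:: e]; split => //; first by move=> n; rewrite inE => /eqP ->.
by move=> y _ /(_ e (mem_head _ _)).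
Qed.

Definition indicates L (W : set gG) :=
  forall h, ev L h = if `[< W h >] then 1 else 0.

(** [W] consists of the germs of $s$ with source in $D_e$ and outside finitely many $D_n$; its
    indicator is that of $se$ times the factors $1-1_{\Theta(sn)}$. *)
Lemma elementary_nbhs (g : gG) s (N : set gG) : Th s g -> nbhs g N ->
  exists L (W : set gG),
    [/\ indicates L W, open W, W g, W `<=` N & W `<=` [set h | Th s h]].
Proof.
move=> sg /(germ_nbhsE _ sg) /tight_basis [e [ns [ge hn hN]]].
have ie := Dom_idem ge.
pose W := [set h | Th s h /\ Dom e (srcg h) /\ forall n, n \in ns -> ~ Dom n (srcg h)].
exists (foldl (@lminus _ _ _) [:: (1, (s * e)%SE)] [seq (s * n)%SE | n <- ns]), W.
split.
- move=> h; pose Q (ms : seq S) := Th s h /\ Dom e (srcg h) /\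
      forall n, n \in ms -> ~ Dom n (srcg h).
  have hL : ev [:: (1 : C, (s * e)%SE)] h = if `[< Q [::] >] then 1 else 0.
    rewrite /ev big_seq1 mul1r chiE; case: asboolP => [/(Th_mulr _ _ ie) [h1 h2]|h1].
      by rewrite asboolT.
    by rewrite asboolF // => -[h2 [h3 _]]; apply: h1; apply/Th_mulr.
  have ins n : n \in ns -> idem n by move=> /hn [].
  suff key (ls ms : seq S) L : (forall n, n \in ls -> idem n) ->
      ev L h = (if `[< Q ms >] then 1 else 0) ->
      ev (foldl (@lminus _ _ _) L [seq (s * n)%SE | n <- ls]) h =
        if `[< Q (ms ++ ls) >] then 1 else 0 by exact: (key ns [::]).
  elim: ls ms L => [|n ls IH] ms L {hL}ils hL /=; first by rewrite cats0.
  rewrite -cat_rcons; apply: IH => [m mn|]; first by apply: ils; rewrite inE mn orbT.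
  have jn : idem n := ils n (mem_head _ _).
  rewrite ev_minus hL chiE; case: asboolP => [[h1 [h2 h3]]|nh]; last first.
    rewrite mul0r asboolF // => -[h1 [h2 h3]]; apply: nh; split => //; split => // m mm.
    by apply: h3; rewrite mem_rcons inE mm orbT.
  case: asboolP => [/(Th_mulr _ _ jn) [_ dn]|nd].
    rewrite subrr mulr0 asboolF // => -[_ [_ h4]].
    by apply: (h4 n) => //; rewrite mem_rcons inE eqxx.
  rewrite subr0 mulr1 asboolT //; split => //; split => // m.
  rewrite mem_rcons inE => /orP[/eqP ->|/h3 //] dn.
  by apply: nd; apply/Th_mulr.
- have -> : W = Theta s (Dom (s^* * s)%SE `&` Dom e `&` [set x | forall n, n \in ns -> ~ Dom n x]).
    apply/seteqP; split => h.
      move=> [h1 [h2 h3]]; exists (srcg h) => //; split => //; split => //.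
      exact: Th_dom.
    move=> [x [[x1 x2] x3] hs]; split; first exact: is_germ_Th hs.
    by rewrite (srcgE hs).
  apply: Theta_open; last by move=> x [[]].
  apply: openI; first by apply: openI; apply: Dom_open => //; exact: idem_ss.
  elim: ns hn {hN W} => [_|n l IH hn].
    have -> : [set x : X | forall n, n \in [::] -> ~ Dom n x] = setT by apply/seteqP; split.
    exact: openT.
  have -> : [set x : X | forall m, m \in n :: l -> ~ Dom m x] =
      ~` Dom n `&` [set x : X | forall n, n \in l -> ~ Dom n x].
    apply/seteqP; split => x /=.
      move=> h; split; first exact: h (mem_head _ _).
      by move=> m ml; apply: h; rewrite inE ml orbT.
    by move=> [h1 h2] m; rewrite inE => /orP[/eqP ->|/h2].
  apply: openI; first by apply: Dom_closed; have [] := hn n (mem_head _ _).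
  by apply: IH => m ml; apply: hn; rewrite inE ml orbT.
- by split => //; split => // n /hn [].
- by move=> h [h1 [h2 h3]]; apply: (hN (srcg h)).
- by move=> h [].
Qed.

Lemma ev_pointwise_mul L L' : exists M, forall g, ev M g = ev L g * ev L' g.
Proof.
exists [seq (p.1 * q.1, meet p.2 q.2) | p <- L, q <- L'] => g.
rewrite /ev big_allpairs_dep mulr_suml; apply: eq_bigr => p _.
rewrite mulr_sumr; apply: eq_bigr => q _ /=.
by rewrite chi_meet mulrACA.
Qed.

(** The sets are made disjoint by priority: the value at $h$ is [F g] for the first [g] in the list
    with $h$ in [W g]. Subtracting the product [M] erases the function of the tail on the set of the
    head. *)
Lemma step_function (l : seq gG) (W : gG -> set gG) (LW : gG -> seq (C * S)) F :
  (forall g, g \in l -> indicates (LW g) (W g)) ->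
  exists L, forall h, ((exists2 g, g \in l & W g h) ->
      exists2 g, g \in l /\ W g h & ev L h = F g) /\
    (~ (exists2 g, g \in l & W g h) -> ev L h = 0).
Proof.
elim: l => [_|g l IH hl].
  by exists [::] => h; split; [case|rewrite /ev big_nil].
have [|L hL] := IH; first by move=> k kl; apply: hl; rewrite inE kl orbT.
have ig := hl g (mem_head _ _).
have [M hM] := ev_pointwise_mul (LW g) L.
exists (lscale (F g) (LW g) ++ L ++ lscale (-1) M) => h.
have -> : ev (lscale (F g) (LW g) ++ L ++ lscale (-1) M) h =
    if `[< W g h >] then F g else ev L h.
  rewrite !ev_cat !ev_scale hM ig; case: asboolP => _.
    by rewrite mulr1 mul1r mulN1r subrr addr0.
  by rewrite mulr0 mul0r mulr0 addr0 add0r.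
case: asboolP => gh.
  split; last by case; exists g => //; exact: mem_head.
  by move=> _; exists g => //; split => //; exact: mem_head.
have [h1 h2] := hL h; split.
  move=> [k]; rewrite inE => /orP[/eqP -> //|kl] kh.
  have [|m [ml mh] ->] := h1; first by exists k.
  by exists m => //; split => //; rewrite inE ml orbT.
move=> nh; apply: h2 => -[k kl kh]; apply: nh; exists k => //.
by rewrite inE kl orbT.
Qed.

Lemma Cc_bsupp F : Cc F -> exists K, bsupp K F.
Proof.
move=> [_ coF].
have [|g _|K cov] := compact_finite_cover (f := fun s => [set g | Th s g]) coF.
- by move=> s; exact: Th_open.
- exact: Th_ex.
by exists K => g g0; apply: cov; apply: subset_closure; exact: g0.
Qed.

Lemma compact_Ths K : compact [set g : gG | exists2 s, s \in K & Th s g].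
Proof.
elim: K => [|s K IH].
  have -> : [set g : gG | exists2 s, s \in [::] & Th s g] = set0.
    by apply/seteqP; split => // g [].
  exact: compact0.
have -> : [set g : gG | exists2 t, t \in s :: K & Th t g] =
    [set g | Th s g] `|` [set g | exists2 s, s \in K & Th s g].
  apply/seteqP; split => g.
    by move=> [t]; rewrite inE => /orP[/eqP ->|tK] h; [left|right; exists t].
  by move=> [h|[t tK h]]; [exists s => //|exists t => //]; rewrite inE ?eqxx ?tK ?orbT.
by apply: compactU => //; exact: Th_compact.
Qed.

(** The step functions use neighbourhoods inside the union of the bisections of [K], so that the
    approximants keep the support [K] for every [e]; this is what makes the constant of [iol_bound]
    uniform in [e]. *)
Lemma ev_dense F K (e : R) : Cc F -> bsupp K F -> 0 < e ->
  exists2 L, bsupp K (ev L) & forall g, rc (F g - ev L g) <= e.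
Proof.
move=> [cF _] sF e0; pose U := [set g : gG | exists2 s, s \in K & Th s g].
have ex (g : gG) : exists p : seq (C * S) * set gG, U g ->
    [/\ indicates p.1 p.2, open p.2, p.2 g,
        p.2 `<=` [set h | rc (F h - F g) <= e] & p.2 `<=` U].
  have [[s sK sg]|nU] := pselect (U g); last by exists ([::], set0).
  have [L [W [h1 h2 h3 h4 h5]]] := elementary_nbhs sg (continuous_near g cF e0).
  by exists (L, W) => _; split => // h /h5 sh; exists s.
have [f fP] := choice ex.
have [||l0 cov] := compact_finite_cover (f := fun g => [set h | U g /\ (f g).2 h]) (@compact_Ths K).
- move=> g; have [gU|nU] := pselect (U g).
    have [_ og _ _ _] := fP g gU; have -> // : [set h | U g /\ (f g).2 h] = (f g).2.
    by apply/seteqP; split => h // -[].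
  have -> : [set h | U g /\ (f g).2 h] = set0 by apply/seteqP; split => h // -[].
  exact: open0.
- by move=> g gU; exists g; split => //; have [] := fP g gU.
pose l := [seq g <- l0 | `[< U g >]].
have lU g : g \in l -> U g by rewrite mem_filter => /andP[/asboolP].
have [L hL] := @step_function l (fun g => (f g).2) (fun g => (f g).1) F
  (fun g gl => let: And5 h _ _ _ _ := fP g (lU g gl) in h).
exists L.
  move=> h; have [_ h2] := hL h; apply: contra_neqP => nh; apply: h2.
  by move=> [g /lU /fP [_ _ _ _ sub] gh]; apply: nh; exact: sub.
move=> h; have [h1 h2] := hL h.
have [Uh|nUh] := pselect (U h).
  have [|g [gl gh] ->] := h1.
    by have [g gl [gU gh]] := cov h Uh; exists g => //; rewrite mem_filter gl andbT; apply/asboolP.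
  by have [_ _ _ sub _] := fP g (lU g gl); exact: sub.
rewrite h2; last by move=> [g /lU /fP [_ _ _ _ sub] gh]; apply: nUh; exact: sub.
have [->|/sF //] := eqVneq (F h) 0.
by rewrite subrr rc0 ltW.
Qed.

(** * The representation of $C_c$ induced by a representation of the relations *)

Section PiMap.
Variables (B : cstarAlg R) (phi : sgen G -> B).
Hypothesis phiP : satisfies_R1_R10 A phi.
Local Notation iol := (@iol R G A B phi).

(** Here $b$ is the limit of the [iol L] for sums approximating [F] uniformly with one common
    support. The linear rate $De$ serves the same purpose as in [Gr_cl]. *)
Definition approx F (b : B) := exists K (D : R), [/\ 0 <= D, bsupp K F &
  forall e : R, 0 < e -> e <= 1 -> exists L, [/\ bsupp K (ev L),
    forall g, rc (F g - ev L g) <= D * e & rn (b - iol L) <= D * e]].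

Lemma rc_sub_triangle (x y z : C) : rc (x - z) <= rc (x - y) + rc (y - z).
Proof. by rewrite -[x - z](subrKA y) rcD. Qed.

Lemma rcB (x y : C) : rc (x - y) = rc (y - x).
Proof. by rewrite -rcN opprB. Qed.

Lemma bsuppB K F F' : bsupp K F -> bsupp K F' -> bsupp K (fun g => F g - F' g).
Proof.
move=> h h' g; have [h1|/h //] := eqVneq (F g) 0.
by rewrite h1 sub0r oppr_eq0 => /h'.
Qed.

Lemma approx_uniq F b b' : approx F b -> approx F b' -> b = b'.
Proof.
move=> [K [D [D0 sF h]]] [K' [D' [D'0 _ h']]].
pose n : R := (size (K ++ K'))%:R.
apply: (@rn_eps_eq _ _ _ _ ((D + D') * (1 + n))) => e e0 e1.
have [L [sL hL rL]] := h e e0 e1; have [L' [sL' hL' rL']] := h' e e0 e1.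
have DD : 0 <= (D + D') * e by rewrite mulr_ge0 ?addr_ge0 // ltW.
have evE g : ev (L ++ lscale (-1) L') g = ev L g - ev L' g.
  by rewrite ev_cat ev_scale mulN1r.
have s1 : bsupp (K ++ K') (ev (L ++ lscale (-1) L')).
  have -> : ev (L ++ lscale (-1) L') = (fun g => ev L g - ev L' g) by apply/funext.
  apply: bsuppB; first by apply: sub_bsupp sL => s sK; rewrite mem_cat sK.
  by apply: sub_bsupp sL' => s sK; rewrite mem_cat sK orbT.
have := iol_bound phiP DD s1; rewrite iol_cat iol_scale scaleN1r => /(_ _) h3.
have {}h3 : rn (iol L - iol L') <= n * ((D + D') * e).
  apply: h3 => g; rewrite evE; have := rc_sub_triangle (ev L g) (F g) (ev L' g).
  by rewrite (rcB (ev L g) (F g)); have := hL g; have := hL' g; lra.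
have := rn_triangle (iol L) b b'; have := rn_triangle (iol L') (iol L) b'.
rewrite (rnB (iol L') b'); clearbody n.
have -> : (D + D') * (1 + n) * e = D * e + D' * e + n * ((D + D') * e) by ring.
lra.
Qed.

Lemma approx_ev L : approx (ev L) (iol L).
Proof.
exists [seq p.2 | p <- L], 0; split => //; first exact: bsupp_ev.
move=> e _ _; exists L; split; first exact: bsupp_ev.
  by move=> g; rewrite subrr rc0 mul0r.
by rewrite subrr rn0 mul0r.
Qed.

Lemma approx_ex F : Cc F -> exists b, approx F b.
Proof.
move=> cF; have [K sF] := Cc_bsupp cF.
pose e n : R := (1 / 2) ^+ n.
have e0 n : 0 < e n by rewrite exprn_gt0 //; lra.
have /choice [u uP] : forall n, exists L, bsupp K (ev L) /\
    forall g, rc (F g - ev L g) <= e n.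
  by move=> n; have [L sL hL] := ev_dense cF sF (e0 n); exists L.
have dist m n (d : R) : e m <= d -> e n <= d ->
    rn (iol (u m) - iol (u n)) <= (size K)%:R * (2 * d).
  move=> md nd; have [s1 h1] := uP m; have [s2 h2] := uP n.
  have -> : iol (u m) - iol (u n) = iol (u m ++ lscale (-1) (u n)).
    by rewrite iol_cat iol_scale scaleN1r.
  have evE g : ev (u m ++ lscale (-1) (u n)) g = ev (u m) g - ev (u n) g.
    by rewrite ev_cat ev_scale mulN1r.
  apply: (iol_bound phiP).
  - by have := e0 m; lra.
  - have -> : ev (u m ++ lscale (-1) (u n)) = (fun g => ev (u m) g - ev (u n) g).
      by apply/funext.
    exact: bsuppB.
  - move=> g; rewrite evE; have := rc_sub_triangle (ev (u m) g) (F g) (ev (u n) g).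
    by rewrite (rcB (ev (u m) g) (F g)); have := h1 g; have := h2 g; lra.
have sz0 : 0 <= (size K)%:R :> R by [].
have [d d0|b bP] := @rn_complete R B (fun n => iol (u n)).
  have p0 : 0 < 2 * (size K)%:R + 1 :> R by lra.
  have [N NP] := half_exp_small (divr_gt0 d0 p0).
  exists N => m n Nm Nn; apply: le_trans (dist m n _ (NP m Nm) (NP n Nn)) _.
  rewrite mulrA mulrC -mulrA.
    apply: (@le_trans _ _ (d / (2 * (size K)%:R + 1) * (2 * (size K)%:R + 1))).
    rewrite -mulrA; apply: ler_wpM2l; first exact: ltW.
    by rewrite ler_pM2l ?invr_gt0 //; lra.
  by rewrite divfK // gt_eqF.
exists b, K, 1; split => // d d0 d1.
have [N NP] := half_exp_small d0; have [M MP] := bP d d0.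
have [s1 h1] := uP (maxn N M); exists (u (maxn N M)); split => //.
  move=> g; rewrite mul1r; apply: le_trans (h1 g) _.
  by apply: NP; exact: leq_maxl.
by rewrite mul1r rnB; apply: MP; exact: leq_maxr.
Qed.

Lemma approxD F F' b b' : approx F b -> approx F' b' ->
  approx (fun g => F g + F' g) (b + b').
Proof.
move=> [K [D [D0 sF h]]] [K' [D' [D'0 sF' h']]].
have sum F1 F2 : bsupp K F1 -> bsupp K' F2 -> bsupp (K ++ K') (fun g => F1 g + F2 g).
  move=> h1 h2 g; have [e1|/h1 [s sK sg] _] := eqVneq (F1 g) 0.
    rewrite e1 add0r => /h2 [s sK sg]; exists s => //.
    by rewrite mem_cat sK orbT.
  by exists s => //; rewrite mem_cat sK.
exists (K ++ K'), (D + D'); split; [exact: addr_ge0|exact: sum|] => e e0 e1.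
have [L [sL hL rL]] := h e e0 e1; have [L' [sL' hL' rL']] := h' e e0 e1.
exists (L ++ L'); split.
- have -> : ev (L ++ L') = (fun g => ev L g + ev L' g) by apply/funext => g; exact: ev_cat.
  exact: sum.
- move=> g; rewrite ev_cat opprD addrACA; have := rcD (F g - ev L g) (F' g - ev L' g).
  by have := hL g; have := hL' g; lra.
- rewrite iol_cat opprD addrACA.
  by have := rnD (b - iol L) (b' - iol L'); lra.
Qed.

Lemma approxZ (a : C) F b : approx F b -> approx (fun g => a * F g) (a *: b).
Proof.
move=> [K [D [D0 sF h]]].
have sc F1 : bsupp K F1 -> bsupp K (fun g => a * F1 g).
  by move=> h1 g; rewrite mulf_eq0 negb_or => /andP[_ /h1].
exists K, (rc a * D); split; [by rewrite mulr_ge0 // rc_ge0|exact: sc|].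
move=> e e0 e1; have [L [sL hL rL]] := h e e0 e1; exists (lscale a L); split.
- have -> : ev (lscale a L) = (fun g => a * ev L g) by apply/funext => g; exact: ev_scale.
  exact: sc.
- move=> g; rewrite ev_scale -mulrBr rcM -mulrA; apply: ler_wpM2l => //.
  exact: rc_ge0.
- by rewrite iol_scale -scalerBr rnZ -mulrA; apply: ler_wpM2l => //; exact: rc_ge0.
Qed.

Lemma approx_star F b : approx F b -> approx (groupoid_star F) (cstar b).
Proof.
move=> [K [D [D0 sF h]]]; exists [seq (s^*)%SE | s <- K], D; split => //.
  exact: bsupp_star.
move=> e e0 e1; have [L [sL hL rL]] := h e e0 e1; exists (lstar L); split.
- by rewrite -star_ev; exact: bsupp_star.
- by move=> g; rewrite -star_ev /groupoid_star -rmorphB rc_conj.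
- by rewrite (iol_star phiP) -cstarB rn_star.
Qed.

Lemma approx_bounded F b : approx F b -> exists2 M : R, 0 <= M & forall g, rc (F g) <= M.
Proof.
move=> [K [D [D0 _ h]]]; have [L [_ hL _]] := h 1 ltr01 (lexx _).
have evb g : rc (ev L g) <= \sum_(p <- L) rc p.1.
  rewrite /ev; elim: (L) => [|p l IH]; first by rewrite !big_nil rc0.
  rewrite !big_cons; apply: le_trans (rcD _ _) _; apply: lerD => //.
  by rewrite rcM -[X in _ <= X]mulr1; apply: ler_wpM2l; [exact: rc_ge0|exact: rc_chi].
exists (D + \sum_(p <- L) rc p.1).
  by rewrite addr_ge0 // sumr_ge0 // => p _; exact: rc_ge0.
move=> g; have := rcD (F g - ev L g) (ev L g); rewrite subrK.
by have := hL g; have := evb g; lra.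
Qed.

Lemma approxM F F' b b' : approx F b -> approx F' b' ->
  approx (groupoid_conv F F') (cmul b b').
Proof.
move=> aF aF'; have [M M0 hM] := approx_bounded aF.
have [M' M'0 hM'] := approx_bounded aF'.
move: aF aF' => [K [D [D0 sF h]]] [K' [D' [D'0 sF' h']]].
pose n : R := (size K * size K')%:R.
have n0 : 0 <= n by [].
(* [D1] accounts for the uniform error of replacing first [F] and then [F'], through [conv_bound];
   [D2] is the norm error from [rn_mul_approx]. *)
pose D1 := n * (D * M') + n * ((M + D) * D').
pose D2 := rn b * D' + D * (rn b' + D').
have D10 : 0 <= D1 by rewrite addr_ge0 // !mulr_ge0 // addr_ge0.
have D20 : 0 <= D2 by rewrite addr_ge0 // mulr_ge0 ?rn_ge0 // addr_ge0 // rn_ge0.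
exists [seq (s * t)%SE | s <- K, t <- K'], (D1 + D2); split.
- exact: addr_ge0.
- exact: bsupp_conv.
move=> e e0 e1; have [L [sL hL rL]] := h e e0 e1; have [L' [sL' hL' rL']] := h' e e0 e1.
exists (lmul L L'); split.
- by rewrite -conv_ev; exact: bsupp_conv.
- move=> k; rewrite -conv_ev [X in _ <= X]mulrDl.
  have d1 : rc (groupoid_conv F F' k - groupoid_conv (ev L) F' k) <= n * (D * e * M').
    have -> : groupoid_conv F F' k - groupoid_conv (ev L) F' k =
       groupoid_conv (fun g => F g - ev L g) F' k by rewrite (conv_Dl sF sL sF').
    apply: conv_bound => //; first by rewrite mulr_ge0 // ltW.
    exact: bsuppB.
  have hLb g : rc (ev L g) <= M + D.
    have := rcD (F g) (ev L g - F g); rewrite addrC subrK (rcB (ev L g) (F g)).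
    have := hL g; have := hM g; have : D * e <= D * 1 by apply: ler_wpM2l.
    lra.
  have d2 : rc (groupoid_conv (ev L) F' k - groupoid_conv (ev L) (ev L') k) <=
        n * ((M + D) * (D' * e)).
    have -> : groupoid_conv (ev L) F' k - groupoid_conv (ev L) (ev L') k =
       groupoid_conv (ev L) (fun g => F' g - ev L' g) k by rewrite (conv_Dr sL sF' sL').
    apply: conv_bound => //; [exact: addr_ge0|by rewrite mulr_ge0 // ltW|exact: bsuppB].
  have := rc_sub_triangle (groupoid_conv F F' k) (groupoid_conv (ev L) F' k)
        (groupoid_conv (ev L) (ev L') k).
  have : 0 <= D2 * e by rewrite mulr_ge0 // ltW.
  have : D1 * e = n * (D * e * M') + n * ((M + D) * (D' * e)) by rewrite /D1; ring.
  move: (D1 * e) (D2 * e) => x y.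
  move: d1 d2; move: (n * _) (n * _) => z w; lra.
- rewrite (iol_mul phiP).
  rewrite mulrDl; have := rn_mul_approx e0 e1 D0 D'0 rL rL'; rewrite -/D2.
  have : 0 <= D1 * e by rewrite mulr_ge0 // ltW.
  lra.
Qed.

Definition pi_rep F : B := xget 0 [set b | approx F b].

Lemma pi_repE F b : approx F b -> pi_rep F = b.
Proof.
move=> h; rewrite /pi_rep; case: xgetP => [b' _ h'|/(_ b) //].
exact: approx_uniq h' h.
Qed.

Lemma pi_rep_approx F : Cc F -> approx F (pi_rep F).
Proof. by move=> /approx_ex [b h]; rewrite (pi_repE h). Qed.

Lemma pi_rep_Cc : is_Cc_rep pi_rep.
Proof.
split.
- move=> F F' cF cF'; apply: pi_repE; apply: approxD; exact: pi_rep_approx.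
- by move=> a F cF; apply: pi_repE; apply: approxZ; exact: pi_rep_approx.
- move=> F F' cF cF'; apply: pi_repE; apply: approxM; exact: pi_rep_approx.
- by move=> F cF; apply: pi_repE; apply: approx_star; exact: pi_rep_approx.
Qed.

Lemma pi_rep_ev L : pi_rep (ev L) = iol L.
Proof. exact/pi_repE/approx_ev. Qed.

Lemma ev1 s : ev [:: (1, s)] = chi R s.
Proof. by apply/funext => g; rewrite /ev big_seq1 mul1r. Qed.

End PiMap.
End Density.

Lemma near_continuous_rc (R : realType) (X : topologicalType) (f : X -> R[i]) :
  (forall x (e : R), 0 < e -> nbhs x [set y | rc (f y - f x) <= e]) ->
  continuous (fun x => rc (f x)).
Proof.
move=> cf x; apply/cvgrPdistC_le => e e0; apply: filterS (cf x e e0) => y /= h1.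
have := rcD (f y - f x) (f x); have := rcD (f x - f y) (f y).
by rewrite !subrK (rcB (f x)) ler_norml; lra.
Qed.

(** * Representations of $C_c$: the relations and boundedness *)

Section CcRep.
Variables (R : realType) (G : sepGraph) (A : adaptable G).
Local Notation C := R[i].
Local Notation S := (SE A).
Local Notation gG := (germ A).
Local Notation X := (tight A).
Implicit Types (L : seq (C * S)) (K : seq S) (s t : S) (F : gG -> C).

Lemma Th_closed_set s : closed [set g : gG | Th s g].
Proof. by rewrite -[X in closed X]setCK; apply: open_closedC; exact: Th_closed. Qed.

Lemma Ths_closed K : closed [set g : gG | exists2 s, s \in K & Th s g].
Proof.
elim: K => [|s K IH].
  have -> : [set g : gG | exists2 s, s \in [::] & Th s g] = set0.
    by apply/seteqP; split => // g [].
  exact: closed0.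
have -> : [set g : gG | exists2 t, t \in s :: K & Th t g] =
    [set g | Th s g] `|` [set g | exists2 s, s \in K & Th s g].
  apply/seteqP; split => g.
    by move=> [t]; rewrite inE => /orP[/eqP ->|tK] h; [left|right; exists t].
  by move=> [h|[t tK h]]; [exists s => //|exists t => //]; rewrite inE ?eqxx ?tK ?orbT.
exact: closedU (@Th_closed_set s) IH.
Qed.

Lemma Cc_of F K : continuous (F : gG -> R[i]^o) -> bsupp K F -> Cc F.
Proof.
move=> cF sF; split => //.
apply: (subclosed_compact _ (@compact_Ths G A K)); first exact: closed_closure.
have -> : [set g : gG | exists2 s, s \in K & Th s g] =
    closure [set g : gG | exists2 s, s \in K & Th s g].
  exact/closure_id/Ths_closed.
by apply: closure_subset => g /sF.
Qed.

Lemma chi_near s (g : gG) : nbhs g [set h | chi R s h = chi R s g].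
Proof.
rewrite chiE; case: asboolP => sg.
  apply: (@filterS _ _ (nbhs_filter g) _ _ _ (open_nbhs_nbhs (conj (Th_open s) sg))).
  by move=> h sh /=; rewrite chiE asboolT.
apply: (@filterS _ _ (nbhs_filter g) _ _ _ (open_nbhs_nbhs (conj (Th_closed s) sg))).
by move=> h sh /=; rewrite chiE asboolF.
Qed.

(** Meant for $(a,b)=(0,1)$ and $(1,-1)$, that is for multiplication by $1_{\Theta(s)}$ and by
    $1-1_{\Theta(s)}$. *)
Lemma continuousM_chi F s (a b : C) : continuous (F : gG -> R[i]^o) ->
  rc (a + b * 1) <= 1 -> rc (a + b * 0) <= 1 ->
  continuous ((fun g => F g * (a + b * chi R s g)) : gG -> R[i]^o).
Proof.
move=> cF h1 h0; apply: near_continuous => g e e0.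
apply: (@filterS _ _ (nbhs_filter g) _ _ _
  (@filterI _ _ (nbhs_filter g) _ _ (continuous_near g cF e0) (chi_near s g))).
move=> h [hF hc] /=; rewrite hc -mulrBl rcM.
have h2 : rc (a + b * chi R s g) <= 1 by rewrite chiE; case: asboolP.
apply: le_trans (ler_wpM2l (rc_ge0 _) h2) _.
by rewrite mulr1.
Qed.

Lemma CcD F F' : Cc F -> Cc F' -> Cc (fun g => F g + F' g).
Proof.
move=> cF cF'; have [K sF] := Cc_bsupp cF; have [K' sF'] := Cc_bsupp cF'.
apply: (@Cc_of _ (K ++ K')).
  apply: near_continuous => g e e0; have e20 : 0 < e / 2 by lra.
  apply: (@filterS _ _ (nbhs_filter g) _ _ _ (@filterI _ _ (nbhs_filter g) _ _
    (continuous_near g cF.1 e20) (continuous_near g cF'.1 e20))).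
  move=> h [h1 h2] /=; rewrite opprD addrACA.
  by have := rcD (F h - F g) (F' h - F' g); move: h1 h2 => /=; lra.
move=> g; have [e1|/sF [s sK sg] _] := eqVneq (F g) 0.
  rewrite e1 add0r => /sF' [s sK sg]; exists s => //.
  by rewrite mem_cat sK orbT.
by exists s => //; rewrite mem_cat sK.
Qed.

Lemma CcZ (a : C) F : Cc F -> Cc (fun g => a * F g).
Proof.
move=> cF; have [K sF] := Cc_bsupp cF; apply: (@Cc_of _ K).
  apply: near_continuous => g e e0.
  have a0 : 0 < rc a + 1 by have := rc_ge0 a; lra.
  have e20 : 0 < e / (rc a + 1) by exact: divr_gt0.
  apply: (@filterS _ _ (nbhs_filter g) _ _ _ (continuous_near g cF.1 e20)).
  move=> h /= h1; rewrite -mulrBr rcM.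
  apply: le_trans (ler_wpM2l (rc_ge0 a) h1) _.
  rewrite mulrA ler_pdivrMr // mulrC; apply: ler_wpM2l; first exact: ltW.
  lra.
by move=> g; rewrite mulf_eq0 negb_or => /andP[_ /sF].
Qed.

Lemma Cc0 : Cc (fun _ : gG => 0 : C).
Proof.
apply: (@Cc_of _ [::]); last by move=> g; rewrite eqxx.
apply: near_continuous => g e e0.
apply: (@filterS _ _ (nbhs_filter g) _ _ _ (@filterT _ _ (nbhs_filter g))) => h _ /=.
by rewrite subrr rc0 ltW.
Qed.

Lemma Cc_chi s : Cc (chi R s : gG -> C).
Proof.
apply: (@Cc_of _ [:: s]); last exact: bsupp_chi.
apply: near_continuous => g e e0.
apply: (@filterS _ _ (nbhs_filter g) _ _ _ (chi_near s g)) => h /= ->.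
by rewrite subrr rc0 ltW.
Qed.

Lemma ev_cons p L : ev (p :: L) = (fun g => p.1 * chi R p.2 g + ev L g).
Proof. by apply/funext => g; rewrite /ev big_cons. Qed.

Lemma Cc_ev L : Cc (ev L : gG -> C).
Proof.
elim: L => [|p L IH].
  have -> : ev [::] = (fun _ : gG => 0 : C) by apply/funext => g; rewrite /ev big_nil.
  exact: Cc0.
by rewrite ev_cons; apply: CcD => //; apply: CcZ; exact: Cc_chi.
Qed.

Variables (B : cstarAlg R) (rho : (gG -> C) -> B).
Hypothesis rhoP : is_Cc_rep rho.

Lemma rho_ev L : rho (ev L) = \sum_(p <- L) p.1 *: rho (chi R p.2).
Proof.
elim: L => [|p L IH].
  have -> : ev [::] = (fun g : gG => 0 * 0 : C) by apply/funext => g; rewrite /ev big_nil mulr0.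
  by rewrite (Cc_repZ rhoP) ?scale0r ?big_nil //; exact: Cc0.
rewrite ev_cons big_cons (Cc_repD rhoP); first last.
- exact: Cc_ev.
- by apply: CcZ; exact: Cc_chi.
by rewrite (Cc_repZ rhoP) ?IH //; exact: Cc_chi.
Qed.

Lemma rho0 : rho (fun=> 0) = 0.
Proof.
have <- : ev [::] = (fun _ : gG => 0 : C) by apply/funext => g; rewrite /ev big_nil.
by rewrite rho_ev big_nil.
Qed.

Definition rho_gen (x : sgen G) : B := rho (chi R (gen A x)).

Lemma rho_seval (a : sterm (sgen G)) :
  seval rho_gen a = rho (chi R (pcls (srel A) a)).
Proof.
elim: a => [|x|a IHa b IHb|a IHa] //=.
- rewrite -rho0; congr rho; apply/funext => g; rewrite chiE asboolF //.
  exact: Th0.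
- by rewrite IHa IHb -(Cc_repM rhoP) ?conv_chi ?pmul_cls //; exact: Cc_chi.
- by rewrite IHa -(Cc_rep_star rhoP) ?star_chi ?pstar_cls //; exact: Cc_chi.
Qed.

(** A tight filter containing $v$ meets the finite cover of $v$ by the $ee^*$, and by orthogonality
    it contains only one of them; this is (R10) at the level of functions. *)
Lemma chi_block v (Y : set (edge G)) (l : seq (edge G)) : blocks v Y ->
  uniq l -> Y = [set` l] -> chi R (gen A (gV v)) =
  ev [seq (1, (gen A (gE e) * (gen A (gE e))^*)%SE) | e <- l].
Proof.
move=> bY ul YE; pose ee e := (gen A (gE e) * (gen A (gE e))^*)%SE.
have iee e : idem (ee e) by exact: idem_ss'.
have Vee e : e \in l -> ee e = (gen A (gV v) * ee e)%SE.
  move=> el; have Ye : Y e by rewrite YE.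
  by rewrite /ee spmulA; have := genVE A e; rewrite (block_src bY Ye) => ->.
apply/funext => g; rewrite /ev big_map /= chiE; case: asboolP => vg; last first.
  rewrite big_seq big1 // => e el; rewrite mul1r chiE asboolF //.
  by rewrite -/(ee e) (Vee e el) => /(Th_mulr _ _ (iee e)) [].
have xv : Dom (gen A (gV v)) (srcg g).
  by have := Th_dom vg; rewrite genV_star genV_idem.
have Thee e : e \in l -> Th (ee e) g <-> Dom (ee e) (srcg g).
  move=> el; rewrite (Vee e el) (Th_mulr _ _ (iee e)) -(Vee e el).
  by split => [[]//|]; split.
have [z [e el <-] xe] : exists2 z, (ee @` [set` l]) z & Dom z (srcg g).
  apply: (Dom_cover xv); split.
  - by apply: finite_image; apply/finite_seqP; exists l.
  - move=> _ [e el <-]; split => //; rewrite /ile (idemC (iee e) (idem_V A v)).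
    by rewrite -Vee.
  - move=> f [jf fv] f0; have [e Ye h] := block_cover_idem bY jf fv f0.
    by exists (ee e) => //; exists e => //; move: Ye; rewrite YE.
rewrite (bigD1_seq e) //= mul1r chiE asboolT; last exact/Thee.
rewrite big_seq_cond big1 ?addr0 // => f /andP[fl /eqP fe].
rewrite mul1r chiE asboolF // => /(Thee f fl) xf; apply: (@Dom0 _ A (srcg g)).
have <- : (ee f * ee e = 0)%SE.
  by apply: (edge_orth A bY) => //; rewrite YE.
exact: DomM.
Qed.

Lemma rho_R1_R10 : satisfies_R1_R10 A rho_gen.
Proof.
split=> [t u tu|v Y bY]; first by rewrite !rho_seval (pcls_rel tu).
have /finite_seqP[l0 YE0] := ad_finsep A bY.
have YE : Y = [set` undup l0].
  by rewrite YE0; apply/seteqP; split=> e /=; rewrite mem_undup.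
rewrite {1}/rho_gen (chi_block bY (undup_uniq l0) YE) rho_ev big_map.
rewrite YE -fsbig_seq ?undup_uniq //; apply: eq_bigr => e _ /=.
rewrite scale1r /rho_gen -(Cc_rep_star rhoP) ?star_chi; last exact: Cc_chi.
by rewrite -(Cc_repM rhoP) ?conv_chi //; exact: Cc_chi.
Qed.

Lemma rho_gen_iota s : iotaS rho_gen s = rho (chi R s).
Proof. by rewrite /iotaS rho_seval /pcls reprK. Qed.

Definition near_cont (f : X -> C) := forall x (e : R), 0 < e ->
  nbhs x [set y | rc (f y - f x) <= e].

Definition lift s (f : X -> C) : gG -> C :=
  fun g => if `[< Th s g >] then f (srcg g) else 0.

Lemma Cc_lift s f : near_cont f -> Cc (lift s f).
Proof.
move=> cf; apply: (@Cc_of _ [:: s]).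
  apply: near_continuous => g e e0; rewrite /lift; case: asboolP => sg.
    have h1 : nbhs g ((@srcg G A) @^-1` [set y | rc (f y - f (srcg g)) <= e]).
      by apply: srcg_continuous; exact: cf.
    apply: (@filterS _ _ (nbhs_filter g) _ _ _ (@filterI _ _ (nbhs_filter g) _ _ h1
      (open_nbhs_nbhs (conj (Th_open s) sg)))).
    by move=> h [hf hs] /=; rewrite asboolT.
  apply: (@filterS _ _ (nbhs_filter g) _ _ _ (open_nbhs_nbhs (conj (Th_closed s) sg))).
  by move=> h hs /=; rewrite asboolF // subr0 rc0 ltW.
move=> g; rewrite /lift; case: asboolP => [sg _|]; last by rewrite eqxx.
by exists s => //; exact: mem_head.
Qed.

Lemma srcg_inv s g : Th (s^*)%SE g -> val (srcg (germ_inv g)) = act (s^*)%SE (val (srcg g)).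
Proof.
move=> sg; have [s0 [x [y [yE gE hE]]]] := germ_inv_spec g.
have [_ [f df sf]] := (ThP _ (is_germ_Th gE)).1 sg.
rewrite (srcgE gE) in df *; rewrite (srcgE hE) yE.
apply/seteqP; split; first exact: act_eq df sf.
by apply: act_eq df _; rewrite sf.
Qed.

(** If $k=gh$ with $g$ a germ of $s^*$ and $h$ a germ of $s$, then $h$ and $g^{-1}$ both have the
    source of $k$; so the convolution is a pointwise product over the units. *)
Lemma conv_lift s f f' : groupoid_conv (groupoid_star (lift s f)) (lift s f') =
  lift (s^* * s)%SE (fun x => (f x)^* * f' x).
Proof.
apply/funext => k; rewrite [RHS]/lift /groupoid_conv.
have val_pair (g h : gG) : germ_mul g h k -> Th (s^*)%SE g -> Th s h ->
    srcg h = srcg k /\ srcg (germ_inv g) = srcg k.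
  move=> m sg sh; have [hk hs gs] := germ_mul_Th m sg sh; split => //.
  apply: val_inj; rewrite (srcg_inv sg).
  have sk : Dom (s^* * s)%SE (srcg k) by rewrite -hs; exact: Th_dom.
  by apply: act_starK sk _ _.
case: asboolP => hk.
  have [g [h [m sg th]]] := germ_mul_ex hk.
  rewrite -(@fsbig_widen _ _ _ _ [set (g, h)]).
  - rewrite fsbig_set1 /= /groupoid_star /lift !asboolT //; last exact/Th_star.
    by have [-> ->] := val_pair g h m sg th.
  - by move=> _ ->.
  - move=> [g' h'] /= [m' ne]; apply: contrapT => /eqP ne0.
    have sg' : Th (s^*)%SE g'.
      apply: contrapT => n; move: ne0.
      by rewrite /groupoid_star /lift asboolF ?conjC0 ?mul0r ?eqxx // => /Th_star.
    have th' : Th s h'.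
      by apply: contrapT => n; move: ne0; rewrite /lift (asboolF n) mulr0 eqxx.
    by have [e1 e2] := germ_mul_uniq m m' sg sg' th th'; apply: ne; rewrite e1 e2.
rewrite fsbig1 // => -[g h] /= m; apply: contrapT => /eqP ne0.
have sg : Th (s^*)%SE g.
  apply: contrapT => n; move: ne0.
  by rewrite /groupoid_star /lift asboolF ?conjC0 ?mul0r ?eqxx // => /Th_star.
have th : Th s h.
  by apply: contrapT => n; move: ne0; rewrite /lift (asboolF n) mulr0 eqxx.
by have [] := germ_mul_Th m sg th.
Qed.

Lemma germ_inv_continuous : continuous (@germ_inv G A).
Proof.
move=> g N /= gN; have [s tg] : exists s, Th (s^*)%SE g.
  by have [t tg] := Th_ex g; exists (t^*)%SE; rewrite spstarK.
have sg := (Th_star s g).1 tg.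
have [e [ns [xe xn hN]]] := tight_basis ((germ_nbhsE _ sg).1 gN).
have iss (n : S) : idem n -> idem ((s^*)^* * n * s^*)%SE by move=> jn; exact: idem_conj.
have act_dom (h : gG) (n : S) : Th (s^*)%SE h -> idem n ->
    Dom n (srcg (germ_inv h)) <-> Dom ((s^*)^* * n * s^*)%SE (srcg h).
  move=> sh jn; rewrite {1}/Dom /= (srcg_inv sh); split; last by split.
  by move=> [].
have ie := Dom_idem xe.
have near_ns : nbhs g [set h | forall n, n \in ns -> ~ Dom ((s^*)^* * n * s^*)%SE (srcg h)].
  elim: ns xn {hN} => [_|n l IH xn].
    by apply: (@filterS _ _ (nbhs_filter g) _ _ _ (@filterT _ _ (nbhs_filter g))).
  have [jn nx] := xn n (mem_head _ _).
  have hn : nbhs g ((@srcg G A) @^-1` (~` Dom ((s^*)^* * n * s^*)%SE)).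
    apply: srcg_continuous; apply: open_nbhs_nbhs; split.
      exact: Dom_closed (iss n jn).
    by move/(act_dom g n tg jn).
  have hl := IH (fun m ml => xn m (introT orP (or_intror ml))).
  apply: (@filterS _ _ (nbhs_filter g) _ _ _ (@filterI _ _ (nbhs_filter g) _ _ hn hl)).
  by move=> h [h1 h2] m; rewrite inE => /orP[/eqP ->|/h2].
have near_e : nbhs g ((@srcg G A) @^-1` (Dom ((s^*)^* * e * s^*)%SE)).
  apply: srcg_continuous; apply: open_nbhs_nbhs; split; first exact: Dom_open (iss e ie).
  exact/(act_dom g e tg ie).
apply: (@filterS _ _ (nbhs_filter g) _ _ _ (@filterI _ _ (nbhs_filter g) _ _
  (@filterI _ _ (nbhs_filter g) _ _ near_ns near_e) (open_nbhs_nbhs (conj (Th_open (s^*)%SE) tg)))).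
move=> h [[h1 h2] h3] /=; apply: (hN (srcg (germ_inv h))).
- exact/(act_dom h e h3 ie).
- by move=> n nn /(act_dom h n h3 (xn n nn).1); exact: h1.
- exact/Th_star.
Qed.

Lemma Cc_star F : Cc F -> Cc (groupoid_star F).
Proof.
move=> cF; have [K sF] := Cc_bsupp cF.
apply: (@Cc_of _ [seq (s^*)%SE | s <- K]); last exact: bsupp_star.
apply: near_continuous => g e e0.
have := germ_inv_continuous (continuous_near (germ_inv g) cF.1 e0).
move=> h; apply: (@filterS _ _ (nbhs_filter g) _ _ _ h) => k /= hk.
by rewrite /groupoid_star -rmorphB rc_conj.
Qed.

(** By the C*-identity, estimates on a bisection are reduced to nonnegative functions on the
    units. *)
Lemma rn_rho_lift s f : near_cont f ->
  rn (rho (lift s f)) ^+ 2 = rn (rho (lift (s^* * s)%SE (fun x => (f x)^* * f x))).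
Proof.
move=> cf; have cl := Cc_lift s cf.
rewrite -conv_lift (Cc_repM rhoP) //; last exact: Cc_star.
by rewrite (Cc_rep_star rhoP) // rn_starM.
Qed.

Lemma rc_Re_Im (a b : R) : rc (a%:C + 'i * b%:C)%C <= `|a| + `|b|.
Proof.
apply: le_trans (rcD _ _) _; rewrite rcM rc_i mul1r.
have h (c : R) : rc (c%:C)%C = `|c|.
  by rewrite /rc normc_def /= expr0n addr0 sqrtr_sqr.
by rewrite !h.
Qed.

Lemma rn_rho_chi s : rn (rho (chi R s)) <= 1.
Proof. by rewrite -rho_gen_iota; exact: rn_iota rho_R1_R10 s. Qed.

Lemma lift1 s f : (forall x, Dom (s^* * s)%SE x -> f x = 1) -> lift s f = chi R s.
Proof.
move=> h; apply/funext => g; rewrite /lift chiE; case: asboolP => // sg.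
by rewrite h //; exact: Th_dom.
Qed.

Lemma cont_near (f : X -> R) : continuous f -> forall x (e : R), 0 < e ->
  nbhs x [set y | `|f y - f x| <= e].
Proof.
by move=> cf x e e0; have /cvgrPdistC_le /(_ _ e0) := cf x.
Qed.

Lemma conj_unit (a c : R) : a ^+ 2 + c ^+ 2 = 1 ->
  (a%:C + 'i * c%:C)%C^* * (a%:C + 'i * c%:C)%C = 1.
Proof.
move=> h; apply/eqP; rewrite eq_complex /=.
rewrite !(mul0r, mulr0, mul1r, mulr1, addr0, add0r, subr0, sub0r).
by apply/andP; split; apply/eqP; rewrite -?h; ring.
Qed.

(* f +- i sqrt(1 - f^2) is unitary over the support. *)
Lemma rn_rho_lift_real s (f : X -> R) : continuous f ->
  (forall x, Dom (s^* * s)%SE x -> `|f x| <= 1) ->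
  rn (rho (lift s (fun x => (f x)%:C%C))) <= 1.
Proof.
move=> cf f1.
pose q x : R := Num.sqrt (1 - f x ^+ 2).
have cq : continuous q.
  move=> x; have c2 : {for x, continuous (fun x => f x ^+ 2)}.
    exact: (continuousM (cf x) (cf x)).
  have c1 : {for x, continuous (fun x => 1 - f x ^+ 2)}.
    exact: (continuousB (@cst_continuous _ _ (1 : R) x) c2).
  exact: (continuous_comp c1 (@sqrt_continuous R _)).
pose u (b : R) x : C := ((f x)%:C + 'i * (b * q x)%:C)%C.
have cu b : `|b| = 1 -> near_cont (u b).
  move=> b1 x e e0; have e20 : 0 < e / 2 by lra.
  apply: filterS (filterI (cont_near cf x e20) (cont_near cq x e20)) => y /= [h1 h2].
  have -> : u b y - u b x = ((f y - f x)%:C + 'i * (b * (q y - q x))%:C)%C.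
    by rewrite /u !rmorphB /= mulrBr rmorphB /= mulrBr opprD addrACA.
  apply: le_trans (rc_Re_Im _ _) _.
  by rewrite normrM b1 mul1r; lra.
have bu b : `|b| = 1 -> rn (rho (lift s (u b))) <= 1.
  move=> b1; have := rn_rho_lift s (cu b b1).
  rewrite [X in _ = rn (rho X)]lift1; last first.
    move=> x; rewrite (idem_star (idem_ss s)) (idem_ss s : _ = _) => sx.
    apply: conj_unit; rewrite exprMn -(real_normK (num_real b)) b1 expr1n mul1r.
    rewrite sqr_sqrtr ?subrKC // subr_ge0 -(real_normK (num_real (f x))).
    by rewrite expr_le1 ?f1 // normr_ge0.
  have := rn_rho_chi (s^* * s)%SE; have := rn_ge0 (rho (lift s (u b))).
  nra.
have -> : lift s (fun x => (f x)%:C%C) =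
    (fun g => 2^-1 * lift s (u 1) g + 2^-1 * lift s (u (-1)) g).
  apply/funext => g; rewrite /lift; case: asboolP => _; last by rewrite !mulr0 addr0.
  rewrite /u mulN1r mul1r rmorphN /= mulrN -mulrDr addrACA subrr addr0.
  rewrite mulrDr -mulrDl; have -> : (2^-1 + 2^-1 : C) = 1 by field.
  by rewrite mul1r.
have c1 : Cc (lift s (u 1)) by apply: Cc_lift; apply: cu; rewrite normr1.
have c2 : Cc (lift s (u (-1))) by apply: Cc_lift; apply: cu; rewrite normrN1.
rewrite (Cc_repD rhoP); [|exact: CcZ|exact: CcZ].
rewrite !(Cc_repZ rhoP) //; apply: le_trans (rnD _ _) _.
rewrite !rn_half; have := bu 1 (normr1 _); have := bu (-1) (normrN1 _).
lra.
Qed.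

Lemma rn_rho_lift_bound s f (M : R) : near_cont f -> 0 <= M ->
  (forall x, Dom (s^* * s)%SE x -> rc (f x) <= M) -> rn (rho (lift s f)) <= M.
Proof.
move=> cf M0 fM; have [M1|/eqP M1] := eqVneq M 0.
  rewrite M1; have -> : lift s f = fun=> 0; last by rewrite rho0 rn0.
  apply/funext => g; rewrite /lift; case: asboolP => // sg.
  have := fM _ (Th_dom sg); rewrite M1 => h.
  apply/eqP; rewrite -normr_eq0 rcE.
  by have -> : rc (f (srcg g)) = 0 by apply/eqP; rewrite eq_le h rc_ge0.
have Mp : 0 < M by rewrite lt_neqAle M0 andbT eq_sym; apply/eqP.
(* Only $|f|^2$ matters for the norm; [h] is $|f|^2/M^2$, which is real with values in $[0,1]$ over
   the domain of $s$, as [rn_rho_lift_real] requires. *)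
pose h x : R := (rc (f x) / M) ^+ 2.
have ch : continuous h.
  have cr := near_continuous_rc cf.
  have cr2 : continuous (fun x => rc (f x) / M).
    by move=> x; exact: (continuousM (cr x) (@cst_continuous _ _ (M^-1 : R) x)).
  by move=> x; exact: (continuousM (cr2 x) (cr2 x)).
have := rn_rho_lift s cf; set r := rn (rho (lift s f)).
have -> : lift (s^* * s)%SE (fun x => (f x)^* * f x) =
    (fun g => (M ^+ 2)%:C%C * lift (s^* * s)%SE (fun x => (h x)%:C%C) g).
  apply/funext => g; rewrite /lift; case: asboolP => _; last by rewrite mulr0.
  rewrite mulrC -normCK rcE -rmorphXn -rmorphM /=; congr (_%:C%C).
  by rewrite /h expr_div_n; field; apply/eqP.
have cl : Cc (lift (s^* * s)%SE (fun x => (h x)%:C%C)).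
  apply: Cc_lift => x e e0; apply: filterS (cont_near ch x e0) => y /= h1.
  by rewrite -rmorphB /rc normc_def /= expr0n addr0 sqrtr_sqr.
rewrite (Cc_repZ rhoP) // rnZ rc_real ?exprn_ge0 // => rE.
have : rn (rho (lift (s^* * s)%SE (fun x => (h x)%:C%C))) <= 1.
  apply: rn_rho_lift_real => // x; rewrite (idem_star (idem_ss s)) (idem_ss s : _ = _) => sx.
  rewrite ger0_norm ?sqr_ge0 // expr_le1 ?divr_ge0 ?rc_ge0 //.
  by rewrite ler_pdivrMr // mul1r fM.
have := rn_ge0 (rho (lift s f)); rewrite -/r => r0 h1.
rewrite -(@ler_pXn2r _ 2) ?nnegrE // rE.
by apply: ler_piMr => //; exact: exprn_ge0.
Qed.

Lemma bsupp1_lift s F : continuous (F : gG -> R[i]^o) -> bsupp [:: s] F ->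
  exists f, [/\ near_cont f, F = lift s f &
    forall x, Dom (s^* * s)%SE x -> exists g, f x = F g].
Proof.
move=> cF sF.
have /choice [f fP] x : exists c : C, (forall g, is_germ g s x -> c = F g) /\
    (~ Dom (s^* * s)%SE x -> c = 0).
  have [sx|nx] := pselect (Dom (s^* * s)%SE x).
    have [g gs] := germ_exP sx; exists (F g); split => // h hs.
    by congr F; apply: Th_inj (is_germ_Th gs) (is_germ_Th hs) _; rewrite (srcgE gs) (srcgE hs).
  by exists 0; split => // g [].
exists f; split.
- move=> x e e0; have [sx|nx] := pselect (Dom (s^* * s)%SE x).
    have [g gs] := germ_exP sx.
    have := (germ_nbhsE _ (is_germ_Th gs)).1 (continuous_near g cF e0).
    rewrite (srcgE gs) => h1.
    apply: filterS (filterI h1 (open_nbhs_nbhs (conj (Dom_open (idem_ss s)) sx))).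
    move=> y [hy sy] /=; have [k ks] := germ_exP sy.
    by rewrite ((fP y).1 k ks) ((fP x).1 g gs); exact: hy.
  apply: filterS (open_nbhs_nbhs (conj (Dom_closed (idem_ss s)) nx)) => y ny /=.
  by rewrite (fP y).2 // (fP x).2 // subrr rc0 ltW.
- apply/funext => g; rewrite /lift; case: asboolP => [sg|ng].
    by rewrite ((fP (srcg g)).1 g).
  by apply/eqP; apply: contrapT => /negP /sF [t]; rewrite inE => /eqP ->.
- by move=> x sx; have [g gs] := germ_exP sx; exists g; exact: (fP x).1.
Qed.

(** Multiplication by $1_{\Theta(s)}$ and by its complement splits [F] into two parts that remain
    continuous since $\Theta(s)$ is clopen. The first lives on one bisection and costs $M$, the
    second is supported in the rest of [K]. *)
Lemma rn_rho_bound K F (M : R) : 0 <= M -> continuous (F : gG -> R[i]^o) ->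
  bsupp K F -> (forall g, rc (F g) <= M) -> rn (rho F) <= (size K)%:R * M.
Proof.
move=> M0; elim: K F => [|s K IH] F cF sF FM.
  have -> : F = fun=> 0; last by rewrite rho0 rn0 mul0r.
  by apply/funext => g; apply/eqP; apply: contrapT => /negP /sF [].
have r01 : rc (0 + 1 * 1 : C) <= 1 /\ rc (0 + 1 * 0 : C) <= 1.
  by rewrite mulr0 mulr1 addr0 add0r rc0 rc1.
have r10 : rc (1 + -1 * 1 : C) <= 1 /\ rc (1 + -1 * 0 : C) <= 1.
  by rewrite mulr0 mulr1 subrr addr0 rc0 rc1.
pose F1 g := F g * (0 + 1 * chi R s g); pose F2 g := F g * (1 + -1 * chi R s g).
have c1 : continuous (F1 : gG -> R[i]^o) := continuousM_chi cF r01.1 r01.2.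
have c2 : continuous (F2 : gG -> R[i]^o) := continuousM_chi cF r10.1 r10.2.
have s1 : bsupp [:: s] F1.
  move=> g; rewrite /F1 chiE; case: asboolP => [sg _|]; last by rewrite mulr0 addr0 mulr0 eqxx.
  by exists s => //; exact: mem_head.
have s2 : bsupp K F2.
  move=> g; rewrite /F2 chiE; case: asboolP => [_|ng].
    by rewrite mulr1 subrr mulr0 eqxx.
  rewrite mulr0 addr0 mulr1 => /sF [t]; rewrite inE => /orP[/eqP ->|tK tg] //.
  by exists t.
have FE : F = fun g => F1 g + F2 g.
  by apply/funext => g; rewrite /F1 /F2 -mulrDr mul1r mulN1r add0r subrKC mulr1.
have b1 : rn (rho F1) <= M.
  have [f [cf E1 fx]] := bsupp1_lift c1 s1; rewrite E1; apply: rn_rho_lift_bound => // x sx.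
  have [g ->] := fx x sx; rewrite /F1 rcM -[leRHS]mulr1.
  by apply: ler_pM; rewrite ?rc_ge0 // chiE; case: asboolP; case: r01.
have b2 : rn (rho F2) <= (size K)%:R * M.
  apply: IH => // g; rewrite /F2 rcM -[leRHS]mulr1.
  by apply: ler_pM; rewrite ?rc_ge0 // chiE; case: asboolP; case: r10.
rewrite FE (Cc_repD rhoP (Cc_of c1 s1) (Cc_of c2 s2)).
apply: le_trans (rnD _ _) _.
by rewrite /= -natr1 mulrDl mul1r; lra.
Qed.

Lemma rn_rho_sub K F F' (e : R) : 0 <= e -> Cc F -> Cc F' -> bsupp K F -> bsupp K F' ->
  (forall g, rc (F g - F' g) <= e) -> rn (rho F - rho F') <= (size K)%:R * e.
Proof.
move=> e0 cF cF' sF sF' h; have cN := CcZ (-1) cF'; have cD := CcD cF cN.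
have -> : rho F - rho F' = rho (fun g => F g + -1 * F' g).
  by rewrite (Cc_repD rhoP) // (Cc_repZ rhoP) // scaleN1r.
apply: rn_rho_bound => // [|g|g]; first exact: cD.1.
  by rewrite mulN1r; exact: bsuppB.
by rewrite mulN1r.
Qed.

End CcRep.

(** * The enveloping C*-algebra of a family of representations *)

Section Envelope.
Variables (R : realType) (X : Type) (P : forall D : cstarAlg R, (X -> D) -> Prop).
Local Notation C := R[i].
Local Notation T := (seq (C * sterm X)).
Local Notation family := (forall D : cstarAlg R, (X -> D) -> D).

Definition evl (D : cstarAlg R) (psi : X -> D) (l : T) : D :=
  \sum_(p <- l) p.1 *: seval psi p.2.

(** Convergence is uniform over all representations, so that the norm, a supremum over them, is
    controlled in the limit. *)
Definition converges (u : nat -> T) (L : family) := forall e : R, 0 < e ->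
  exists N, forall n, (N <= n)%N -> forall (D : cstarAlg R) (psi : X -> D),
  P psi -> rn (evl psi (u n) - L D psi) <= e.

Definition family_le (L : family) (M : R) :=
  forall (D : cstarAlg R) (psi : X -> D), P psi -> rn (L D psi) <= M.

Definition bounded_limit u L := converges u L /\ exists2 M, 0 <= M & family_le L M.

Lemma evl_cat (D : cstarAlg R) (psi : X -> D) l l' : evl psi (l ++ l') = evl psi l + evl psi l'.
Proof. exact: big_cat. Qed.

Lemma evl_scale (D : cstarAlg R) (psi : X -> D) a l :
  evl psi [seq (a * p.1, p.2) | p <- l] = a *: evl psi l.
Proof.
by rewrite /evl big_map scaler_sumr; apply: eq_bigr => p _; rewrite scalerA.
Qed.

Lemma evl_mul (D : cstarAlg R) (psi : X -> D) l l' :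
  evl psi [seq (p.1 * q.1, SMul p.2 q.2) | p <- l, q <- l'] =
  cmul (evl psi l) (evl psi l').
Proof.
rewrite /evl big_allpairs_dep; elim: l => [|p l IH]; first by rewrite !big_nil cmul0l.
rewrite !big_cons cmulDl IH; congr (_ + _).
elim: l' {IH} => [|q l' IH]; first by rewrite !big_nil cmul0r.
by rewrite !big_cons cmulDr IH; congr (_ + _); rewrite cmulZl cmulZr scalerA.
Qed.

Lemma evl_star (D : cstarAlg R) (psi : X -> D) l :
  evl psi [seq (p.1^*, SStar p.2) | p <- l] = cstar (evl psi l).
Proof.
elim: l => [|p l IH]; first by rewrite /evl !big_nil cstar0.
by rewrite /evl !big_cons -/(evl psi _) IH cstarD cstarZ.
Qed.

Lemma bounded_limitD u L u' L' : bounded_limit u L -> bounded_limit u' L' ->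
  bounded_limit (fun n => u n ++ u' n) (fun D psi => L D psi + L' D psi).
Proof.
move=> [h [M M0 hM]] [h' [M' M'0 hM']]; split; last first.
  exists (M + M') => [|D psi Pp]; first exact: addr_ge0.
  by apply: le_trans (rnD _ _) _; apply: lerD; [exact: hM|exact: hM'].
move=> e e0; have e20 : 0 < e / 2 by lra.
have [N hN] := h _ e20; have [N' hN'] := h' _ e20.
exists (maxn N N') => n; rewrite geq_max => /andP[Nn N'n] D psi Pp.
rewrite evl_cat opprD addrACA; apply: le_trans (rnD _ _) _.
by have := hN n Nn D psi Pp; have := hN' n N'n D psi Pp; lra.
Qed.

Lemma bounded_limitZ a u L : bounded_limit u L ->
  bounded_limit (fun n => [seq (a * p.1, p.2) | p <- u n]) (fun D psi => a *: L D psi).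
Proof.
move=> [h [M M0 hM]]; split; last first.
  exists (rc a * M) => [|D psi Pp]; first by rewrite mulr_ge0 ?rc_ge0.
  by rewrite rnZ; apply: ler_wpM2l; [exact: rc_ge0|exact: hM].
move=> e e0; have a0 : 0 < rc a + 1 by have := rc_ge0 a; lra.
have [N hN] := h (e / (rc a + 1)) (divr_gt0 e0 a0).
exists N => n Nn D psi Pp; rewrite evl_scale -scalerBr rnZ.
have := hN n Nn D psi Pp; rewrite ler_pdivlMr // => h1.
by have := rn_ge0 (evl psi (u n) - L D psi); have := rc_ge0 a; nra.
Qed.

Lemma bounded_limit_star u L : bounded_limit u L ->
  bounded_limit (fun n => [seq (p.1^*, SStar p.2) | p <- u n])
    (fun D psi => cstar (L D psi)).
Proof.
move=> [h [M M0 hM]]; split; last by exists M => // D psi Pp; rewrite rn_star; exact: hM.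
move=> e e0; have [N hN] := h e e0; exists N => n Nn D psi Pp.
by rewrite evl_star -cstarB rn_star; exact: hN.
Qed.

Lemma bounded_limitM u L u' L' : bounded_limit u L -> bounded_limit u' L' ->
  bounded_limit (fun n => [seq (p.1 * q.1, SMul p.2 q.2) | p <- u n, q <- u' n])
    (fun D psi => cmul (L D psi) (L' D psi)).
Proof.
move=> [h [M M0 hM]] [h' [M' M'0 hM']]; split; last first.
  exists (M * M') => [|D psi Pp]; first exact: mulr_ge0.
  by apply: rnM_le; [exact: hM|exact: hM'].
move=> e e0; have K0 : 0 < M + M' + 2 by lra.
pose d := Num.min 1 (e / (M + M' + 2)).
have d0 : 0 < d by rewrite lt_min ltr01 divr_gt0.
have d1 : d <= 1 by rewrite ge_min lexx.
have dK : d * (M + M' + 2) <= e by rewrite -ler_pdivlMr // ge_min lexx orbT.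
have [N hN] := h _ d0; have [N' hN'] := h' _ d0.
exists (maxn N N') => n; rewrite geq_max => /andP[Nn N'n] D psi Pp.
rewrite evl_mul rnB.
have h1 : rn (L D psi - evl psi (u n)) <= 1 * d by rewrite rnB mul1r; exact: hN.
have h2 : rn (L' D psi - evl psi (u' n)) <= 1 * d by rewrite rnB mul1r; exact: hN'.
apply: le_trans (rn_mul_approx d0 d1 ler01 ler01 h1 h2) _.
by have := hM D psi Pp; have := hM' D psi Pp; nra.
Qed.

Lemma bounded_limit_cst (t : T) M : 0 <= M -> family_le (fun D psi => evl psi t) M ->
  bounded_limit (fun=> t) (fun D psi => evl psi t).
Proof.
move=> M0 tM; split; last by exists M.
by move=> e e0; exists 0%N => n _ D psi Pp; rewrite subrr rn0 ltW.
Qed.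

(** Elements of the envelope are encoded by sequences of formal combinations rather than by families
    indexed by all representations: such families would live in a universe above that of the
    algebras [D], and the envelope could not be one of these. *)
Definition presequence := set_type [set u : nat -> T | exists L, bounded_limit u L].
HB.instance Definition _ := Choice.on presequence.

Definition limit (u : nat -> T) (D : cstarAlg R) (psi : X -> D) : D :=
  xget 0 [set z | forall e : R, 0 < e -> exists N, forall n, (N <= n)%N ->
    rn (evl psi (u n) - z) <= e].

Lemma limitE u L (D : cstarAlg R) (psi : X -> D) : converges u L -> P psi ->
  limit u psi = L D psi.
Proof.
move=> h Pp; apply: xget_unique.
  by move=> e e0; have [N hN] := h e e0; exists N => n /hN; exact.
move=> z hz; apply: (@rn_eps_eq _ _ _ _ 2) => e e0 _.
have [N hN] := h e e0; have [N' hN'] := hz e e0.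
have := hN _ (leq_maxl N N') D psi Pp; have := hN' _ (leq_maxr N N').
have := rn_triangle (evl psi (u (maxn N N'))) z (L D psi).
by rewrite (rnB z (evl _ _)); lra.
Qed.

Definition preseq_eq (u v : presequence) : bool :=
  `[< forall (D : cstarAlg R) (psi : X -> D), P psi -> limit (val u) psi = limit (val v) psi >].

Lemma preseq_eq_refl : reflexive preseq_eq.
Proof. by move=> u; apply/asboolP. Qed.

Lemma preseq_eq_sym : symmetric preseq_eq.
Proof. by move=> u v; apply/asboolP/asboolP => h D psi /h. Qed.

Lemma preseq_eq_trans : transitive preseq_eq.
Proof.
move=> v u w /asboolP h /asboolP h'; apply/asboolP => D psi Pp.
by rewrite h // h'.
Qed.

Canonical preseq_equiv := EquivRel preseq_eq preseq_eq_refl preseq_eq_sym preseq_eq_trans.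

Definition envelope := {eq_quot preseq_equiv}.
HB.instance Definition _ := Choice.on envelope.

Definition extend (D : cstarAlg R) (psi : X -> D) (x : envelope) : D :=
  limit (val (repr x)) psi.

Lemma envelope_ext (x y : envelope) : (forall (D : cstarAlg R) (psi : X -> D),
  P psi -> extend psi x = extend psi y) -> x = y.
Proof.
by move=> h; rewrite -[x]reprK -[y]reprK; apply/eqmodP/asboolP; exact: h.
Qed.

Lemma envelope_ex u L : bounded_limit u L -> exists x : envelope,
  forall (D : cstarAlg R) (psi : X -> D), P psi -> extend psi x = L D psi.
Proof.
move=> uL; have h : exists L, bounded_limit u L by exists L.
pose v : presequence := SigSub (mem_set h); exists (\pi_envelope v) => D psi Pp.
have /eqmodP/asboolP e : repr (\pi_envelope v) = v %[mod envelope] by rewrite reprK.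
by rewrite /extend e //; exact: limitE uL.1 Pp.
Qed.

Lemma envelope_limit x : exists u, bounded_limit u (fun D psi => @extend D psi x).
Proof.
have [u uE] : exists u, u = val (repr x) by exists (val (repr x)).
have [L [cL [M M0 LM]]] : exists L, bounded_limit u L.
  by rewrite uE; have := set_mem (valP (repr x)).
have e (D : cstarAlg R) (psi : X -> D) : P psi -> extend psi x = L D psi.
  by move=> Pp; rewrite /extend -uE; exact: limitE.
exists u; split; last by exists M => // D psi Pp; rewrite e //; exact: LM.
by move=> d d0; have [N hN] := cL d d0; exists N => n Nn D psi Pp; rewrite e //; exact: hN.
Qed.

Lemma env0_ex : exists z : envelope, forall (D : cstarAlg R) (psi : X -> D),
  P psi -> extend psi z = 0.
Proof.
have h : family_le (fun D psi => evl psi [::]) 0.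
  by move=> D psi _; rewrite /evl big_nil rn0.
have [z hz] := envelope_ex (bounded_limit_cst (lexx 0) h).
by exists z => D psi /hz ->; rewrite /evl big_nil.
Qed.

Lemma envD_ex x y : exists z : envelope, forall (D : cstarAlg R) (psi : X -> D),
  P psi -> extend psi z = extend psi x + extend psi y.
Proof.
have [u hu] := envelope_limit x; have [v hv] := envelope_limit y.
exact: envelope_ex (bounded_limitD hu hv).
Qed.

Lemma envZ_ex a x : exists z : envelope, forall (D : cstarAlg R) (psi : X -> D),
  P psi -> extend psi z = a *: extend psi x.
Proof.
by have [u hu] := envelope_limit x; exact: envelope_ex (bounded_limitZ a hu).
Qed.

Lemma envM_ex x y : exists z : envelope, forall (D : cstarAlg R) (psi : X -> D),
  P psi -> extend psi z = cmul (extend psi x) (extend psi y).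
Proof.
have [u hu] := envelope_limit x; have [v hv] := envelope_limit y.
exact: envelope_ex (bounded_limitM hu hv).
Qed.

Lemma env_star_ex x : exists z : envelope, forall (D : cstarAlg R) (psi : X -> D),
  P psi -> extend psi z = cstar (extend psi x).
Proof.
by have [u hu] := envelope_limit x; exact: envelope_ex (bounded_limit_star hu).
Qed.

Definition env0 := projT1 (cid env0_ex).
Definition envD x y := projT1 (cid (envD_ex x y)).
Definition envZ a x := projT1 (cid (envZ_ex a x)).
Definition envM x y := projT1 (cid (envM_ex x y)).
Definition env_star x := projT1 (cid (env_star_ex x)).

Section Extend.
Variables (D : cstarAlg R) (psi : X -> D).
Hypothesis Pp : P psi.

Lemma extend0 : extend psi env0 = 0.
Proof. exact: (projT2 (cid env0_ex)). Qed.

Lemma extendD x y : extend psi (envD x y) = extend psi x + extend psi y.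
Proof. exact: (projT2 (cid (envD_ex x y))). Qed.

Lemma extendZ a x : extend psi (envZ a x) = a *: extend psi x.
Proof. exact: (projT2 (cid (envZ_ex a x))). Qed.

Lemma extendM x y : extend psi (envM x y) = cmul (extend psi x) (extend psi y).
Proof. exact: (projT2 (cid (envM_ex x y))). Qed.

Lemma extend_star x : extend psi (env_star x) = cstar (extend psi x).
Proof. exact: (projT2 (cid (env_star_ex x))). Qed.

End Extend.

Lemma envDA : associative envD.
Proof. by move=> x y z; apply: envelope_ext => D psi Pp; rewrite !extendD // addrA. Qed.

Lemma envDC : commutative envD.
Proof. by move=> x y; apply: envelope_ext => D psi Pp; rewrite !extendD // addrC. Qed.

Lemma env0D : left_id env0 envD.
Proof. by move=> x; apply: envelope_ext => D psi Pp; rewrite extendD // extend0 // add0r. Qed.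

Lemma envND : left_inverse env0 (envZ (-1)) envD.
Proof.
move=> x; apply: envelope_ext => D psi Pp.
by rewrite extendD // extend0 // extendZ // scaleN1r addNr.
Qed.

HB.instance Definition _ := GRing.isZmodule.Build envelope envDA envDC env0D envND.

Lemma envZA a b x : envZ a (envZ b x) = envZ (a * b) x.
Proof. by apply: envelope_ext => D psi Pp; rewrite !extendZ // scalerA. Qed.

Lemma env1Z : left_id 1 envZ.
Proof. by move=> x; apply: envelope_ext => D psi Pp; rewrite extendZ // scale1r. Qed.

Lemma envZDr : right_distributive envZ +%R.
Proof.
move=> a x y; apply: envelope_ext => D psi Pp.
by rewrite extendZ // !extendD // !extendZ // scalerDr.
Qed.

Lemma envZDl x : {morph envZ^~ x : a b / a + b}.
Proof.
move=> a b; apply: envelope_ext => D psi Pp.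
by rewrite extendD // !extendZ // scalerDl.
Qed.

HB.instance Definition _ :=
  GRing.Zmodule_isLmodule.Build C envelope envZA env1Z envZDr envZDl.

Lemma env_norm_ex x : exists M : R, [/\ 0 <= M, family_le (fun D psi => @extend D psi x) M &
  forall M' : R, 0 <= M' -> family_le (fun D psi => @extend D psi x) M' -> M <= M'].
Proof.
(* $0$ is adjoined so that the set is nonempty even in the absence of representations. It is a set
   of reals, although the representations range over all algebras. *)
pose E := [set r | r = 0 \/
  exists (D : cstarAlg R) (psi : X -> D), P psi /\ r = rn (extend psi x)].
have E0 : E 0 by left.
have supE : has_sup E.
  split; first by exists 0.
  have [u [_ [M M0 hM]]] := envelope_limit x; exists M => r [->//|[D [psi [Pp ->]]]].
  exact: hM.
exists (sup E); split; first exact: sup_upper_bound supE _ E0.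
  by move=> D psi Pp; apply: (sup_upper_bound supE); right; exists D, psi.
move=> M' M0 hM; apply: ge_sup; first by exists 0.
by move=> r [->//|[D [psi [Pp ->]]]]; exact: hM.
Qed.

Definition env_norm (x : envelope) : R := projT1 (cid (env_norm_ex x)).

Lemma env_norm_ub (D : cstarAlg R) (psi : X -> D) x : P psi ->
  rn (extend psi x) <= env_norm x.
Proof. by rewrite /env_norm; case: cid => M [_ h _] /=; exact: h. Qed.

Lemma env_norm_le x (M : R) : 0 <= M -> family_le (fun D psi => @extend D psi x) M ->
  env_norm x <= M.
Proof. by rewrite /env_norm; case: cid => M' [_ _ h] /=; exact: h. Qed.

Lemma env_norm_ge0 x : 0 <= env_norm x.
Proof. by rewrite /env_norm; case: cid => M []. Qed.

Lemma env_normD x y : env_norm (x + y) <= env_norm x + env_norm y.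
Proof.
apply: env_norm_le => [|D psi Pp]; first by rewrite addr_ge0 ?env_norm_ge0.
rewrite extendD //; apply: le_trans (rnD _ _) _.
by apply: lerD; exact: env_norm_ub.
Qed.

Lemma env_normZ a x : env_norm (a *: x) = rc a * env_norm x.
Proof.
have h b y : env_norm (b *: y) <= rc b * env_norm y.
  apply: env_norm_le => [|D psi Pp]; first by rewrite mulr_ge0 ?rc_ge0 ?env_norm_ge0.
  by rewrite extendZ // rnZ; apply: ler_wpM2l; [exact: rc_ge0|exact: env_norm_ub].
apply/le_anti/andP; split; first exact: h.
have [->|a0] := eqVneq a 0; first by rewrite rc0 mul0r env_norm_ge0.
have := h a^-1 (a *: x); rewrite scalerA mulVf // scale1r => h1.
have := ler_wpM2l (rc_ge0 a) h1; rewrite mulrA -rcM divff // rc1 mul1r.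
exact.
Qed.

Lemma env_norm_eq0 x : env_norm x = 0 -> x = 0.
Proof.
move=> x0; apply: envelope_ext => D psi Pp; rewrite extend0 //; apply: rn_eq0.
by apply/le_anti/andP; split; [rewrite -x0; exact: env_norm_ub|exact: rn_ge0].
Qed.

Lemma env_normDC x y : (env_norm (x + y))%:C%C <= (env_norm x)%:C%C + (env_norm y)%:C%C :> C.
Proof. by rewrite -rmorphD lecR; exact: env_normD. Qed.

Lemma env_normZC a x : (env_norm (a *: x))%:C%C = `|a| * (env_norm x)%:C%C :> C.
Proof. by rewrite env_normZ rmorphM /= rcE. Qed.

Lemma env_normC_eq0 x : (env_norm x)%:C%C = 0 :> C -> x = 0.
Proof. by move=> [] /env_norm_eq0. Qed.

HB.instance Definition _ := Lmodule_isNormed.Build C envelope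
  env_normDC env_normZC env_normC_eq0.

Lemma envelope_normE (x : envelope) : `|x| = (env_norm x)%:C%C.
Proof. by []. Qed.

Lemma extendB (D : cstarAlg R) (psi : X -> D) (x y : envelope) : P psi ->
  extend psi (x - y) = extend psi x - extend psi y.
Proof. by move=> Pp; rewrite extendD // extendZ // scaleN1r. Qed.

(** Choose formal combinations within $2^{-n}$ of [x n] in every representation at once; by
    uniformity they converge to the pointwise limits and so define an element of the envelope. *)
Lemma envelope_complete_seq (x : nat -> envelope) :
  (forall e : R, 0 < e -> exists N, forall m n, (N <= m)%N -> (N <= n)%N ->
     env_norm (x m - x n) <= e) ->
  exists z, forall e : R, 0 < e -> exists N, forall n, (N <= n)%N ->
     env_norm (x n - z) <= e.
Proof.
move=> cx.
have /choice [t ht] n : exists t : T, forall (D : cstarAlg R) (psi : X -> D), P psi ->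
    rn (evl psi t - extend psi (x n)) <= (1 / 2) ^+ n.
  have [u [cu _]] := envelope_limit (x n).
  have [|N hN] := cu ((1 / 2) ^+ n); first by rewrite exprn_gt0 // divr_gt0.
  by exists (u N); exact: hN.
pose L : family := fun D psi => xget 0 [set z | forall e : R, 0 < e -> exists N,
  forall n, (N <= n)%N -> rn (extend psi (x n) - z) <= e].
have LP (D : cstarAlg R) (psi : X -> D) : P psi -> forall e : R, 0 < e ->
    exists N, forall n, (N <= n)%N -> rn (extend psi (x n) - L D psi) <= e.
  move=> Pp; rewrite /L; case: xgetP => [//|nz].
  have [|l hl] := @rn_complete R D (fun n => extend psi (x n)); last by case: (nz l).
  move=> e e0; have [N hN] := cx e e0; exists N => m n Nm Nn.
  by rewrite -extendB //; apply: le_trans (env_norm_ub _ Pp) (hN _ _ Nm Nn).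
have Lu (e : R) : 0 < e -> exists N, forall n, (N <= n)%N ->
    family_le (fun D psi => extend psi (x n) - L D psi) e.
  move=> e0; have e20 : 0 < e / 2 by lra.
  have [N hN] := cx _ e20; exists N => n Nn D psi Pp.
  have [N' hN'] := LP D psi Pp _ e20.
  have := hN' _ (leq_maxr N N').
  have := le_trans (env_norm_ub _ Pp) (hN n _ Nn (leq_maxl N N')); rewrite extendB //.
  have := rn_triangle (extend psi (x (maxn N N'))) (extend psi (x n)) (L D psi).
  lra.
have tL : bounded_limit t L.
  split.
    move=> e e0; have e20 : 0 < e / 2 by lra.
    have [N hN] := Lu _ e20; have [N' hN'] := half_exp_small e20.
    exists (maxn N N') => n; rewrite geq_max => /andP[Nn N'n] D psi Pp.
    have := rn_triangle (extend psi (x n)) (evl psi (t n)) (L D psi).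
    have := hN n Nn D psi Pp; have := ht n D psi Pp; have := hN' n N'n; lra.
  have [N hN] := Lu 1 ltr01; exists (env_norm (x N) + 1).
    by have := env_norm_ge0 (x N); lra.
  move=> D psi Pp; have := hN N (leqnn N) D psi Pp; have := env_norm_ub (x N) Pp.
  have := rn_triangle (extend psi (x N)) (L D psi) 0.
  by rewrite (rnB (L D psi) (extend _ _)) !subr0; lra.
have [z hz] := envelope_ex tL; exists z => e e0.
have [N hN] := Lu e e0; exists N => n Nn; apply: env_norm_le; first exact: ltW.
by move=> D psi Pp; rewrite extendB // hz //; exact: hN.
Qed.

(** A sequence suffices: [y n] is the centre of a ball of radius $2^{-n}$ that belongs to the
    filter. *)
Lemma envelope_cauchy_cvg (F : set_system envelope) : ProperFilter F -> cauchy F -> cvg F.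
Proof.
move=> FF /cauchyP cF.
have ballE (x y : envelope) (d : R) : ball x d%:C%C y <-> env_norm (x - y) < d.
  by rewrite -ball_normE /ball_ /= envelope_normE ltcR.
have normB (x y : envelope) : env_norm (x - y) = env_norm (y - x).
  exact: (congr1 (@complex.Re R) (distrC x y)).
have /choice [y hy] n : exists y : envelope, F (ball y ((1 / 2) ^+ n : R)%:C%C).
  by apply: cF; rewrite ltcR exprn_gt0 // divr_gt0.
have triangle (y0 x z : envelope) : env_norm (x - z) <= env_norm (x - y0) + env_norm (y0 - z).
  by have := env_normD (x - y0) (y0 - z); rewrite addrA subrK.
have [|z hz] := @envelope_complete_seq y.
  move=> e e0; have e20 : 0 < e / 2 by lra.
  have [N hN] := half_exp_small e20; exists N => m n Nm Nn.
  have [w [/ballE wm /ballE wn]] := filter_ex (filterI (hy m) (hy n)).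
  apply: le_trans (triangle w (y m) (y n)) _; rewrite [leRHS]splitr; apply: lerD.
    exact: le_trans (ltW wm) (hN m Nm).
  by have := le_trans (ltW wn) (hN n Nn); have := normB (y n) w => ->.
apply/cvg_ex; exists z; apply/cvg_ballP => e e0.
have : e \is Num.real by rewrite realE ltW.
case: e e0 => d b; rewrite complex_real => e0 /eqP /= b0; subst b.
have d0 : 0 < d by move: e0; rewrite ltcR.
have d20 : 0 < d / 2 by lra.
have [N hN] := half_exp_small d20; have [N' hN'] := hz _ d20.
apply: filterS (hy (maxn N N')) => w /ballE h; apply/ballE.
apply: le_lt_trans (triangle (y (maxn N N')) z w) _; rewrite [ltRHS]splitr.
apply: ler_ltD; last exact: lt_le_trans h (hN _ (leq_maxl N N')).
by have := hN' _ (leq_maxr N N'); have := normB (y (maxn N N')) z => ->.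
Qed.

HB.instance Definition _ := Uniform_isComplete.Build envelope envelope_cauchy_cvg.

Lemma envMA : associative envM.
Proof. by move=> x y z; apply: envelope_ext => D psi Pp; rewrite !extendM // cmulA. Qed.

Lemma envMDl : left_distributive envM +%R.
Proof.
by move=> x y z; apply: envelope_ext => D psi Pp; rewrite !(extendM, extendD) // cmulDl.
Qed.

Lemma envMDr : right_distributive envM +%R.
Proof.
by move=> x y z; apply: envelope_ext => D psi Pp; rewrite !(extendM, extendD) // cmulDr.
Qed.

Lemma envMZl (a : C) (x y : envelope) : envM (a *: x) y = a *: envM x y.
Proof.
by apply: envelope_ext => D psi Pp; rewrite !(extendM, extendZ) // cmulZl.
Qed.

Lemma envMZr (a : C) (x y : envelope) : envM x (a *: y) = a *: envM x y.
Proof.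
by apply: envelope_ext => D psi Pp; rewrite !(extendM, extendZ) // cmulZr.
Qed.

Lemma env_starK : involutive env_star.
Proof. by move=> x; apply: envelope_ext => D psi Pp; rewrite !extend_star // cstarK. Qed.

Lemma env_starD : {morph env_star : x y / x + y}.
Proof.
by move=> x y; apply: envelope_ext => D psi Pp; rewrite !(extend_star, extendD) // cstarD.
Qed.

Lemma env_starZ (a : C) (x : envelope) : env_star (a *: x) = a^* *: env_star x.
Proof.
by apply: envelope_ext => D psi Pp; rewrite !(extend_star, extendZ) // cstarZ.
Qed.

Lemma env_starM (x y : envelope) : env_star (envM x y) = envM (env_star y) (env_star x).
Proof.
by apply: envelope_ext => D psi Pp; rewrite !(extend_star, extendM) // cstarM.
Qed.

Lemma env_normM (x y : envelope) : `|envM x y| <= `|x| * `|y|.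
Proof.
change ((env_norm (envM x y))%:C%C <= (env_norm x)%:C%C * (env_norm y)%:C%C :> C).
rewrite -rmorphM lecR; apply: env_norm_le => [|D psi Pp].
  by rewrite mulr_ge0 ?env_norm_ge0.
by rewrite extendM //; apply: rnM_le; exact: env_norm_ub.
Qed.

Lemma env_norm_star (x : envelope) : `|envM (env_star x) x| = `|x| ^+ 2.
Proof.
change ((env_norm (envM (env_star x) x))%:C%C = (env_norm x)%:C%C ^+ 2 :> C).
rewrite -rmorphXn; congr (_%:C%C); apply/le_anti/andP; split.
  apply: env_norm_le => [|D psi Pp]; first exact: sqr_ge0.
  rewrite extendM // extend_star // rn_starM ler_pXn2r ?nnegrE ?rn_ge0 ?env_norm_ge0 //.
  exact: env_norm_ub.
have n0 := env_norm_ge0 (envM (env_star x) x).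
rewrite -(sqr_sqrtr n0) ler_pXn2r ?nnegrE ?env_norm_ge0 ?sqrtr_ge0 //.
apply: env_norm_le => [|D psi Pp]; first exact: sqrtr_ge0.
rewrite -(@ler_pXn2r _ 2) ?nnegrE ?rn_ge0 ?sqrtr_ge0 // sqr_sqrtr //.
by have := env_norm_ub (envM (env_star x) x) Pp; rewrite extendM // extend_star // rn_starM.
Qed.

Definition envelope_alg : cstarAlg R := @CStarAlg R envelope envM env_star
  envMA envMDl envMDr envMZl envMZr env_starK env_starD env_starZ env_starM
  env_normM env_norm_star.

Lemma extend_hom (D : cstarAlg R) (psi : X -> D) : P psi ->
  is_star_hom (extend psi : envelope_alg -> D).
Proof.
move=> Pp; split => *; [exact: extendD|exact: extendZ|exact: extendM|exact: extend_star].
Qed.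

Lemma evl_hom (B D : cstarAlg R) (F : B -> D) (phi : X -> B) l : is_star_hom F ->
  F (evl phi l) = evl (F \o phi) l.
Proof.
move=> hF; have FE t : F (seval phi t) = seval (F \o phi) t.
  elim: t => //= [|t IHt u IHu|t IHt].
  - exact: star_hom0.
  - by rewrite (star_homM hF) IHt IHu.
  - by rewrite (star_hom_star hF) IHt.
rewrite /evl; elim: l => [|p l IH]; first by rewrite !big_nil star_hom0.
by rewrite !big_cons (star_homD hF) (star_homZ hF) IH FE.
Qed.

Hypothesis generators_bounded :
  forall x, exists M, family_le (fun D psi => psi x) M.

Lemma env_gen_ex x : exists z : envelope, forall (D : cstarAlg R) (psi : X -> D),
  P psi -> extend psi z = psi x.
Proof.
have [M xM] := generators_bounded x.
have E (D : cstarAlg R) (psi : X -> D) : evl psi [:: (1, SGen x)] = psi x.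
  by rewrite /evl big_seq1 scale1r.
have M0 : 0 <= Num.max 0 M by rewrite le_max lexx.
have hM : family_le (fun D psi => evl psi [:: (1, SGen x)]) (Num.max 0 M).
  by move=> D psi Pp; rewrite E le_max (xM D psi Pp) orbT.
have [z hz] := envelope_ex (bounded_limit_cst M0 hM).
by exists z => D psi Pp; rewrite hz.
Qed.

Definition env_gen x : envelope_alg := projT1 (cid (env_gen_ex x)).

Lemma extend_gen (D : cstarAlg R) (psi : X -> D) x : P psi -> extend psi (env_gen x) = psi x.
Proof. exact: (projT2 (cid (env_gen_ex x))). Qed.

Lemma extend_evl (D : cstarAlg R) (psi : X -> D) l : P psi ->
  extend psi (evl env_gen l) = evl psi l.
Proof.
move=> Pp; rewrite (evl_hom _ _ (extend_hom Pp)); congr (evl _ l).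
by apply/funext => x /=; exact: extend_gen.
Qed.

Lemma env_gen_dense : dense (range (evl env_gen)).
Proof.
apply: rn_dense => x e e0; have [u [cu _]] := envelope_limit x.
have [N hN] := cu e e0; exists (evl env_gen (u N)); first by exists (u N).
apply: (@env_norm_le (x - evl env_gen (u N))); first exact: ltW.
move=> D psi Pp; rewrite extendB // extend_evl // rnB; exact: hN.
Qed.

End Envelope.

(** * The isomorphism *)

Section UniversalAlgebra.
Variables (R : realType) (G : sepGraph) (A : adaptable G).
Local Notation C := R[i].
Local Notation gG := (germ A).
Local Notation P := (fun D => @satisfies_R1_R10 R G A D).

Lemma R1_R10_bounded (x : sgen G) : exists M, family_le P (fun D psi => psi x) M.
Proof.
exists 1 => D psi Pp; rewrite -(iota_gen Pp); exact: rn_iota.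
Qed.

Definition universal_alg : cstarAlg R := envelope_alg P.
Definition universal_gen (x : sgen G) : universal_alg := env_gen R1_R10_bounded x.

Lemma extend_seval (D : cstarAlg R) (psi : sgen G -> D) t : satisfies_R1_R10 A psi ->
  extend psi (seval universal_gen t : universal_alg) = seval psi t.
Proof.
move=> Pp; have := extend_evl R1_R10_bounded [:: (1, t)] Pp.
by rewrite /evl !big_seq1 !scale1r.
Qed.

Lemma universal_gen_R1_R10 : satisfies_R1_R10 A universal_gen.
Proof.
split=> [t u tu|v Y bY]; apply: envelope_ext => D psi Pp.
  by rewrite !extend_seval //; exact: Pp.1.
have /finite_seqP[l YE] := ad_finsep A bY.
have YE' : Y = [set` undup l] by rewrite YE; apply/seteqP; split=> e /=; rewrite mem_undup.
have hF := extend_hom Pp.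
have hs (r : seq (edge G)) (f : edge G -> universal_alg) :
    extend psi (\sum_(e <- r) f e) = \sum_(e <- r) extend psi (f e).
  elim: r => [|e r IH]; first by rewrite !big_nil; exact: (star_hom0 hF).
  by rewrite !big_cons -IH; exact: (star_homD hF).
rewrite extend_gen // (Pp.2 v Y bY) YE' -!fsbig_seq ?undup_uniq // hs.
apply: eq_bigr => e _; rewrite -(extend_gen R1_R10_bounded (gE e) Pp).
by rewrite (star_homM hF) (star_hom_star hF).
Qed.

Lemma evl_universal_ext (B D : cstarAlg R) (phi : sgen G -> B) (F H : B -> D) :
  is_star_hom F -> is_star_hom H -> dense (range (evl phi)) ->
  (forall x, F (phi x) = H (phi x)) -> F = H.
Proof.
move=> hF hH dphi e; apply: star_hom_dense_eq dphi _ => // _ [l _ <-].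
by rewrite !evl_hom //; congr (evl _ l); apply/funext => x /=.
Qed.

Lemma universal_algP : is_universal A universal_gen.
Proof.
split; first exact: universal_gen_R1_R10.
move=> D psi Pp; exists (extend psi); split.
  by split; [exact: extend_hom|move=> g; exact: extend_gen].
move=> F [hF Fg]; apply: (evl_universal_ext (extend_hom Pp) hF
  (@env_gen_dense _ _ _ R1_R10_bounded)).
by move=> x; exact: etrans (extend_gen R1_R10_bounded x Pp) (esym (Fg x)).
Qed.

Lemma evl_iol (B : cstarAlg R) (phi : sgen G -> B) l : satisfies_R1_R10 A phi ->
  evl phi l = iol phi [seq (p.1, pcls (srel A) p.2) | p <- l].
Proof.
move=> Pp; rewrite /evl /iol big_map; apply: eq_bigr => p _ /=.
by rewrite iotaS_cls.
Qed.

(** The universal algebra itself serves as $C^*(\mathcal G)$. A representation [pi] of $C_c$ yields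
    generators satisfying (R1)-(R10), and the induced homomorphism maps [pi_rep] of [ev L] to
    [pi (ev L)]; its contractivity is the norm inequality for the functions [ev L]. All others
    follow by approximation with a fixed support. *)
Lemma universal_full : is_full_groupoid_cstar (@pi_rep R G A universal_alg universal_gen).
Proof.
have Pu := universal_gen_R1_R10.
have jP := pi_rep_Cc Pu.
split => // [|D pi piP f cf].
  apply: rn_dense => x e e0.
  have [y [l _ <-] h] := dense_rn (@env_gen_dense _ _ _ R1_R10_bounded) x e0.
  exists (evl universal_gen l); last exact: h.
  rewrite evl_iol // -(pi_rep_ev Pu).
  by exists (ev [seq (p.1, pcls (srel A) p.2) | p <- l]) => //; exact: Cc_ev.
have Pp := rho_R1_R10 piP; have hF := extend_hom Pp.
have evlE L : rn (pi (ev L)) <= rn (pi_rep universal_gen (ev L)).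
  have -> : pi (ev L) = extend (rho_gen pi) (pi_rep universal_gen (ev L)).
    rewrite (pi_rep_ev Pu) (rho_ev piP) /iol.
    elim: L => [|p L IH]; first by rewrite !big_nil (star_hom0 hF).
    rewrite !big_cons (star_homD hF) (star_homZ hF) -IH; congr (_ *: _ + _).
    by rewrite -(rho_gen_iota piP) /iotaS extend_seval.
  exact: star_hom_contractive.
have [K sf] := Cc_bsupp cf.
pose k : R := (size K)%:R.
have k0 : 0 <= k by exact: ler0n.
rewrite !normE lecR -subr_le0; apply: (@le_eps0 _ _ (2 * k)) => e e0 _.
have [L sL hL] := ev_dense cf sf e0.
have appr (B : cstarAlg R) (rho : (gG -> C) -> B) : is_Cc_rep rho ->
    rn (rho f - rho (ev L)) <= k * e.
  by move=> rhoP; apply: rn_rho_sub => //; [exact: ltW|exact: Cc_ev].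
have h1 := appr _ _ piP; have h2 := appr _ _ jP; have h3 := evlE L.
have := rn_triangle (pi (ev L)) (pi f) 0.
have := rn_triangle (pi_rep universal_gen f) (pi_rep universal_gen (ev L)) 0.
rewrite (rnB (pi_rep _ (ev L)) (pi_rep _ f)) !subr0; lra.
Qed.

End UniversalAlgebra.

Section Isomorphism.
Variables (R : realType) (G : sepGraph) (A : adaptable G).
Local Notation C := R[i].
Local Notation S := (SE A).
Local Notation gG := (germ A).
Variables (CS : cstarAlg R) (phi : sgen G -> CS).
Variables (CG : cstarAlg R) (j : (gG -> C) -> CG).
Hypotheses (phiU : is_universal A phi) (jF : is_full_groupoid_cstar j).

Lemma ev_dense_full x (e : R) : 0 < e -> exists L : seq (C * S), rn (x - j (ev L)) <= e.
Proof.
have jP := full_rep jF => e0; have e20 : 0 < e / 2 by lra.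
have [_ [f cf <-] h1] := dense_rn (full_dense jF) x e20.
have [K sf] := Cc_bsupp cf; pose k : R := (size K)%:R + 1.
have k0 : 0 < k by rewrite ltr_wpDl.
have d0 : 0 < e / 2 / k by exact: divr_gt0.
have [L sL hL] := ev_dense cf sf d0; exists L.
have h2 := rn_rho_sub jP (ltW d0) cf (Cc_ev L) sf sL hL.
have h3 : (size K)%:R * (e / 2 / k) <= e / 2.
  rewrite mulrCA; apply: ler_piMr; first exact: ltW.
  by rewrite ler_pdivrMr // mul1r /k lerDl.
have := rn_triangle (j f) x (j (ev L)); lra.
Qed.

(** By maximality of the norm of [CG], applied to the representation [pi_rep phi], the assignment of
    [iol phi L] to [j (ev L)] is contractive; hence it is well defined and extends. *)
Lemma full_to_universal : exists2 Psi : CG -> CS, is_star_hom Psi &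
  forall L, Psi (j (ev L)) = iol phi L.
Proof.
have jP := full_rep jF; have [phiP _] := phiU.
pose Gr (y : CG) (x : CS) := exists2 L, y = j (ev L) & x = iol phi L.
have [| | | | | |Psi hPsi PsiE] := @graph_star_hom R CG CS Gr.
- move=> _ _ _ _ [L -> ->] [L' -> ->]; exists (L ++ L'); rewrite ?iol_cat //.
  rewrite -(Cc_repD jP) ?Cc_ev //; [congr j|exact: Cc_ev|exact: Cc_ev].
  by apply/funext => g; rewrite ev_cat.
- move=> a _ _ [L -> ->]; exists (lscale a L); rewrite ?iol_scale //.
  rewrite -(Cc_repZ jP); [congr j|exact: Cc_ev].
  by apply/funext => g; rewrite ev_scale.
- move=> _ _ _ _ [L -> ->] [L' -> ->]; exists (lmul L L'); rewrite ?iol_mul //.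
  by rewrite -(Cc_repM jP) ?conv_ev //; exact: Cc_ev.
- move=> _ _ [L -> ->]; exists (lstar L); rewrite ?iol_star //.
  by rewrite -(Cc_rep_star jP) ?star_ev //; exact: Cc_ev.
- move=> _ _ [L -> ->]; rewrite -(pi_rep_ev phiP) -lecR -!normE.
  by apply: (full_norm jF (pi_rep_Cc phiP)); exact: Cc_ev.
- move=> x e e0; have [L h] := ev_dense_full x e0.
  by exists (j (ev L)), (iol phi L); split => //; exists L.
by exists Psi => // L; apply: PsiE; exists L.
Qed.

Lemma universal_iso_full : exists Phi : CS -> CG, is_star_iso Phi /\
  forall s : S, Phi (iotaS phi s) = j (chi R s).
Proof.
have jP := full_rep jF; have [phiP phiUniv] := phiU.
have [Psi hPsi PsiE] := full_to_universal.
have [Phi [[hPhi Phig] _]] := phiUniv CG _ (rho_R1_R10 jP).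
have Phis s : Phi (iotaS phi s) = j (chi R s).
  have h := evl_hom phi [:: (1, repr s)] hPhi; rewrite /evl !big_seq1 !scale1r in h.
  rewrite /iotaS h -(rho_gen_iota jP); congr (seval _ _).
  by apply/funext => x /=.
exists Phi; split => //; split => //; exists Psi.
  (* [Psi \o Phi] and the identity both fix the generators, so uniqueness in the universal property
     for [phi] itself identifies them. The other composite is compared with the identity on the
     dense set of the [j (ev L)]. *)
  have [U [_ Uuniq]] := phiUniv CS phi phiP.
  have UE (F : CS -> CS) : is_star_hom F -> (forall x, F (phi x) = phi x) -> U = F.
    by move=> hF Fg; apply: Uuniq.
  have PsiPhi : U = Psi \o Phi.
    apply: UE => [|x /=].
      split=> [x y|a x|x y|x] /=.
      - by rewrite (star_homD hPhi) (star_homD hPsi).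
      - by rewrite (star_homZ hPhi) (star_homZ hPsi).
      - by rewrite (star_homM hPhi) (star_homM hPsi).
      - by rewrite (star_hom_star hPhi) (star_hom_star hPsi).
    rewrite Phig /rho_gen -ev1 PsiE /iol big_seq1 scale1r.
    exact: iota_gen.
  have idE : U = id by apply: UE.
  by move=> x; rewrite -[LHS]/((Psi \o Phi) x) -PsiPhi idE.
have hid : is_star_hom (id : CG -> CG) by [].
have hPP : is_star_hom (Phi \o Psi).
  split=> [x y|a x|x y|x] /=.
  - by rewrite (star_homD hPsi) (star_homD hPhi).
  - by rewrite (star_homZ hPsi) (star_homZ hPhi).
  - by rewrite (star_homM hPsi) (star_homM hPhi).
  - by rewrite (star_hom_star hPsi) (star_hom_star hPhi).
have dev : dense (range (fun L => j (ev L))).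
  apply: rn_dense => x e e0; have [L h] := ev_dense_full x e0.
  by exists (j (ev L)) => //; exists L.
suff PhiPsi : Phi \o Psi = id by move=> x; exact: (congr1 (@^~ x) PhiPsi).
apply: star_hom_dense_eq dev _ => // _ [L _ <-] /=.
rewrite PsiE (rho_ev jP) /iol; elim: L => [|p L IH]; first by rewrite !big_nil (star_hom0 hPhi).
by rewrite !big_cons (star_homD hPhi) (star_homZ hPhi) IH Phis.
Qed.

End Isomorphism.

(** Both algebras enter through their defining properties; the two existence clauses make sure that
    the third clause is not vacuous. *)
Theorem corollary4p15 (R : realType) (G : sepGraph) (A : adaptable G) :
  (exists (CS : cstarAlg R) (phi : sgen G -> CS), is_universal A phi) /\
  (exists (CG : cstarAlg R) (j : (germ A -> R[i]) -> CG),
     is_full_groupoid_cstar j) /\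
  forall (CS : cstarAlg R) (phi : sgen G -> CS)
         (CG : cstarAlg R) (j : (germ A -> R[i]) -> CG),
    is_universal A phi -> is_full_groupoid_cstar j ->
    exists Phi : CS -> CG, is_star_iso Phi /\
      forall s : SE A,
        Phi (iotaS phi s) = j \1_(Theta s (Dom (pmul (pstar s) s))).
Proof.
split; first by exists (universal_alg R A), (@universal_gen R G A); exact: universal_algP.
split; first by exists (universal_alg R A), (pi_rep (@universal_gen R G A)); exact: universal_full.
move=> CS phi CG j phiU jF; exact: universal_iso_full phiU jF.
Qed.
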